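(* Let $\mu=(\mu_1,\dots,\mu_m)$, $\nu=(\nu_1,\dots,\nu_n)$ be ordered partitions of the same positive integer and let $\delta=\sum_{i\in I}\mu_i-\sum_{j\in J}\nu_j$, where $I\subset\{1,\dots,m\}$, $J\subset\{1,\dots,n\}$ define the wall $\delta=0$ of $\mathcal{W}(m,n)$. Let $\mathcal{WC}^{\le}_\delta$ and $\mathcal{WC}^{<}_\delta$ be the wall-crossings at $\delta=0$ between adjacent chambers $\mathfrak{c}_1$ (where $\delta<0$) and $\mathfrak{c}_2$ (where $\delta>0$). Then $$\mathcal{WC}^{\le}_\delta(\underline{u},\underline{z})=\delta^2\,\frac{\varsigma(z_J)\,\varsigma(z_{J^c})\,\varsigma(\delta z_{[n]})}{\varsigma(\delta z_J)\,\varsigma(\delta z_{J^c})\,\varsigma(z_{[n]})}\ [(u')^0]\ \mathcal{H}^{\le}_{\mu^I,\nu^J+\delta}(\underline{u}^J,u',\underline{z}^J,0)\ \mathcal{H}^{\le}_{\mu^{I^c}+\delta,\nu^{J^c}}(\underline{u}^{J^c},\underline{z}^{J^c})$$ and $$\mathcal{WC}^{<}_\delta(\underline{u},\underline{z})=\delta^2\,\frac{\varsigma(z_J)\,\varsigma(z_{J^c})\,\varsigma(\delta z_{[n]})}{\varsigma(\delta z_J)\,\varsigma(\delta z_{J^c})\,\varsigma(z_{[n]})}\ [(u')^0]\ \mathcal{H}^{<}_{\mu^I,\nu^J+\delta}(\underline{u}^J,u',\underline{z}^J,0)\ \mathcal{H}^{<}_{\mu^{I^c}+\delta,\nu^{J^c}}(\underline{u}^{J^c},\underline{z}^{J^c}).$$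 Here the argument $0$ is the $z$-variable related to $\delta$ in $\mathcal{H}_{\mu^I,\nu^J+\delta}$ (and $u'$ is the corresponding $u$-variable).
   Context: **Notation.** $\varsigma(z)=e^{z/2}-e^{-z/2}$, $\mathcal{S}(z)=\varsigma(z)/z$, $[n]=\{1,\dots,n\}$. Ordered partitions are finite tuples of positive integers. For $I\subset[m]$, $J\subset[n]$: $\mu_I=\sum_{i\in I}\mu_i$, $\nu_J=\sum_{j\in J}\nu_j$, $z_J=\sum_{j\in J}z_j$; $I^c,J^c$ are complements; $\mu^I$ is the partition $(\mu_i)_{i\in I}$, $\underline u^J=(u_j)_{j\in J}$, $\underline z^J=(z_j)_{j\in J}$; $\mu+\delta$ denotes the partition $(\mu,\delta)$ obtained by appending $\delta$ as a part. $[(u')^0]$ is coefficient extraction. **Semi-infinite wedge.** Let $V=\bigoplus_{i\in\mathbb{Z}+1/2}\mathbb{C}\,\underline{i}$. The semi-infinite wedge space is spanned by $\underline{k_1}\wedge\underline{k_2}\wedge\cdots$ (with $\wedge$ antisymmetric) such that $k_i+i-\frac12$ is constant (the charge) for large $i$; the charge-zero part $\mathcal{V}_0$ has basis $v_\lambda=\underline{\lambda_1-\frac12}\wedge\underline{\lambda_2-\frac32}\wedge\cdots$ over partitions $\lambda$, declared orthonormal. $|0\rangle=v_\emptyset$, $\langle\mathcal{P}\rangle=\langle0|\mathcal{P}|0\rangle$. $\psi_k$ is left wedging with $\underline{k}$, $\psi_k^\dagger$ its adjoint; $E_{i,j}=\psi_i\psi_j^\dagger$ if $j>0$ and $-\psi_j^\dagger\psi_i$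 if $j<0$. For $a\in\mathbb{Z}$, $$\mathcal{E}_a(z)=\sum_{k\in\mathbb{Z}+1/2}e^{z(k-a/2)}E_{k-a,k}+\frac{\delta_{a,0}}{\varsigma(z)}$$ ($\delta_{a,0}$ being the Kronecker delta). Products of operators are ordered from left to right by increasing index. **Refined generating series.** For ordered partitions $\mu=(\mu_1,\dots,\mu_m)$, $\nu=(\nu_1,\dots,\nu_n)$ of the same integer, $$\mathcal{H}^{\le}_{\mu,\nu}(\underline{u},\underline{z})=\sum_{v_1,\dots,v_n\ge0}u_1^{v_1}\cdots u_n^{v_n}\prod_{j=1}^n\frac{(v_j+\nu_j-1)!}{(\nu_j-1)!}\prod_{j=1}^n\mathcal{S}(z_j)^{\nu_j-1}\,\frac{\big\langle\prod_{i=1}^m\mathcal{E}_{\mu_i}(0)\prod_{j=1}^n\mathcal{E}_{-\nu_j}(z_j)\big\rangle}{\prod_i\mu_i\prod_j\nu_j},$$ $$\mathcal{H}^{<}_{\mu,\nu}(\underline{u},\underline{z})=\sum_{0\le v_j\le\nu_j}u_1^{v_1}\cdots u_n^{v_n}\prod_{j=1}^n\frac{\nu_j!}{(\nu_j-v_j)!}\prod_{j=1}^n\mathcal{S}(z_j)^{-\nu_j-1}\,\frac{\big\langle\prod_{i=1}^m\mathcal{E}_{\mu_i}(0)\prod_{j=1}^n\mathcal{E}_{-\nu_j}(z_j)\big\rangle}{\prod_i\mu_i\prod_j\nu_j}.$$ **Chambers and wall-crossing.** $\mathcal{H}(m,n)$ is the set of pairs $(\mu,\nu)$ of tuples of positive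 integers of lengths $m,n$ with equal sums. The hyperplane arrangement $\mathcal{W}(m,n)$ in it consists of the walls $\mu_K=\nu_L$ with $K\subset[m]$, $L\subset[n]$ (the trivial equations for $(K,L)=(\emptyset,\emptyset),([m],[n])$ define no wall). A chamber is the set of all points at the same side of each wall. Adjacent chambers $\mathfrak{c}_1,\mathfrak{c}_2$ are chambers separated by the wall $\delta=0$ and both bordering it in codimension one; by convention $\delta<0$ on $\mathfrak{c}_1$ and $\delta>0$ on $\mathfrak{c}_2$. In a chamber $\mathfrak{c}$, each coefficient in $\underline z$ of $\big\langle\prod_{i}\mathcal{E}_{\mu_i}(0)\prod_{j}\mathcal{E}_{-\nu_j}(z_j)\big\rangle$ is given by a polynomial in $(\mu,\nu)$ depending only on $\mathfrak{c}$; let $q^{\mathfrak{c}}(\underline z)$ be the resulting series with coefficients polynomial in $(\mu,\nu)$. Let $\mathcal{H}^{\le}_{\mu,\nu}(\mathfrak{c},\underline u,\underline z)$ and $\mathcal{H}^{<}_{\mu,\nu}(\mathfrak{c},\underline u,\underline z)$ be given by the formulas for $\mathcal{H}^{\le}_{\mu,\nu}$, $\mathcal{H}^{<}_{\mu,\nu}$ with the vacuum expectation replaced by $q^{\mathfrak{c}}(\underline z)$. For $\bullet\in\{\le,<\}$, $$\mathcal{WC}^{\bullet}_\delta(\underline u,\underline z)=\mathcal{H}^{\bullet}_{\mu,\nu}(\mathfrak{c}_2,\underline u,\underline z)-\mathcal{H}^{\bullet}_{\mu,\nu}(\mathfrak{c}_1,\underline u,\underline z).$$ *)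

(* Defs.v *)
From HB Require Import structures.
From mathcomp Require Import all_boot all_order all_algebra.
From mathcomp Require Import finmap boolp classical_sets functions cardinality fsbigop reals.
From mathcomp Require Import complex.
From mathcomp Require Import mpoly freeg.

Set Implicit Arguments.
Unset Strict Implicit.
Unset Printing Implicit Defensive.

Import Order.TTheory GRing.Theory Num.Theory.
Local Open Scope ring_scope.

(* Formal power series in n variables: f m is the coefficient of the monomial
   with exponent vector m. *)

Record mps (n : nat) (R : Type) := Mps { mps_coef :> 'X_{1..n} -> R }.

Lemma mpsP (n : nat) (R : Type) (f g : mps n R) : f =1 g -> f = g.
Proof. by case: f g => [f] [g] /= /funext ->. Qed.

HB.instance Definition _ (n : nat) (R : Type) := gen_eqMixin (mps n R).
HB.instance Definition _ (n : nat) (R : Type) := gen_choiceMixin (mps n R).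

Section Ring.
Context (n : nat) (R : comNzRingType).
Implicit Types (f g h : mps n R) (m : 'X_{1..n}).

Definition mps_zero : mps n R := Mps (fun _ => 0).
Definition mps_opp f : mps n R := Mps (fun m => - f m).
Definition mps_add f g : mps n R := Mps (fun m => f m + g m).
Definition mps_one : mps n R := Mps (fun m => (m == 0%MM)%:R).
Definition mps_mul f g : mps n R := Mps (fun m =>
  \sum_(k : 'X_{1..n < (mdeg m).+1, (mdeg m).+1} | m == (k.1 + k.2)%MM)
     f k.1 * g k.2).
Definition mps_scale (c : R) f : mps n R := Mps (fun m => c * f m).

Fact mps_addA : associative mps_add.
Proof. by move=> f g h; apply: mpsP => m /=; rewrite addrA. Qed.
Fact mps_addC : commutative mps_add.
Proof. by move=> f g; apply: mpsP => m /=; rewrite addrC. Qed.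
Fact mps_add0 : left_id mps_zero mps_add.
Proof. by move=> f; apply: mpsP => m /=; rewrite add0r. Qed.
Fact mps_addN : left_inverse mps_zero mps_opp mps_add.
Proof. by move=> f; apply: mpsP => m /=; rewrite addNr. Qed.

HB.instance Definition _ := GRing.isZmodule.Build (mps n R)
  mps_addA mps_addC mps_add0 mps_addN.

Definition mps_trunc (d : nat) f : {mpoly R[n]} :=
  \sum_(m : 'X_{1..n < d}) f m *: 'X_[m].

Lemma mcoeff_trunc d f m : (mdeg m < d)%N -> (mps_trunc d f)@_m = f m.
Proof. by move=> lt_md; rewrite /mps_trunc mcoeff_mpoly. Qed.

Lemma mps_mul_trunc d f g m : (mdeg m < d)%N ->
  mps_mul f g m = (mps_trunc d f * mps_trunc d g)@_m.
Proof.
move=> lt_md; rewrite mcoeffM /=; apply: eq_bigr => k _.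
by rewrite !mcoeff_trunc // (leq_trans (bmdeg _)).
Qed.

Fact mps_mulA : associative mps_mul.
Proof.
move=> f g h; apply: mpsP => m; set d := (mdeg m).+1.
have lt_d (k : 'X_{1..n < (mdeg m).+1}) : (mdeg k < d)%N by apply: bmdeg.
have -> : mps_mul f (mps_mul g h) m
    = (mps_trunc d f * (mps_trunc d g * mps_trunc d h))@_m.
  rewrite mcoeffM; apply: eq_bigr => k _.
  by rewrite mcoeff_trunc // (@mps_mul_trunc d).
rewrite mulrA mcoeffM; apply: eq_bigr => k _.
by rewrite mcoeff_trunc // (@mps_mul_trunc d).
Qed.

Fact mps_mulC : commutative mps_mul.
Proof.
move=> f g; apply: mpsP => m.
by rewrite !(@mps_mul_trunc (mdeg m).+1) // mulrC.
Qed.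

Lemma mps_trunc1 d : (0 < d)%N -> mps_trunc d mps_one = 1.
Proof.
move=> d_gt0; apply/mpolyP => m; rewrite mcoeff1.
case: (ltnP (mdeg m) d) => [lt_md | le_dm]; first by rewrite mcoeff_trunc.
have /negbTE -> : m != 0%MM.
  by apply: contraTneq le_dm => ->; rewrite mdeg0 -ltnNge.
rewrite /mps_trunc raddf_sum big1 // => k _; rewrite /= mcoeffZ mcoeffX.
case: (bmnm k =P m) => [e|_]; last by rewrite mulr0.
by have := bmdeg k; rewrite e ltnNge le_dm.
Qed.

Fact mps_mul1 : left_id mps_one mps_mul.
Proof.
move=> f; apply: mpsP => m.
by rewrite (@mps_mul_trunc (mdeg m).+1) // mps_trunc1 // mul1r mcoeff_trunc.
Qed.

Fact mps_mulD : left_distributive mps_mul mps_add.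
Proof.
move=> f g h; apply: mpsP => m /=; rewrite -big_split /=.
by apply: eq_bigr => k _; rewrite mulrDl.
Qed.

Fact mps_oner_neq0 : mps_one != 0 :> mps n R.
Proof.
apply/eqP => /(congr1 (fun f : mps n R => f 0%MM)) /= /eqP.
by rewrite eqxx oner_eq0.
Qed.

HB.instance Definition _ := GRing.Zmodule_isComNzRing.Build (mps n R)
  mps_mulA mps_mulC mps_mul1 mps_mulD mps_oner_neq0.

Fact mps_scaleA c1 c2 f :
  mps_scale c1 (mps_scale c2 f) = mps_scale (c1 * c2) f.
Proof. by apply: mpsP => m /=; rewrite mulrA. Qed.
Fact mps_scale1 : left_id 1 mps_scale.
Proof. by move=> f; apply: mpsP => m /=; rewrite mul1r. Qed.
Fact mps_scaleDr : right_distributive mps_scale +%R.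
Proof. by move=> c f g; apply: mpsP => m /=; rewrite mulrDr. Qed.
Fact mps_scaleDl f : {morph mps_scale^~ f : c1 c2 / c1 + c2}.
Proof. by move=> c1 c2; apply: mpsP => m /=; rewrite mulrDl. Qed.

HB.instance Definition _ := GRing.Zmodule_isLmodule.Build R (mps n R)
  mps_scaleA mps_scale1 mps_scaleDr mps_scaleDl.

Fact mps_scaleAl (c : R) f g : c *: (f * g) = c *: f * g.
Proof.
apply: mpsP => m /=; rewrite mulr_sumr.
by apply: eq_bigr => k _; rewrite mulrA.
Qed.

HB.instance Definition _ :=
  GRing.Lmodule_isLalgebra.Build R (mps n R) mps_scaleAl.
HB.instance Definition _ := GRing.Lalgebra_isComAlgebra.Build R (mps n R).

Definition mpsX (i : 'I_n) : mps n R := Mps (fun m => (m == U_(i)%MM)%:R).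

Definition mps_unit : pred (mps n R) := fun f => `[< exists g, g * f = 1 >].
Definition mps_inv f : mps n R :=
  if pselect (exists g, g * f = 1) is left h then projT1 (cid h) else f.

Fact mps_mulVr : {in mps_unit, left_inverse 1 mps_inv *%R}.
Proof.
move=> f /asboolP fU; rewrite /mps_inv; case: pselect => [h|//].
by case: cid.
Qed.
Fact mps_unitP f g : g * f = 1 -> mps_unit f.
Proof. by move=> gf1; apply/asboolP; exists g. Qed.
Fact mps_inv_out : {in [predC mps_unit], mps_inv =1 id}.
Proof.
move=> f /negP fU; rewrite /mps_inv; case: pselect => [h|//].
by case: fU; apply/asboolP.
Qed.

HB.instance Definition _ := GRing.ComNzRing_hasMulInverse.Build (mps n R)
  mps_mulVr mps_unitP mps_inv_out.

Lemma mpsE_add f g m : (f + g) m = f m + g m. Proof. by []. Qed.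
Lemma mpsE_opp f m : (- f) m = - f m. Proof. by []. Qed.
Lemma mpsE_scale (c : R) f m : (c *: f) m = c * f m. Proof. by []. Qed.
Lemma mpsE_mul f g m : (f * g) m =
  \sum_(k : 'X_{1..n < (mdeg m).+1, (mdeg m).+1} | m == (k.1 + k.2)%MM)
     f k.1 * g k.2.
Proof. by []. Qed.

End Ring.

Section IntegralDomain.
Context (n : nat) (R : idomainType).

Lemma mps_order (f : mps n R) : f != 0 ->
  exists2 m, f m != 0 & forall k, (k < m)%O -> f k = 0.
Proof.
move=> f_neq0; have [m0 fm0] : exists m, f m != 0.
  apply: contrapT => h; case/eqP: f_neq0; apply: mpsP => m.
  by apply/eqP; case: (boolP (f m == 0)) => // fm; case: h; exists m.
elim/(well_founded_ind (@ltom_wf n)): m0 fm0 => m IH fm.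
have [[k lt_km fk]|h] := pselect (exists2 k, (k < m)%O & f k != 0).
  exact: IH fk.
exists m => // k lt_km; apply/eqP; case: (boolP (f k == 0)) => // fk.
by case: h; exists k.
Qed.

Fact mps_idomain (f g : mps n R) : f * g = 0 -> (f == 0) || (g == 0).
Proof.
move=> fg0; apply: contraTT isT => /norP[/mps_order[m1 f1 lt1]].
move=> /mps_order[m2 g2 lt2].
have /eqP := congr1 (fun h : mps n R => h (m1 + m2)%MM) fg0.
rewrite mpsE_mul /=; set d := (mdeg _).+1.
have b1 : (mdeg m1 < d)%N by rewrite ltnS mdegD leq_addr.
have b2 : (mdeg m2 < d)%N by rewrite ltnS mdegD leq_addl.
rewrite (bigD1 (BMultinom b1, BMultinom b2)) //= big1 ?addr0.
  by rewrite mulf_eq0 (negbTE f1) (negbTE g2).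
move=> [[k1 d1] [k2 d2]] /= /andP[/eqP e ne].
have [lt_k1|lt_k1|e1] := ltgtP k1 m1; first by rewrite lt1 ?mul0r.
  have [lt_k2|le_k2] := ltP k2 m2; first by rewrite lt2 ?mulr0.
  suff : ((m1 + m2)%MM < (k1 + k2)%MM)%O by rewrite e ltxx.
  by rewrite (lt_le_trans (y := (k1 + m2)%MM)) ?ltmc_add2l ?lemc_add2r.
subst k1; case/negP: ne; move/eqP: e; rewrite eqm_add2l => /eqP e; subst k2.
by apply/eqP; congr pair; apply/val_inj.
Qed.

HB.instance Definition _ :=
  GRing.ComUnitRing_isIntegral.Build (mps n R) mps_idomain.

End IntegralDomain.

Section Substitution.
Context (N : nat).

(* Locally finite infinite sum: F v is required to vanish in degrees below
   |v|, so that only the v with |v| <= |m| contribute to the coefficient of m. *)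
Definition mps_sum (R : comNzRingType) (l : nat) (F : 'X_{1..l} -> mps N R) :
    mps N R :=
  Mps (fun m => \sum_(v : 'X_{1..l < (mdeg m).+1}) F v m).

(* The series \sum_k c_k x^k, for x without constant term. *)
Definition fps_at (K : fieldType) (c : nat -> K) (x : mps N K) : mps N K :=
  Mps (fun m => \sum_(k < (mdeg m).+1) c k * (x ^+ k) m).

Definition fexp (K : fieldType) (x : mps N K) : mps N K :=
  fps_at (fun k => (k`!%:R)^-1) x.

Definition varsigma (K : fieldType) (x : mps N K) : mps N K :=
  fexp (2^-1 *: x) - fexp (- (2^-1 *: x)).

(* The coefficients of the one-variable series varsigma; calS is the quotient
   of this series by its variable, so that calS 0 = 1. *)
Definition varsigma_coef (K : fieldType) (k : nat) : K :=
  (2^-1 ^+ k - (- 2^-1) ^+ k) / k`!%:R.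

Definition calS (K : fieldType) (x : mps N K) : mps N K :=
  fps_at (fun k => varsigma_coef K k.+1) x.

Lemma mps_pow_low (R : comNzRingType) (x : mps N R) (k : nat) (m : 'X_{1..N}) :
  x 0%MM = 0 -> (mdeg m < k)%N -> (x ^+ k) m = 0.
Proof.
move=> x0; elim: k m => // k IH m lt_mk.
rewrite exprS mpsE_mul big1 // => -[[k1 d1] [k2 d2]] /= /eqP e.
have [->|k1_neq0] := eqVneq k1 0%MM; first by rewrite x0 mul0r.
rewrite IH ?mulr0 //; move: lt_mk; rewrite e mdegD.
have : (0 < mdeg k1)%N by rewrite lt0n mdeg_eq0.
by case: (mdeg k1) => // a _; rewrite addSn ltnS; apply: leq_ltn_trans (leq_addl _ _).
Qed.

Lemma fps_at_wide (K : fieldType) (c : nat -> K) (x : mps N K) m d :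
  x 0%MM = 0 -> (mdeg m < d)%N ->
  fps_at c x m = \sum_(k < d) c k * (x ^+ k) m.
Proof.
move=> x0 lt_md /=; rewrite -(big_mkord predT (fun k => c k * (x ^+ k) m)).
rewrite -[RHS](big_mkord predT (fun k => c k * (x ^+ k) m)).
rewrite [RHS](big_cat_nat (n := (mdeg m).+1)) //=.
rewrite [X in _ = _ + X]big_nat_cond [X in _ = _ + X]big1 ?addr0 //.
by move=> k; rewrite andbT => /andP[lt_mk _]; rewrite mps_pow_low ?mulr0.
Qed.

Lemma varsigmaE (K : fieldType) (x : mps N K) : x 0%MM = 0 ->
  varsigma x = fps_at (varsigma_coef K) x.
Proof.
move=> x0; apply: mpsP => m; rewrite /varsigma mpsE_add mpsE_opp /= -sumrB.
apply: eq_bigr => k _; rewrite -scaleNr !exprZn !mpsE_scale /varsigma_coef.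
by rewrite mulrBl mulrBl !mulrA ![_ ^-1 * _]mulrC.
Qed.

Lemma varsigma_calS (K : fieldType) (x : mps N K) : x 0%MM = 0 ->
  varsigma x = x * calS x.
Proof.
move=> x0; rewrite varsigmaE //; apply: mpsP => m.
rewrite (@fps_at_wide _ _ _ _ (mdeg m).+2) // big_ord_recl.
rewrite {1}/varsigma_coef !expr0 subrr mul0r mul0r add0r.
rewrite mpsE_mul; under [RHS]eq_bigr => k _ do
  rewrite (@fps_at_wide _ _ _ _ (mdeg m).+1) ?bmdeg // mulr_sumr.
rewrite exchange_big /=; apply: eq_bigr => k _.
rewrite /bump /= add1n exprS mpsE_mul mulr_sumr.
by apply: eq_bigr => l _; rewrite mulrCA.
Qed.

End Substitution.

(* The coefficient of the d-th power of the last variable. *)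
Definition last_coef (N : nat) (R : Type) (d : nat) (f : mps N.+1 R) : mps N R :=
  Mps (fun m => f (Multinom [tuple of rcons (multinom_val m) d])).

(* Encoding of the semi-infinite wedge space: the half-integer k + 1/2 is
   represented by k : int, so that the positive half-integers are the k >= 0.
   The basis vector k_1 /\ k_2 /\ ... with k_1 > k_2 > ... is represented by the
   finite symmetric difference S : {fset int} of {k_1, k_2, ...} with
   {-1/2, -3/2, ...}; the vacuum is fset0.  All charges are included; the
   operators E_{i, j} preserve the charge. *)

Notation wedge A := {freeg {fset int} / A}.

Definition occupied (S : {fset int}) (k : int) : bool := (k < 0) (+) (k \in S).

Definition toggle (S : {fset int}) (k : int) : {fset int} :=
  (if k \in S then S `\ k else k |` S)%fset.

(* The number of factors of the wedge to the left of the position of k. *)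
Definition above (S : {fset int}) (k : int) : nat :=
  #|` fset_set [set i : int | occupied S i && (k < i)]%classic|%fset.

Section Operators.
Context (A : comNzRingType).
Implicit Types (S T : {fset int}) (k i j : int) (w : wedge A).

Definition basis S : wedge A := << S >>.

Definition psi k w : wedge A :=
  fglift (fun S => if occupied S k then 0
                   else (-1) ^+ above S k *: basis (toggle S k)) w.

Definition psi_adj k w : wedge A :=
  fglift (fun S => if occupied S k then (-1) ^+ above S k *: basis (toggle S k)
                   else 0) w.

Definition normE i j w : wedge A :=
  if 0 <= j then psi i (psi_adj j w) else - psi_adj j (psi i w).

Definition vacuum : wedge A := basis fset0.

Definition vev (P : wedge A -> wedge A) : A := coeff fset0 (P vacuum).

Lemma toggleK k : involutive (toggle^~ k).
Proof.
move=> S; apply/fsetP => i; rewrite /toggle.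
by have [kS|kS] := boolP (k \in S); rewrite !inE ?eqxx /= !inE;
   have [->|] := eqVneq i k; rewrite ?kS ?(negbTE kS).
Qed.

Lemma occupied_toggle S k i :
  occupied (toggle S k) i = (i == k) (+) occupied S i.
Proof.
rewrite /occupied /toggle; have [kS|kS] := boolP (k \in S); rewrite !inE;
  have [->|] := eqVneq i k; rewrite ?kS ?(negbTE kS) //=; by case: (k < 0).
Qed.

Lemma above_toggle S k : above (toggle S k) k = above S k.
Proof.
rewrite /above; congr #|` fset_set _|%fset; apply/seteqP.
by split=> i /=; rewrite occupied_toggle;
   have [->|_] := eqVneq i k; rewrite ?ltxx ?andbF.
Qed.

(* psi_adj is the adjoint of psi for the pairing making the basis orthonormal. *)
Lemma psi_adjoint k S T :
  coeff T (psi k (basis S)) = coeff S (psi_adj k (basis T)).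
Proof.
rewrite /psi /psi_adj /basis !liftU !scale1r.
have [/eqP <-|TS] := boolP (toggle S k == T).
  rewrite occupied_toggle eqxx above_toggle toggleK.
  by case: (occupied S k); rewrite /= ?coeff0 // !coeffZ !coeffU !eqxx.
have ST : toggle T k != S by apply: contraNneq TS => <-; rewrite toggleK.
have {}TS := negbTE TS; have {}ST := negbTE ST.
by case: (occupied S k); case: (occupied T k);
  rewrite ?coeff0 ?coeffZ ?coeffU ?TS ?ST ?mulr0.
Qed.

End Operators.

Notation "x %:F" := (tofrac x) : ring_scope.

Section GeneratingSeries.
Context (K : fieldType) (n : nat).

Local Notation frac_series := {fraction mps n K}.

Implicit Types (a : int) (z : mps n K).

(* In E_{k - a, k} the half-integer k is k + 1/2 in terms of the summation
   index k : int; the sum has finitely many nonzero terms on each w.  The series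
   z has no constant term; for a = 0 it must also be nonzero. *)
Definition calE a z (w : wedge frac_series) : wedge frac_series :=
  \sum_(k \in [set: int]%classic)
     (fexp ((k%:~R + 2^-1 - a%:~R / 2) *: z))%:F *: normE (k - a) k w
  + (if a == 0 then ((varsigma z)%:F)^-1 *: w else 0).

Context (m l : nat).
Implicit Types (mu : m.-tuple nat) (nu : l.-tuple nat).

Definition correlator mu nu (z : l.-tuple (mps n K)) : frac_series :=
  vev (foldr (fun az P => calE az.1 az.2 \o P) id
         ([seq (p%:Z, 0) | p <- mu] ++ [seq (- pz.1%:Z, pz.2) | pz <- zip nu z])).

Context (N : nat).

(* The series H^{<=} and H^{<} with the vacuum expectation replaced by X; the
   entries of u have no constant term. *)
Definition Hle_with mu nu (u : l.-tuple (mps N frac_series))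
    (z : l.-tuple (mps n K)) (X : frac_series) : mps N frac_series :=
  mps_sum (fun v : 'X_{1..l} =>
    (\prod_(j < l) (((v j + tnth nu j).-1)`!%:R / ((tnth nu j).-1)`!%:R)
     * \prod_(j < l) (calS (tnth z j))%:F ^+ (tnth nu j).-1
     * (X / (\prod_(i < m) (tnth mu i)%:R * \prod_(j < l) (tnth nu j)%:R)))
    *: \prod_(j < l) tnth u j ^+ v j).

Definition Hlt_with mu nu (u : l.-tuple (mps N frac_series))
    (z : l.-tuple (mps n K)) (X : frac_series) : mps N frac_series :=
  \sum_(v : 'X_{1..l < (\sum_(j < l) tnth nu j).+1}
         | [forall j, (v j <= tnth nu j)%N])
    (\prod_(j < l) ((tnth nu j)`!%:R / (tnth nu j - v j)`!%:R)
     * \prod_(j < l) (calS (tnth z j))%:F ^- (tnth nu j).+1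
     * (X / (\prod_(i < m) (tnth mu i)%:R * \prod_(j < l) (tnth nu j)%:R)))
    *: \prod_(j < l) tnth u j ^+ v j.

Definition Hle mu nu (u : l.-tuple (mps N frac_series))
    (z : l.-tuple (mps n K)) : mps N frac_series :=
  Hle_with mu nu u z (correlator mu nu z).
Definition Hlt mu nu (u : l.-tuple (mps N frac_series))
    (z : l.-tuple (mps n K)) : mps N frac_series :=
  Hlt_with mu nu u z (correlator mu nu z).

End GeneratingSeries.

Definition sub_tuple (T : Type) (n : nat) (J : {set 'I_n}) (t : n.-tuple T) :
    #|J|.-tuple T :=
  [tuple tnth t (enum_val i) | i < #|J|].

Section Chambers.
Context (m n : nat).

Definition hpoint : Type := (m.-tuple nat * n.-tuple nat)%type.

Definition in_H (p : hpoint) : Prop :=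
  [/\ all (fun x => 0 < x)%N p.1, all (fun x => 0 < x)%N p.2
    & sumn p.1 = sumn p.2].

Definition delta (I : {set 'I_m}) (J : {set 'I_n}) (p : hpoint) : int :=
  \sum_(i in I) (tnth p.1 i)%:Z - \sum_(j in J) (tnth p.2 j)%:Z.

Definition is_wall (I : {set 'I_m}) (J : {set 'I_n}) : Prop :=
  ~ (I = finset.set0 /\ J = finset.set0) /\
  ~ (I = finset.setTfor 'I_m /\ J = finset.setTfor 'I_n).

Local Open Scope classical_set_scope.

Definition is_chamber (c : set hpoint) : Prop :=
  exists2 p0, c p0 & c = [set p | in_H p /\
    forall I J, is_wall I J -> 0 < delta I J p * delta I J p0].

Definition closed_chamber (c : set hpoint) : set hpoint :=
  [set p | in_H p /\ forall I J, is_wall I J ->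
    forall p0, c p0 -> 0 <= delta I J p * delta I J p0].

Definition coords (R : pzSemiRingType) (p : hpoint) : 'rV[R]_(m + n) :=
  \row_i (tnth [tuple of p.1 ++ p.2] i)%:R.

(* H(m, n) spans a space of dimension m + n - 1: both chambers border the wall
   in codimension one, along the same part of the wall, when their common
   boundary contains m + n - 2 linearly independent points of the wall. *)
Definition adjacent (I : {set 'I_m}) (J : {set 'I_n}) (c1 c2 : set hpoint) :
    Prop :=
  [/\ is_chamber c1, is_chamber c2,
      forall p, c1 p -> delta I J p < 0,
      forall p, c2 p -> 0 < delta I J p
    & exists2 s : (m + n - 2).-tuple hpoint,
        free [seq coords rat p | p <- s]
      & forall p, p \in s -> [/\ closed_chamber c1 p, closed_chamber c2 p
                               & delta I J p = 0] ].

Context (K : fieldType).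

Definition z_ : n.-tuple (mps n K) := [tuple mpsX K j | j < n].

Definition u_ : n.-tuple (mps n {fraction mps n K}) :=
  [tuple mpsX {fraction mps n K} j | j < n].

Definition zsum (J : {set 'I_n}) : mps n K := \sum_(j in J) mpsX K j.

(* The variables u_1, ..., u_n and u' when u' is added as a last variable. *)
Definition u_ext : n.-tuple (mps n.+1 {fraction mps n K}) :=
  [tuple mpsX {fraction mps n K} (widen_ord (leqnSn n) j) | j < n].
Definition u' : mps n.+1 {fraction mps n K} := mpsX {fraction mps n K} ord_max.

(* A series in z whose coefficients are polynomials in the m + n entries of
   (mu, nu). As a chamber is Zariski dense in sum mu = sum nu, the values
   of the coefficients at all points of H(m, n) are determined by those on the
   chamber, although the polynomials are only determined modulo this equation. *)
Definition poly_series : Type := mps n {mpoly K[m + n]}.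

Definition qeval (q : poly_series) (p : hpoint) : mps n K :=
  Mps (fun k => (q k).@[coords K p 0]).

Definition is_chamber_series (c : set hpoint) (q : poly_series) : Prop :=
  forall p, c p -> correlator p.1 p.2 z_ = (qeval q p)%:F.

Definition WCle (q1 q2 : poly_series) (p : hpoint) : mps n {fraction mps n K} :=
  Hle_with p.1 p.2 u_ z_ (qeval q2 p)%:F - Hle_with p.1 p.2 u_ z_ (qeval q1 p)%:F.

Definition WClt (q1 q2 : poly_series) (p : hpoint) : mps n {fraction mps n K} :=
  Hlt_with p.1 p.2 u_ z_ (qeval q2 p)%:F - Hlt_with p.1 p.2 u_ z_ (qeval q1 p)%:F.

End Chambers.

(* Main.v *)
(* The commutation relation
     [E_a(z), E_b(w)] = varsigma(a w - b z) E_{a+b}(z + w)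
   together with <E_a(z) ... > = 0 for a < 0, < ... E_a(z)> = 0 for a > 0 and
   <E_0(z)> = 1 / varsigma(z) determines every correlator: a word in the
   operators indexed by disjoint sets of parts is reduced by moving negative
   operators to the left, and only the signs of the energies mu_K - nu_L matter.
   Read with the signs of a chamber c and the energies of an arbitrary point, the
   same rules define a functional on words which, up to the factor
   varsigma(z_[n]), is polynomial in (mu, nu); it is therefore the extension of
   the chamber polynomials of c.

   Put A = I u J, B its complement.  By adjacency the functionals of c1 and c2 use
   the same signs except for A and B.  Their difference D satisfies the same
   commutation rules; it vanishes on words containing a block that meets both A
   and B, and on the others it factors, up to the constant D(E_A E_B), into a
   functional of the blocks inside A and one of the blocks inside B.  These two
   are characterized by the same rules as <... E_{-delta}(0)> and
   <E_delta(0) ...>, with normalization varsigma(delta z_J) / varsigma(z_J) and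
   varsigma(delta z_{J^c}) / varsigma(z_{J^c}). *)
Require Import Defs.
From HB Require Import structures.
From mathcomp Require Import all_boot all_order all_algebra.
From mathcomp Require Import finmap boolp classical_sets functions cardinality fsbigop reals.
From mathcomp Require Import complex.
From mathcomp Require Import mpoly freeg.
From mathcomp Require Import zify ring lra.

Set Implicit Arguments.
Unset Strict Implicit.
Unset Printing Implicit Defensive.

Import Order.TTheory GRing.Theory Num.Theory.
Local Open Scope ring_scope.

(** * Power series *)

(** The difference is read at a point [p] of [c2], where the hypothesis on [q1] says nothing. The
    polynomials of [c1] are therefore used only along the ray [p + t p1] with [p1] in [c1]: it stays
    in [c1] for large [t], the energies are affine in [t], and the coefficients of the correlators,
    cleared of [varsigma], are polynomials in [t]. At [t = 0] the signs are still those of [c1]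
    while the energies are those of [p], and a polynomial in one variable is determined by its
    values at large [t]. For [c2] the true correlator at [p] is taken. The rules for the two factors
    rest on boundary points: a block [Y] inside A or inside B, and not equal to either, has nonzero
    energy at some point [q] of the common boundary, where A and B have energy zero. So [Y] and its
    union with the opposite side have the same sign at [p]. The constant D(E_A E_B) is
    varsigma(delta z_[n]) / varsigma(z_[n]); dividing it by the two normalizations gives the ratio
    of the statement. The factor delta^2 compensates the part delta that occurs once in the
    denominator of each factor. *)

Lemma big_ord_triangle (V : zmodType) d (G : nat -> nat -> V) :
  (forall i j, (d <= i + j)%N -> G i j = 0) ->
  \sum_(k < d) \sum_(i < k.+1) G (k - i)%N i = \sum_(i < d) \sum_(j < d) G i j.
Proof.
move=> G0; rewrite [RHS]exchange_big /=.
rewrite -(big_mkord predT (fun i => \sum_(j < d) G j i)).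
have inner (k : 'I_d) : \sum_(i < k.+1) G (k - i)%N i =
    \sum_(0 <= i < d | (i < k.+1)%N) G (k - i)%N i.
  by rewrite -(big_mkord predT (fun i => G (k - i)%N i)) (big_nat_widen _ _ d).
under eq_bigr => k _ do rewrite inner.
rewrite -(big_mkord predT
  (fun k => \sum_(0 <= i < d | (i < k.+1)%N) G (k - i)%N i)).
rewrite (exchange_big_dep_nat predT) //=.
apply: eq_big_nat => i /andP[_ lt_id].
rewrite -(big_mkord predT (fun j => G j i)).
rewrite [RHS](big_cat_nat (n := (d - i)%N)) //=; last exact: leq_subr.
rewrite [X in _ + X]big_nat_cond [X in _ + X]big1 ?addr0; last first.
  by move=> j /andP[/andP[le_j _] _]; apply: G0; lia.
transitivity (\sum_(i <= k < d) G (k - i)%N i).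
  by rewrite (@big_nat_widenl _ _ _ i 0).
rewrite -[LHS]/(\sum_(0 + i <= k < d) G (k - i)%N i) big_addn.
by apply: eq_bigr => j _; rewrite addnK.
Qed.

Lemma telescope2 (V : zmodType) (a b c : V) : b - a + (c - b) = c - a.
Proof. by rewrite addrC addrA subrK. Qed.

Lemma mps_sumE (R : comNzRingType) (N : nat) (I : Type) (r : seq I) (P : pred I)
    (F : I -> mps N R) (m : 'X_{1..N}) :
  (\sum_(i <- r | P i) F i) m = \sum_(i <- r | P i) F i m.
Proof. by elim/big_rec2: _ => // i a b _ <-. Qed.

Section Series.
Context (K : numFieldType) (N : nat).
Implicit Types (x y : mps N K) (c : K).

Lemma mps1E (m : 'X_{1..N}) : (1 : mps N K) m = (m == 0%MM)%:R.
Proof. by []. Qed.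

Lemma mps_natE x k m : (x *+ k) m = x m *+ k.
Proof. by elim: k => [//|k IH]; rewrite !mulrS mpsE_add IH. Qed.

Lemma mps_intE x (k : int) m : (x *~ k) m = x m *~ k.
Proof. by case: k => k; rewrite ?NegzE ?mulrNz -?pmulrn ?mpsE_opp mps_natE. Qed.

Lemma mps_powM_low x y i j (m : 'X_{1..N}) : x 0%MM = 0 -> y 0%MM = 0 ->
  (mdeg m < i + j)%N -> (x ^+ i * y ^+ j) m = 0.
Proof.
move=> x0 y0 lt_m; rewrite mpsE_mul big1 // => -[[k1 d1] [k2 d2]] /= /eqP e.
move: lt_m; rewrite e mdegD => lt_m.
have [lt1|le1] := ltnP (mdeg k1) i; first by rewrite mps_pow_low ?mul0r.
by rewrite [X in _ * X]mps_pow_low ?mulr0 //; lia.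
Qed.

Lemma fps_atM (c1 c2 : nat -> K) x y (m : 'X_{1..N}) :
  x 0%MM = 0 -> y 0%MM = 0 ->
  (fps_at c1 x * fps_at c2 y) m =
  \sum_(i < (mdeg m).+1) \sum_(j < (mdeg m).+1)
     c1 i * c2 j * (x ^+ i * y ^+ j) m.
Proof.
move=> x0 y0; rewrite mpsE_mul.
under eq_bigr => k _ do
  rewrite !(@fps_at_wide _ _ _ _ _ (mdeg m).+1) ?bmdeg // big_distrlr /=.
rewrite exchange_big; apply: eq_bigr => i _ /=.
rewrite exchange_big; apply: eq_bigr => j _ /=.
rewrite mulr_sumr; apply: eq_bigr => k _.
by rewrite mulrACA.
Qed.

(** The binomial theorem. The expansion of the left side runs over the pairs [i + j <= mdeg m], the
    product of truncated series over a square; the additional terms have too high an order to reach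
    [m]. *)
Lemma fexpD x y : x 0%MM = 0 -> y 0%MM = 0 -> fexp (x + y) = fexp x * fexp y.
Proof.
move=> x0 y0; apply: mpsP => m; rewrite fps_atM //.
rewrite -(@big_ord_triangle _ _
  (fun i j => (i`!%:R)^-1 * (j`!%:R)^-1 * (x ^+ i * y ^+ j) m)).
  apply: eq_bigr => k _; rewrite exprDn mps_sumE mulr_sumr.
  apply: eq_bigr => i _; rewrite mps_natE; set z := mps_coef _ _; rewrite -[z *+ _]mulr_natl.
  have nz j : j`!%:R != 0 :> K by rewrite pnatr_eq0 -lt0n fact_gt0.
  have nzb : 'C(k, i)%:R != 0 :> K by rewrite pnatr_eq0 -lt0n bin_gt0 -ltnS.
  have le_ik : (i <= k)%N by rewrite -ltnS.
  by rewrite -[X in X%:R^-1](bin_fact le_ik) !natrM; field; rewrite !nz nzb.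
by move=> i j le_d; rewrite mps_powM_low ?mulr0.
Qed.

Lemma varsigma0 : varsigma (0 : mps N K) = 0.
Proof. by rewrite /varsigma scaler0 oppr0 subrr. Qed.

Lemma varsigmaN x : varsigma (- x) = - varsigma x.
Proof. by rewrite /varsigma scalerN opprK opprB. Qed.

Lemma calS_neq0 x : x 0%MM = 0 -> calS x != 0.
Proof.
move=> x0; apply/eqP => /(congr1 (fun f : mps N K => f 0%MM)).
rewrite /calS /= mdeg0 big_ord1 expr0 mps1E eqxx mulr1 /varsigma_coef.
rewrite !expr1 opprK -[2^-1]mul1r -splitr -[1`!]/1%N divr1 => /eqP.
by rewrite oner_eq0.
Qed.

Lemma varsigma_neq0 x : x 0%MM = 0 -> x != 0 -> varsigma x != 0.
Proof. by move=> x0 nz; rewrite varsigma_calS // mulf_neq0 ?calS_neq0. Qed.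

Lemma calS0 : calS (0 : mps N K) = 1.
Proof.
apply: mpsP => m; rewrite /calS /= big_ord_recl big1 => [|k _].
  rewrite addr0 expr0 /varsigma_coef !expr1 opprK -[2^-1]mul1r -splitr.
  by rewrite -[1`!]/1%N divr1 mul1r.
by rewrite expr0n /= mulr0.
Qed.

Lemma fexp_scale_sub x c : x 0%MM = 0 ->
  fexp ((c + 2^-1) *: x) - fexp ((c - 2^-1) *: x) = fexp (c *: x) * varsigma x.
Proof.
by move=> x0; rewrite /varsigma mulrBr !scalerDl scaleNr
  !fexpD ?mpsE_scale ?mpsE_opp ?mpsE_scale ?x0 ?mulr0 ?oppr0.
Qed.

(* Telescoping of [fexp_scale_sub]: this is the central term of the
   commutator of two operators of opposite energies. *)
Lemma sum_fexp_varsigma x c a : x 0%MM = 0 ->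
  (\sum_(i < a) fexp ((c + 2^-1 + i%:R) *: x)) * varsigma x =
  fexp ((c + a%:R) *: x) - fexp (c *: x).
Proof.
move=> x0; elim: a => [|a IH]; first by rewrite big_ord0 mul0r addr0 subrr.
have e1 : c + 2^-1 + a%:R + 2^-1 = c + a.+1%:R :> K by rewrite -natr1; field.
have e2 : c + 2^-1 + a%:R - 2^-1 = c + a%:R :> K by field.
have := fexp_scale_sub (c + 2^-1 + a%:R) x0.
rewrite e1 e2 => step.
rewrite big_ord_recr /= mulrDl.
rewrite IH.
rewrite -step.
exact: telescope2.
Qed.

End Series.

(** * Fermionic operators *)

Section Lift.
Context (A : comNzRingType) (G : choiceType).
Implicit Types (f : G -> {freeg G / A}) (w : {freeg G / A}).

HB.instance Definition _ f :=
  GRing.isZmodMorphism.Build {freeg G / A} {freeg G / A} (fglift f)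
    (lift_is_additive f).

Fact fglift_is_scalable f : scalable (fglift f).
Proof.
move=> c u; rewrite {1}/GRing.scale /= /fgscale raddf_sum /=.
rewrite -[in RHS](freeg_sumE u) raddf_sum scaler_sumr /=.
by apply: eq_bigr => x _; rewrite !liftU scalerA.
Qed.

HB.instance Definition _ f :=
  GRing.isScalable.Build A {freeg G / A} {freeg G / A} *:%R (fglift f)
    (fglift_is_scalable f).

Lemma freegU_scale (c : A) (x : G) : << c *g x >> = c *: << x >> :> {freeg G / A}.
Proof. by apply/eqP/freeg_eqP => y; rewrite coeffZ !coeffU mul1r. Qed.

Lemma fglift_ext (f g : {linear {freeg G / A} -> {freeg G / A}}) :
  (forall x, f << x >> = g << x >>) -> f =1 g.
Proof.
move=> fg w; rewrite -(freeg_sumE w) !linear_sum; apply: eq_bigr => x _.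
by rewrite freegU_scale !linearZ fg.
Qed.

End Lift.

Lemma mem_toggle S k l : (l \in toggle S k) = (l == k) (+) (l \in S).
Proof.
by rewrite /toggle; have [kS|kS] := boolP (k \in S); rewrite !inE;
  have [->|] := eqVneq l k; rewrite ?kS ?(negbTE kS).
Qed.

Lemma toggleC S i j : toggle (toggle S i) j = toggle (toggle S j) i.
Proof. by apply/fsetP => l; rewrite !mem_toggle addbCA. Qed.

Definition int_range (N : nat) : seq int :=
  [seq i%:Z - N%:Z | i <- iota 0 (N + N)].

Lemma mem_int_range N k : (k \in int_range N) = (- N%:Z <= k < N%:Z).
Proof.
apply/mapP/idP => [[ i]|/andP[h1 h2]].
  by rewrite mem_iota => lt_i ->; lia.
exists `|(k + N%:Z)%R|%N; last by lia.
by rewrite mem_iota; lia.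
Qed.

Lemma int_range_uniq N : uniq (int_range N).
Proof. by rewrite map_inj_uniq ?iota_uniq // => i j; lia. Qed.

Lemma finite_above S k :
  finite_set [set i : int | occupied S i && (k < i)]%classic.
Proof.
apply: (@sub_finite_set _ _
  ([set` S] `|` [set` int_range `|k|.+1])%classic); last first.
  by rewrite finite_setU; split; [exact: finite_fset | exact: finite_seq].
move=> i /=; rewrite /occupied => /andP[h lt_ki].
case: (i \in S) h => /=; rewrite ?addbF => lt_i0; [by left|right].
by rewrite mem_int_range; lia.
Qed.

Lemma mem_above S k i :
  (i \in fset_set [set i : int | occupied S i && (k < i)]%classic)
  = occupied S i && (k < i).
Proof.
rewrite in_fset_set; last exact: finite_above.
by apply/idP/idP => [/set_mem|h]; [|apply/mem_set].
Qed.

(** Toggling the site [j] changes the number of factors above [i] by one if [i < j] and by zero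
    otherwise. All fermionic signs come from this. *)
Lemma sign_above_toggle (A : comNzRingType) S j i :
  (-1) ^+ above (toggle S j) i = (-1) ^+ (i < j)%R * (-1) ^+ above S i :> A.
Proof.
rewrite /above; set B := fset_set _; set C := fset_set _.
have BE l : (l \in B) = occupied (toggle S j) l && (i < l) by apply: mem_above.
have CE l : (l \in C) = occupied S l && (i < l) by apply: mem_above.
have [lt_ij|le_ji] := boolP (i < j)%R; last first.
  rewrite mul1r; congr (_ ^+ #|` _|%fset); apply/fsetP => l.
  rewrite BE CE occupied_toggle; have [->|] //= := eqVneq l j.
  by rewrite (negbTE le_ji) !andbF.
have [oj|oj] := boolP (occupied S j).
  have jC : j \in C by rewrite CE oj.
  have -> : B = (C `\ j)%fset.
    apply/fsetP => l; rewrite !inE BE CE occupied_toggle.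
    by have [->|] := eqVneq l j; rewrite ?oj.
  by rewrite [in RHS](cardfsD1 j) jC exprD !expr1 mulrA mulrNN mulr1 mul1r.
have jC : j \notin C by rewrite CE (negbTE oj).
have -> : B = (j |` C)%fset.
  apply/fsetP => l; rewrite !inE BE CE occupied_toggle.
  by have [->|] := eqVneq l j; rewrite ?(negbTE oj) ?lt_ij.
by rewrite cardfsU1 jC exprD.
Qed.

Lemma subr_addKr (V : zmodType) (x y t : V) : x + t - (y + t) = x - y.
Proof. by rewrite opprD addrACA subrr addr0. Qed.

Lemma subrACA_add (V : zmodType) (x y z t : V) :
  x + y - (z + t) = (x - z) + (y - t).
Proof. by rewrite opprD addrACA. Qed.

Lemma subr_cross (V : zmodType) (p q s t r : V) :
  p - t - (s - r) - (q - s - (t - r)) = p - q.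
Proof.
have h (a b c e : V) : a - b - (c - e) = a - (b + c - e).
  by rewrite -addrA -opprD addrA.
by rewrite (h p) (h q) [s + t]addrC subr_addKr.
Qed.

Section Fock.
Context (A : comNzRingType).
Implicit Types (S : {fset int}) (i j k l a b c : int) (w : wedge A).

HB.instance Definition _ k := GRing.Linear.copy (@psi A k) (fglift _).
HB.instance Definition _ k := GRing.Linear.copy (@psi_adj A k) (fglift _).

Lemma psi_basis k S : psi k (Defs.basis A S) =
  if occupied S k then 0 else (-1) ^+ above S k *: Defs.basis A (toggle S k).
Proof. by rewrite /psi /Defs.basis liftU scale1r. Qed.

Lemma psi_adj_basis k S : psi_adj k (Defs.basis A S) =
  if occupied S k then (-1) ^+ above S k *: Defs.basis A (toggle S k) else 0.
Proof. by rewrite /psi_adj /Defs.basis liftU scale1r. Qed.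

(** For distinct sites exactly one of the two comparisons holds, so the two orders of acting at both
    sites differ by one sign. *)
Lemma sign_ltC i j (s t : A) : i != j ->
  s * ((-1) ^+ (i < j)%R * t) = - (t * ((-1) ^+ (j < i)%R * s)).
Proof. by case: ltgtP => // _ _; rewrite !expr1 !expr0; ring. Qed.

Lemma psi_anticomm i j w : psi i (psi j w) = - psi j (psi i w).
Proof.
pose f : {linear wedge A -> wedge A} := psi i \o psi j.
pose g : {linear wedge A -> wedge A} := psi j \o psi i.
apply: (fun H => @fglift_ext _ _ f (\- g) H w) => S; rewrite /= -/(Defs.basis A S) !psi_basis.
have [<-|ne] := eqVneq i j.
  case: ifP => oj; rewrite ?linear0 ?oppr0 // linearZ /= psi_basis.
  by rewrite occupied_toggle eqxx oj scaler0 oppr0.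
case: ifP => oj; case: ifP => oi; rewrite ?linear0 ?oppr0 // !linearZ /=;
  rewrite !psi_basis !occupied_toggle ?oi ?oj ?(eq_sym j) ?(negbTE ne) /=;
  rewrite ?oppr0 ?scaler0 ?oppr0 //.
rewrite ?scalerN.
rewrite 2!scalerA.
rewrite (toggleC S i j).
rewrite (sign_above_toggle A S j i) (sign_above_toggle A S i j).
rewrite -scaleNr; congr (_ *: _).
exact: sign_ltC.
Qed.

Lemma psi_adj_anticomm i j w : psi_adj i (psi_adj j w) = - psi_adj j (psi_adj i w).
Proof.
pose f : {linear wedge A -> wedge A} := psi_adj i \o psi_adj j.
pose g : {linear wedge A -> wedge A} := psi_adj j \o psi_adj i.
apply: (fun H => @fglift_ext _ _ f (\- g) H w) => S; rewrite /= -/(Defs.basis A S) !psi_adj_basis.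
have [<-|ne] := eqVneq i j.
  case: ifP => oj; rewrite ?linear0 ?oppr0 // linearZ /= psi_adj_basis.
  by rewrite occupied_toggle eqxx oj scaler0 oppr0.
case: ifP => oj; case: ifP => oi; rewrite ?linear0 ?oppr0 // !linearZ /=;
  rewrite !psi_adj_basis !occupied_toggle ?oi ?oj ?(eq_sym j) ?(negbTE ne) /=;
  rewrite ?oppr0 ?scaler0 ?oppr0 //.
rewrite ?scalerN.
rewrite 2!scalerA.
rewrite (toggleC S i j).
rewrite (sign_above_toggle A S j i) (sign_above_toggle A S i j).
rewrite -scaleNr; congr (_ *: _).
exact: sign_ltC.
Qed.

(** The canonical anticommutation relation. At [i = j] exactly one of the two products survives on a
    basis vector, and toggling twice returns the vector with a squared sign. *)
Lemma psi_psi_adj i j w :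
  psi i (psi_adj j w) = (i == j)%:R *: w - psi_adj j (psi i w).
Proof.
pose f : {linear wedge A -> wedge A} := psi i \o psi_adj j.
pose g : {linear wedge A -> wedge A} := psi_adj j \o psi i.
apply: (fun H => @fglift_ext _ _ f (( *:%R (i == j)%:R) \- g) H w) => S.
rewrite /= -/(Defs.basis A S) psi_basis psi_adj_basis.
have [<-|ne] := eqVneq i j.
  case: ifP => oj; rewrite linear0 ?subr0 ?sub0r linearZ /=;
    rewrite ?psi_basis ?psi_adj_basis occupied_toggle eqxx oj /= scalerA.
    by rewrite above_toggle toggleK -expr2 sqrr_sign scale1r.
  by rewrite above_toggle toggleK -expr2 sqrr_sign scale1r subrr.
rewrite scale0r sub0r.
case: ifP => oj; case: ifP => oi; rewrite ?linear0 ?oppr0 // !linearZ /=;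
  rewrite ?psi_basis ?psi_adj_basis !occupied_toggle ?oi ?oj ?(eq_sym j)
     ?(negbTE ne) /=; rewrite ?oppr0 ?scaler0 ?oppr0 //.
rewrite ?scalerN.
rewrite 2!scalerA.
rewrite (toggleC S i j).
rewrite (sign_above_toggle A S j i) (sign_above_toggle A S i j).
rewrite -scaleNr; congr (_ *: _).
exact: sign_ltC.
Qed.

Lemma psi_adj_psi i j w :
  psi_adj j (psi i w) = (i == j)%:R *: w - psi i (psi_adj j w).
Proof. by rewrite psi_psi_adj opprB addrC subrK. Qed.

(** Normal ordering only subtracts a scalar, on the diagonal and at negative sites. Commutators then
    need no case distinction, and these scalars are the source of the central term. *)
Lemma normE_psi i j w :
  normE i j w = psi i (psi_adj j w) - ((i == j) && (j < 0))%:R *: w.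
Proof.
rewrite /normE; case: ifP => [h|/negbT]; first by rewrite ltNge h andbF scale0r subr0.
rewrite -ltNge => ->; rewrite andbT psi_psi_adj.
by rewrite addrAC subrr add0r.
Qed.

Fact normE_is_linear i j : linear (@normE A i j).
Proof.
move=> x u v; rewrite !normE_psi; set c := (_ && _)%:R.
rewrite linearP linearP /= scalerDr scalerBr 2!scalerA [c * x]mulrC.
by rewrite opprD addrACA.
Qed.
HB.instance Definition _ i j :=
  GRing.isLinear.Build A (wedge A) (wedge A) *:%R (@normE A i j)
    (normE_is_linear i j).

(** The Lie bracket of infinite matrices, before normal ordering: once both [psi] are moved to the
    left, the quartic terms of the two orders coincide and cancel. *)
Lemma psi_bilinear_comm i j k l w :
  psi i (psi_adj j (psi k (psi_adj l w)))
  - psi k (psi_adj l (psi i (psi_adj j w)))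
  = (j == k)%:R *: psi i (psi_adj l w) - (l == i)%:R *: psi k (psi_adj j w).
Proof.
have expand i0 j0 k0 l0 : psi i0 (psi_adj j0 (psi k0 (psi_adj l0 w))) =
    (j0 == k0)%:R *: psi i0 (psi_adj l0 w)
    + psi i0 (psi k0 (psi_adj l0 (psi_adj j0 w))).
  rewrite psi_adj_psi (linearB (psi i0)) (linearZ_LR (psi i0)) /=.
  rewrite (psi_adj_anticomm j0 l0) (linearN (psi k0)) (linearN (psi i0)) opprK.
  by rewrite (eq_sym k0).
have swap : psi k (psi i (psi_adj j (psi_adj l w))) =
    psi i (psi k (psi_adj l (psi_adj j w))).
  rewrite psi_anticomm (psi_adj_anticomm j l) (linearN (psi k)).
  by rewrite (linearN (psi i)) opprK.
rewrite (expand i j k l) (expand k l i j) swap.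
exact: subr_addKr.
Qed.

(** The scalars removed by normal ordering cancel in a commutator. The right-hand side is left
    without normal ordering: restoring it after summation yields the central term. *)
Lemma normE_comm i j k l w :
  normE i j (normE k l w) - normE k l (normE i j w)
  = (j == k)%:R *: psi i (psi_adj l w) - (l == i)%:R *: psi k (psi_adj j w).
Proof.
rewrite -psi_bilinear_comm (normE_psi k l w) (normE_psi i j w).
set x := (_ && _)%:R; set y := (_ && _)%:R.
rewrite (linearB (normE i j)) (linearZ_LR (normE i j)) /=.
rewrite (linearB (normE k l)) (linearZ_LR (normE k l)) /=.
rewrite !normE_psi -/x -/y 2!scalerBr 2!scalerA [x * y]mulrC.
exact: subr_cross.
Qed.

End Fock.

(** * Operators of fixed energy as locally finite sums *)

Section InfiniteSums.
Context (A : comNzRingType).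
Implicit Types (f g : int -> A) (S : {fset int}) (i j k l a b c : int) (w : wedge A).

(** The vector looks like the vacuum outside the window [- M <= k < M]: sites above it are empty,
    sites below it are filled. Every vector has such a window, which bounds all the infinite sums
    applied to it. *)
Definition vanish_out (M : nat) w : Prop :=
  (forall k, M%:Z <= k -> psi_adj k w = 0) /\
  (forall k, k < - M%:Z -> psi k w = 0).

Lemma vanish_outW M M' w : (M <= M')%N -> vanish_out M w -> vanish_out M' w.
Proof. by move=> le_M [h1 h2]; split=> k hk; by [apply: h1; lia|apply: h2; lia]. Qed.

Lemma vanish_out_sum (I : Type) (r : seq I) (P : pred I) (F : I -> wedge A) M :
  (forall x, P x -> vanish_out M (F x)) ->
  vanish_out M (\sum_(i <- r | P i) F i).
Proof.
move=> h; split=> k hk; [rewrite (linear_sum (psi_adj k))|rewrite (linear_sum (psi k))];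
  rewrite big1 // => i Pi; case: (h i Pi) => h1 h2; by [apply: h1|apply: h2].
Qed.

Lemma vanish_outZ M (c : A) w : vanish_out M w -> vanish_out M (c *: w).
Proof.
move=> [h1 h2]; split=> k hk.
  by rewrite (linearZ_LR (psi_adj k)) /= h1 // scaler0.
by rewrite (linearZ_LR (psi k)) /= h2 // scaler0.
Qed.

Lemma vanish_out_basis S : exists M, vanish_out M (Defs.basis A S).
Proof.
exists (\max_(s <- enum_fset S) `|s|%N).+1.
have h k : (k \in S) -> (`|k|%N <= \max_(s <- enum_fset S) `|s|%N)%N.
  by move=> kS; apply: (@leq_bigmax_seq _ _ xpredT (fun s : int => `|s|%N)).
split=> k hk; [rewrite psi_adj_basis|rewrite psi_basis]; rewrite /occupied;
  have [/h|_] := boolP (k \in S); try lia.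
- by have -> : (k < 0) = false by lia.
- by have -> : (k < 0) = true by lia.
Qed.

Lemma vanish_out_ex w : exists M, vanish_out M w.
Proof.
rewrite -(freeg_sumE w); elim: (dom w) => [|x s [M hM]].
  exists 0%N; rewrite big_nil.
  by split=> k _; [exact: (linear0 (psi_adj k))|exact: (linear0 (psi k))].
have [M' hM'] := vanish_out_basis x.
exists (maxn M M'); rewrite big_cons.
have hx : vanish_out (maxn M M') << coeff x w *g x>>.
  rewrite freegU_scale; apply: vanish_outZ.
  by apply: vanish_outW hM'; apply: leq_maxr.
have {hM} [h1 h2] := vanish_outW (leq_maxl M M') hM.
have [k1 k2] := hx; split=> k hk.
  by rewrite (linearD (psi_adj k)) /= h1 // k1 // addr0.
by rewrite (linearD (psi k)) /= h2 // k2 // addr0.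
Qed.

(** Above the window [psi_adj k] kills the vector. Below it [psi (k - a)] does, and for [a = 0] the
    remaining identity term is exactly what normal ordering subtracts. *)
Lemma normE_out M w a k : vanish_out M w ->
  (M%:Z <= k) || (k - a < - M%:Z) -> normE (k - a) k w = 0.
Proof.
move=> [h1 h2]; rewrite normE_psi => /orP[le_Mk|lt_kM].
  rewrite h1 // (linear0 (psi (k - a))) /=.
  by have -> : k < 0 = false; [lia | rewrite andbF scale0r subr0].
rewrite psi_psi_adj h2 // (linear0 (psi_adj k)) subr0.
case: eqP => [e|_]; last by rewrite scale0r subr0.
by have -> : k < 0 = true; [lia | rewrite subrr].
Qed.

(** A site beyond the wider window is either untouched or one end of the shift by [b], and in the
    latter case the other end lies beyond the old window. *)
Lemma vanish_out_normE M w b l : b != 0 -> vanish_out M w ->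
  vanish_out (M + `|b|)%N (normE (l - b) l w).
Proof.
move=> nz_b [h1 h2].
have ne : (l - b == l) = false by apply/eqP; lia.
rewrite normE_psi ne /= scale0r subr0; split=> k hk.
  rewrite psi_adj_psi (psi_adj_anticomm k l) (h1 k) ?(linear0 (psi_adj l)) ?oppr0; last by lia.
  rewrite (linear0 (psi (l - b))) subr0; case: eqP => [e|_]; last by rewrite scale0r.
  by rewrite h1 ?scaler0 //; lia.
rewrite psi_anticomm psi_psi_adj (h2 k) ?(linear0 (psi_adj l)) ?subr0; last by lia.
rewrite (linearZ_LR (psi (l - b))) /=; case: eqP => [e|_].
  by rewrite h2 ?scaler0 ?oppr0 //; lia.
by rewrite scale0r oppr0.
Qed.

(** The operator [calE] without its scalar term and with arbitrary weights in place of exponentials,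
    so that commutators become identities between weight functions. *)
Definition Eop f a w : wedge A :=
  \sum_(k \in [set: int]%classic) f k *: normE (k - a) k w.

Lemma Eop_finite M N f a w : vanish_out M w -> (M + `|a| <= N)%N ->
  Eop f a w = \sum_(k <- int_range N) f k *: normE (k - a) k w.
Proof.
move=> vM le_N; rewrite fsbig_seq ?int_range_uniq //; apply/esym/fsbig_widen => //.
move=> k [_ /= /negP]; rewrite mem_int_range => out_k.
rewrite (normE_out vM) ?scaler0 //; lia.
Qed.

Lemma vanish_out_Eop M f b w : b != 0 -> vanish_out M w ->
  vanish_out (M + `|b|)%N (Eop f b w).
Proof.
move=> nz_b vM; rewrite (Eop_finite _ vM (leqnn _)).
by apply: vanish_out_sum => k _; apply/vanish_outZ/vanish_out_normE.
Qed.

Lemma Eop_is_linear f a : linear (Eop f a).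
Proof.
move=> c u v.
have [M1 v1] := vanish_out_ex u; have [M2 v2] := vanish_out_ex v.
have [M3 v3] := vanish_out_ex (c *: u + v).
pose N := (M1 + M2 + M3 + `|a|)%N.
rewrite (@Eop_finite _ N _ _ _ v1) ?(@Eop_finite _ N _ _ _ v2)
  ?(@Eop_finite _ N _ _ _ v3); try by rewrite /N; lia.
rewrite scaler_sumr -big_split; apply: eq_bigr => k _.
by rewrite (linearP (normE (k - a) k)) scalerDr 2!scalerA [c * _]mulrC.
Qed.

HB.instance Definition _ f a :=
  GRing.isLinear.Build A (wedge A) (wedge A) *:%R (Eop f a) (Eop_is_linear f a).

Lemma scale_Eop (c : A) f a w : c *: Eop f a w = Eop (fun k => c * f k) a w.
Proof.
have [M vM] := vanish_out_ex w.
rewrite (Eop_finite f vM (leqnn _)) (Eop_finite _ vM (leqnn _)) scaler_sumr.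
by apply: eq_bigr => k _; rewrite scalerA.
Qed.

Lemma eq_Eop f g a w : f =1 g -> Eop f a w = Eop g a w.
Proof. by move=> /funext ->. Qed.

Lemma Eop_add_is_linear f a (t : bool) (p : A) :
  linear (fun w => Eop f a w + (if t then p *: w else 0)).
Proof.
move=> c u v; rewrite (linearP (Eop f a)) /=.
case: t; last by rewrite !addr0.
by rewrite (scalerDr p) (scalerDr c) addrACA !scalerA [p * c]mulrC.
Qed.

Lemma big_delta_seq (I : eqType) (V : lmodType A) (r : seq I) (F : I -> V) x :
  uniq r -> \sum_(y <- r) (y == x)%:R *: F y = if x \in r then F x else 0.
Proof.
move=> Ur; case: ifP => [xr|/negbT xr].
  rewrite (bigD1_seq x) //= eqxx scale1r big1 ?addr0 // => y /negbTE ->.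
  by rewrite scale0r.
rewrite big_seq big1 // => y yr; case: eqP => [e|_]; last by rewrite scale0r.
by rewrite -e yr in xr.
Qed.

Lemma sum_int_range (F : int -> A) N (n : nat) : (n <= N)%N ->
  \sum_(k <- int_range N | 0 <= k < n%:Z) F k = \sum_(t < n) F t%:Z.
Proof.
move=> le_nN; rewrite -(big_mkord xpredT (fun t : nat => F t%:Z)).
rewrite -(big_map Posz xpredT F) -[LHS]big_filter; apply: perm_big.
apply: uniq_perm; first by rewrite filter_uniq // int_range_uniq.
  by rewrite map_inj_uniq ?iota_uniq // => i j [].
move=> k; rewrite mem_filter mem_int_range; apply/idP/mapP.
  move=> /andP[h1 h2]; exists `|k|%N; last by lia.
  by rewrite mem_index_iota; lia.
by move=> [i0]; rewrite mem_index_iota => h ->; lia.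
Qed.

(** The central term for energies [a] and [- a] with [a > 0]; only the [a] sites that a shift by [a]
    carries across zero contribute. *)
Definition cocycle f g a : A := \sum_(t < `|a|) f t%:Z * g (t%:Z - a).

(** On a common finite range both compositions are double sums, [normE_comm] collapses them to
    single sums, and normal ordering is then restored. Each of the two resulting scalar sums depends
    on the range; their difference is the fixed [cocycle]. *)
Lemma Eop_comm f g a b w : a != 0 -> b != 0 -> (0 < a) || (a + b != 0) ->
  Eop f a (Eop g b w) - Eop g b (Eop f a w) =
  Eop (fun l => f (l - b) * g l - f l * g (l - a)) (a + b) w
  + (if a + b == 0 then cocycle f g a else 0) *: w.
Proof.
move=> nz_a nz_b hab; have [M vM] := vanish_out_ex w.
(* Both compositions, and shifts of an index by [a] or [b], have to stay in the range up to
   vanishing terms; hence twice each absolute value beyond the window. *)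
pose N := (M + (`|a| + `|a|) + (`|b| + `|b|))%N; pose R := int_range N.
have UR : uniq R by apply: int_range_uniq.
have comp f1 g1 a1 b1 : b1 != 0 -> (M + `|b1| + `|a1| <= N)%N ->
  Eop f1 a1 (Eop g1 b1 w) =
  \sum_(k <- R) \sum_(l <- R) (f1 k * g1 l) *:
     normE (k - a1) k (normE (l - b1) l w).
  move=> nz_b1 le_N.
  rewrite (@Eop_finite (M + `|b1|) N); [|exact: vanish_out_Eop|lia].
  apply: eq_bigr => k _; rewrite (@Eop_finite M N) //; last by lia.
  rewrite (linear_sum (normE (k - a1) k)) scaler_sumr; apply: eq_bigr => l _.
  by rewrite (linearZ_LR (normE (k - a1) k)) scalerA.
rewrite (comp f g a b) // ?(comp g f b a) //; try by rewrite /N; lia.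
rewrite [X in _ - X]exchange_big /= -sumrB.
have -> : \sum_(k <- R) (\sum_(l <- R) (f k * g l) *: normE (k - a) k (normE (l - b) l w)
      - \sum_(l <- R) (g l * f k) *: normE (l - b) l (normE (k - a) k w))
  = \sum_(k <- R) \sum_(l <- R) (k == l - b)%:R *: ((f k * g l) *: psi (l - (a + b)) (psi_adj l w))
  - \sum_(k <- R) \sum_(l <- R) (l == k - a)%:R *: ((f k * g l) *: psi (k - (a + b)) (psi_adj k w)).
  rewrite -sumrB; apply: eq_bigr => k _; rewrite -!sumrB; apply: eq_bigr => l _.
  rewrite [g l * f k]mulrC -scalerBr normE_comm scalerBr !scalerA.
  congr (_ - _).
    case: eqP => [->|_]; last by rewrite mulr0 mul0r !scale0r.
    have -> : l - b - a = l - (a + b) by lia.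
    by rewrite mulr1 mul1r.
  case: eqP => [->|_]; last by rewrite mulr0 mul0r !scale0r.
  have -> : k - a - b = k - (a + b) by lia.
  by rewrite mulr1 mul1r.
have psiN l : psi (l - (a + b)) (psi_adj l w) = normE (l - (a + b)) l w +
    ((a + b == 0) && (l < 0))%:R *: w.
  rewrite normE_psi; have -> : (l - (a + b) == l) = (a + b == 0).
    by apply/eqP/eqP; lia.
  by rewrite subrK.
(* An index whose shift leaves the range is too close to its ends to contribute, so the truncation
   loses nothing when a Kronecker delta is summed. *)
have out l : l \in R -> (l - b \notin R) || (l - a \notin R) ->
    normE (l - (a + b)) l w = 0.
  by rewrite !mem_int_range /N => h1 h2; apply: (normE_out vM); lia.
have -> : \sum_(k <- R) \sum_(l <- R) (k == l - b)%:R *: ((f k * g l) *: psi (l - (a + b)) (psi_adj l w))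
  = \sum_(l <- R) (f (l - b) * g l) *: normE (l - (a + b)) l w
   + (\sum_(k <- R | (k + b \in R)) (f k * g (k + b)) * ((a + b == 0) && (k + b < 0))%:R) *: w.
  transitivity (\sum_(k <- R) \sum_(l <- R) (k == l - b)%:R *: ((f k * g l) *: normE (l - (a + b)) l w)
    + \sum_(k <- R) \sum_(l <- R) (l == k + b)%:R *: ((f k * g l * ((a + b == 0) && (l < 0))%:R) *: w)).
    rewrite -big_split; apply: eq_bigr => k _; rewrite -big_split; apply: eq_bigr => l _ /=.
    have -> : (l == k + b) = (k == l - b) by apply/eqP/eqP; lia.
    by rewrite psiN -[(f k * g l * _) *: w]scalerA -scalerDr -scalerDr.
  congr (_ + _).
    rewrite exchange_big; apply: eq_big_seq => l lR /=.
    rewrite (big_delta_seq (fun k => (f k * g l) *: normE (l - (a + b)) l w)) //.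
    by case: ifP => // /negbT h; rewrite out ?h // scaler0.
  rewrite scaler_suml [RHS]big_mkcond; apply: eq_bigr => k _.
  by rewrite (big_delta_seq (fun l => (f k * g l * ((a + b == 0) && (l < 0))%:R) *: w)).
have -> : \sum_(k <- R) \sum_(l <- R) (l == k - a)%:R *: ((f k * g l) *: psi (k - (a + b)) (psi_adj k w))
  = \sum_(k <- R) (f k * g (k - a)) *: normE (k - (a + b)) k w
   + (\sum_(k <- R | (k - a \in R)) (f k * g (k - a)) * ((a + b == 0) && (k < 0))%:R) *: w.
  transitivity (\sum_(k <- R) \sum_(l <- R) (l == k - a)%:R *: ((f k * g l) *: normE (k - (a + b)) k w)
    + \sum_(k <- R) \sum_(l <- R) (l == k - a)%:R *: ((f k * g l * ((a + b == 0) && (k < 0))%:R) *: w)).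
    rewrite -big_split; apply: eq_bigr => k _; rewrite -big_split; apply: eq_bigr => l _ /=.
    by rewrite psiN -[(f k * g l * _) *: w]scalerA -scalerDr -scalerDr.
  congr (_ + _).
    apply: eq_big_seq => k kR /=.
    rewrite (big_delta_seq (fun l => (f k * g l) *: normE (k - (a + b)) k w)) //.
    by case: ifP => // /negbT h; rewrite out ?h ?orbT // scaler0.
  rewrite scaler_suml [RHS]big_mkcond; apply: eq_bigr => k _.
  by rewrite (big_delta_seq (fun l => (f k * g l * ((a + b == 0) && (k < 0))%:R) *: w)).
rewrite subrACA_add; congr (_ + _).
  rewrite (@Eop_finite M N) //; last by rewrite /N; lia.
  by rewrite -sumrB; apply: eq_bigr => l _; rewrite scalerBl.
rewrite -scalerBl; congr (_ *: _).
case: eqP hab => [ab0|_] hab; last by rewrite !big1 ?subrr // => k _; rewrite mulr0.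
have eb : b = - a by lia.
have {hab} a_gt0 : 0 < a by move: hab; rewrite orbF.
(* The two scalar sums carry the conditions [k - a < 0] and [k < 0], which differ precisely for
   [0 <= k < a]. *)
rewrite eb -sumrB /cocycle -(@sum_int_range (fun k => f k * g (k - a)) N); last by rewrite /N; lia.
rewrite big_mkcond [RHS]big_mkcond; apply: eq_big_seq => k kR /=.
move: kR; rewrite !mem_int_range /N => kR.
have [h0|h0] := boolP (0 <= k < `|a|%:Z).
  have -> : (- (M + (`|a| + `|a|) + (`|b| + `|b|))%N%:Z <= k - a < (M + (`|a| + `|a|) + (`|b| + `|b|))%N%:Z) by lia.
  have -> : (k - a < 0) by lia.
  have -> : (k < 0) = false by lia.
  by rewrite mulr1 mulr0 subr0.
case: ifP => // _.
have -> : (k - a < 0) = (k < 0) by lia.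
by rewrite subrr.
Qed.

Lemma Eop_comm_central f g (h : int -> A) (c p : A) a b w :
  a != 0 -> b != 0 -> (0 < a) || (a + b != 0) ->
  (forall l, f (l - b) * g l - f l * g (l - a) = c * h l) ->
  (a + b = 0 -> cocycle f g a = c * p) ->
  Eop f a (Eop g b w) - Eop g b (Eop f a w) =
  c *: (Eop h (a + b) w + (if a + b == 0 then p *: w else 0)).
Proof.
move=> nz_a nz_b hab hh hp; rewrite Eop_comm // scalerDr scale_Eop.
congr (_ + _); first exact: eq_Eop.
by case: eqP => [/hp ->|_]; rewrite ?scale0r ?scaler0 // scalerA.
Qed.

End InfiniteSums.

Lemma subr_swap_add (V : zmodType) (x y z : V) : x - y = z -> x = y + z.
Proof. by move=> <-; rewrite addrC subrK. Qed.

(** * The left and right vacuum *)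

Section VacuumVectors.
Context (A : comNzRingType).
Implicit Types (u : wedge A) (k : int).

Lemma wedge_eq0 (f : wedge A -> A) : (forall u v, f (u + v) = f u + f v) ->
  (forall c u, f (c *: u) = c * f u) -> (forall S, f (Defs.basis A S) = 0) ->
  forall u, f u = 0.
Proof.
move=> fD fZ fB u; rewrite -(freeg_sumE u).
have f0 : f 0 = 0 by rewrite -[0 in LHS](scale0r 0) fZ mul0r.
elim: (dom u) => [|x s IH]; first by rewrite big_nil.
by rewrite big_cons fD IH addr0 freegU_scale fZ fB mulr0.
Qed.

Lemma coeff_vacuum_psi k u : 0 <= k -> coeff fset0 (psi k u) = 0.
Proof.
move=> ge0; apply: (@wedge_eq0 (fun u => coeff fset0 (psi k u))) => [v w|c v|S].
- by rewrite (linearD (psi k)) coeffD.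
- by rewrite (linearZ_LR (psi k)) coeffZ.
- rewrite psi_adjoint psi_adj_basis /occupied inE addbF ltNge ge0.
  by rewrite coeff0.
Qed.

Lemma coeff_vacuum_psi_adj k u : k < 0 -> coeff fset0 (psi_adj k u) = 0.
Proof.
move=> lt0; apply: (@wedge_eq0 (fun u => coeff fset0 (psi_adj k u))) => [v w|c v|S].
- by rewrite (linearD (psi_adj k)) coeffD.
- by rewrite (linearZ_LR (psi_adj k)) coeffZ.
- by rewrite -psi_adjoint psi_basis /occupied inE addbF lt0 coeff0.
Qed.

Lemma psi_vacuum k : k < 0 -> psi k (vacuum A) = 0.
Proof. by move=> lt0; rewrite psi_basis /occupied inE addbF lt0. Qed.

Lemma psi_adj_vacuum k : 0 <= k -> psi_adj k (vacuum A) = 0.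
Proof. by move=> ge0; rewrite psi_adj_basis /occupied inE addbF ltNge ge0. Qed.

(** For [k >= 0] the site [k] is empty, for [k < 0] the site [k - a] is filled. The case [a = 0] is
    included, so the one-point function of [calE 0] is its scalar term alone. *)
Lemma Eop_vacuum f (a : int) : 0 <= a -> Eop f a (vacuum A) = 0.
Proof.
move=> a_gt0; rewrite /Eop fsbig1 // => k _; rewrite /normE.
case: ifP => hk; first by rewrite psi_adj_vacuum // (linear0 (psi _)) scaler0.
by rewrite psi_vacuum ?(linear0 (psi_adj _)) ?oppr0 ?scaler0 //; lia.
Qed.

Lemma coeff_vacuum_Eop f (a : int) u : a < 0 -> coeff fset0 (Eop f a u) = 0.
Proof.
move=> a_lt0; have [M vM] := vanish_out_ex u.
rewrite (Eop_finite _ vM (leqnn _)) raddf_sum big1 // => k _ /=.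
rewrite coeffZ /normE; case: ifP => hk.
  by rewrite coeff_vacuum_psi ?mulr0 //; lia.
by rewrite coeffN coeff_vacuum_psi_adj ?oppr0 ?mulr0 //; lia.
Qed.

End VacuumVectors.

(** * The commutation relation of [calE] and the rules for correlators *)

Section Exponents.
Context (K : numFieldType) (V : lmodType K) (z w : V) (a b l : int).

(** As weights are centred at [k - a / 2], the exponents of the two orders of composition lie
    symmetrically around that of energy [a + b], at distance half of [a w - b z]. This symmetry
    produces [varsigma]. *)
Lemma exponent_pos :
  ((l - b)%:~R + 2^-1 - a%:~R / 2) *: z + (l%:~R + 2^-1 - b%:~R / 2) *: w
  = 2^-1 *: (w *~ a - z *~ b) + (l%:~R + 2^-1 - (a + b)%:~R / 2) *: (z + w).
Proof.
rewrite -!scaler_int scalerBr !scalerA scalerDr addrC.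
rewrite [2^-1 * _ *: w - _]addrC addrACA -scaleNr -!scalerDl addrC.
by congr (_ *: _ + _ *: _); rewrite !(rmorphB, rmorphD) /=; field.
Qed.

Lemma exponent_neg :
  (l%:~R + 2^-1 - a%:~R / 2) *: z + ((l - a)%:~R + 2^-1 - b%:~R / 2) *: w
  = - (2^-1 *: (w *~ a - z *~ b)) + (l%:~R + 2^-1 - (a + b)%:~R / 2) *: (z + w).
Proof.
rewrite -!scaler_int -scaleNr scalerBr !scalerA scalerDr addrC.
rewrite [_ * _ *: w - _]addrC addrACA -scaleNr -!scalerDl addrC.
by congr (_ *: _ + _ *: _); rewrite !(rmorphB, rmorphD) /=; field.
Qed.

End Exponents.

Section Correlators.
Context (K : numFieldType) (n : nat).
Local Notation A := {fraction mps n K}.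
Implicit Types (z w : mps n K) (a b : int) (u v : wedge A).

Definition mode a z (k : int) : mps n K :=
  fexp ((k%:~R + 2^-1 - a%:~R / 2) *: z).

Lemma calE_Eop a z v : calE a z v =
  Eop (fun k => (mode a z k)%:F) a v
  + (if a == 0 then ((varsigma z)%:F)^-1 *: v else 0).
Proof. by []. Qed.

Lemma varsigmaM_fexp (x y : mps n K) : x 0%MM = 0 -> y 0%MM = 0 ->
  varsigma x * fexp y = fexp (2^-1 *: x + y) - fexp (- (2^-1 *: x) + y).
Proof.
move=> x0 y0; have h : (2^-1 *: x) 0%MM = 0 by rewrite mpsE_scale x0 mulr0.
have h' : (- (2^-1 *: x)) 0%MM = 0 by rewrite mpsE_opp h oppr0.
by rewrite (fexpD h y0) (fexpD h' y0) -mulrBl.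
Qed.

Lemma mode_comm a b z w (l : int) : z 0%MM = 0 -> w 0%MM = 0 ->
  mode a z (l - b) * mode b w l - mode a z l * mode b w (l - a)
  = varsigma (w *~ a - z *~ b) * mode (a + b) (z + w) l.
Proof.
move=> z0 w0.
have p0 : (w *~ a - z *~ b) 0%MM = 0.
  by rewrite mpsE_add mpsE_opp !mps_intE z0 w0 !mul0rz subr0.
have q0 (c : K) : (c *: (z + w)) 0%MM = 0.
  by rewrite mpsE_scale mpsE_add z0 w0 addr0 mulr0.
have z0' (c : K) : (c *: z) 0%MM = 0 by rewrite mpsE_scale z0 mulr0.
have w0' (c : K) : (c *: w) 0%MM = 0 by rewrite mpsE_scale w0 mulr0.
rewrite (varsigmaM_fexp p0 (q0 _)) -(exponent_pos z w a b l) -(exponent_neg z w a b l).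
by rewrite (fexpD (z0' _) (w0' _)) (fexpD (z0' _) (w0' _)).
Qed.

(** The exponents [i + 1/2 - a/2] are spaced by one and symmetric around zero, so the cocycle is a
    geometric sum equal to a quotient of two [varsigma]. This accounts for the scalar term of
    [calE 0]. *)
Lemma cocycle_mode a z w : 0 < a -> z 0%MM = 0 -> w 0%MM = 0 ->
  (\sum_(i < `|a|) mode a z i%:Z * mode (- a) w (i%:Z - a)) * varsigma (z + w)
  = varsigma ((z + w) *~ a).
Proof.
move=> a_gt0 z0 w0.
have s0 : (z + w) 0%MM = 0 by rewrite mpsE_add z0 w0 addr0.
have z0' (c : K) : (c *: z) 0%MM = 0 by rewrite mpsE_scale z0 mulr0.
have w0' (c : K) : (c *: w) 0%MM = 0 by rewrite mpsE_scale w0 mulr0.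
have [k ->] : exists k : nat, a = k%:Z by exists `|a|%N; lia.
rewrite absz_nat; transitivity ((\sum_(i < k)
    fexp ((- (k%:R / 2) + 2^-1 + i%:R) *: (z + w))) * varsigma (z + w)).
  congr (_ * _); apply: eq_bigr => i0 _; rewrite /mode -(fexpD (z0' _) (w0' _)).
  congr (fexp _); rewrite scalerDr; congr (_ *: _ + _ *: _).
    by rewrite -!pmulrn; ring.
  by rewrite rmorphB rmorphN /= -!pmulrn; field.
rewrite (sum_fexp_varsigma _ _ s0) /varsigma -pmulrn -scaler_nat scalerA -scaleNr.
have -> : - (k%:R / 2) + k%:R = 2^-1 * k%:R :> K by field.
by have -> : - (k%:R / 2) = - (2^-1 * k%:R) :> K by field.
Qed.

Lemma calE_is_linear a z : linear (calE a z).
Proof.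
exact: Eop_add_is_linear. Qed.

HB.instance Definition _ a z :=
  GRing.isLinear.Build A (wedge A) (wedge A) *:%R (@calE K n a z) (calE_is_linear a z).

Lemma calE_comm a b z w v : z 0%MM = 0 -> w 0%MM = 0 -> a != 0 -> b != 0 ->
  (a + b != 0) || (z + w != 0) ->
  calE a z (calE b w v) - calE b w (calE a z v)
  = (varsigma (w *~ a - z *~ b))%:F *: calE (a + b) (z + w) v.
Proof.
(* For [a + b = 0] the cocycle is computed with [a] positive; the other case follows by exchanging
   the operators, as both sides change sign. *)
wlog hab : a b z w / (0 < a) || (a + b != 0).
  move=> W z0 w0 nz_a nz_b h.
  have [hab|hab] := boolP ((0 < a) || (a + b != 0)); first exact: W.
  have hab' : (0 < b) || (b + a != 0) by lia.
  have h' : (b + a != 0) || (w + z != 0) by rewrite (addrC b) (addrC w).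
  have := W b a w z hab' w0 z0 nz_b nz_a h'.
  rewrite (addrC b) (addrC w) => /(congr1 -%R); rewrite opprB => ->.
  by rewrite -scaleNr -tofracN -varsigmaN opprB.
move=> z0 w0 nz_a nz_b h.
have s0 : (z + w) 0%MM = 0 by rewrite mpsE_add z0 w0 addr0.
have calE_nz c y u : c != 0 -> calE c y u = Eop (fun k => (mode c y k)%:F) c u.
  by move=> nz_c; rewrite calE_Eop (negbTE nz_c) addr0.
rewrite !(calE_nz a) // !(calE_nz b) // (calE_Eop (a + b)).
apply: Eop_comm_central => // [l|ab0].
  by rewrite -!tofracM -tofracB; congr (_%:F); apply: mode_comm.
have nz_s : z + w != 0 by move: h; rewrite ab0.
have a_gt0 : 0 < a by move: hab; rewrite ab0 orbF.
have eb : b = - a by lia.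
apply: (canRL (mulfK _)); first by rewrite tofrac_eq0 varsigma_neq0.
rewrite eb mulrNz opprK -mulrzDl [w + z]addrC -(cocycle_mode a_gt0 z0 w0).
rewrite tofracM rmorph_sum /=; congr (_ * _); apply: eq_bigr => i0 _.
by rewrite tofracM.
Qed.

(** The fold of [correlator] for arbitrary words, since commutators leave the words given by [mu]
    and [nu]. *)
Definition gops (L : seq (int * mps n K)) : wedge A -> wedge A :=
  foldr (fun az P => calE az.1 az.2 \o P) id L.

Definition gcorr L : A := vev (gops L).

Lemma gops_cat L1 L2 v : gops (L1 ++ L2) v = gops L1 (gops L2 v).
Proof. by elim: L1 => //= az L1 ->. Qed.

Fact gops_is_linear L : linear (gops L).
Proof.
elim: L => [//|az L IH] c u v /=.
by rewrite IH (linearP (calE az.1 az.2)).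
Qed.
HB.instance Definition _ L :=
  GRing.isLinear.Build A (wedge A) (wedge A) *:%R (gops L) (gops_is_linear L).

Lemma gcorr_swap L1 L2 a b z w : z 0%MM = 0 -> w 0%MM = 0 -> a != 0 -> b != 0 ->
  (a + b != 0) || (z + w != 0) ->
  gcorr (L1 ++ (a, z) :: (b, w) :: L2) = gcorr (L1 ++ (b, w) :: (a, z) :: L2)
   + (varsigma (w *~ a - z *~ b))%:F * gcorr (L1 ++ (a + b, z + w) :: L2).
Proof.
move=> z0 w0 nz_a nz_b h; rewrite /gcorr /vev !gops_cat /=.
rewrite (subr_swap_add (calE_comm (gops L2 (vacuum A)) z0 w0 nz_a nz_b h)).
by rewrite (linearD (gops L1)) (linearZ_LR (gops L1)) coeffD coeffZ.
Qed.

Lemma gcorr_neg L a z : a < 0 -> gcorr ((a, z) :: L) = 0.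
Proof.
move=> a_lt0; rewrite /gcorr /vev /= calE_Eop.
have -> : (a == 0) = false by lia.
by rewrite addr0 coeff_vacuum_Eop.
Qed.

Lemma gcorr_pos L a z : 0 < a -> gcorr (rcons L (a, z)) = 0.
Proof.
move=> a_gt0; rewrite /gcorr /vev -cats1 gops_cat /= calE_Eop.
have -> : (a == 0) = false by lia.
by rewrite addr0 Eop_vacuum ?ltW // (linear0 (gops L)) coeff0.
Qed.

Lemma gcorr1 z : gcorr [:: (0, z)] = (varsigma z)%:F^-1.
Proof.
rewrite /gcorr /vev /= calE_Eop eqxx Eop_vacuum // add0r coeffZ coeffU eqxx.
by rewrite !mulr1.
Qed.

Lemma gcorr_pair a z w : z 0%MM = 0 -> w 0%MM = 0 -> 0 < a -> z + w != 0 ->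
  gcorr [:: (a, z); (- a, w)] = (varsigma ((z + w) *~ a))%:F / (varsigma (z + w))%:F.
Proof.
move=> z0 w0 a_gt0 nz.
have nz_a : a != 0 by lia.
have nz_Na : - a != 0 by lia.
have nz' : (a - a != 0) || (z + w != 0) by rewrite nz orbT.
have lt0 : - a < 0 by lia.
rewrite (gcorr_swap [::] [::] z0 w0 nz_a nz_Na nz') (gcorr_neg _ _ lt0) add0r.
by rewrite addrN gcorr1 mulrNz opprK -mulrzDl [w + z]addrC.
Qed.

End Correlators.

(** * Words of commuting blocks *)

(* The import makes the lemma names of finset visible again, which
   classical_sets shadows. *)
Module SetCompositions.
Import mathcomp.boot.finset.

Section Words.
Context (T : finType).
Implicit Types (S X Y A B : {set T}) (W : seq {set T}).

(** Ordered set partitions. An operator is indexed by the set of letters merged into it, over which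
    energy and z-variable are additive; the class is closed under exchanging and merging
    neighbours. *)
Fixpoint set_composition S W : bool :=
  if W is X :: W' then [&& X != set0, X \subset S & set_composition (S :\: X) W']
  else S == set0.

Lemma set_composition_sub S W X : set_composition S W -> X \in W -> X \subset S.
Proof.
elim: W S => //= Y W IH S /and3P[_ sub h]; rewrite inE => /predU1P[->//|XW].
by exact: fintype.subset_trans (IH _ h XW) (subsetDl _ _).
Qed.

Lemma set_composition_nonempty S W X :
  set_composition S W -> X \in W -> X != set0.
Proof.
elim: W S => //= Y W IH S /and3P[nz _ h]; rewrite inE => /predU1P[->//|XW].
exact: IH h XW.
Qed.

Lemma set_composition_mid S W1 X Y W2 :
  set_composition S (W1 ++ X :: Y :: W2) ->
  [/\ set_composition S (W1 ++ Y :: X :: W2),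
      set_composition S (W1 ++ (X :|: Y) :: W2), [disjoint X & Y],
      X \subset S & Y \subset S].
Proof.
elim: W1 S => [|Z W1 IH] S /=.
  move=> /and5P[nX subX nY subY]; rewrite subsetD in subY.
  case/andP: subY => subY dYX h; rewrite nX nY subX subY subUset subX subY.
  rewrite subsetD subX disjoint_sym dYX andbT /=.
  by rewrite setUC setU_eq0 negb_and nY -setDDl setDDl setUC -setDDl h.
move=> /and3P[nZ subZ /IH[-> -> -> sX sY]]; rewrite nZ subZ; split=> //.
  exact: fintype.subset_trans sX (subsetDl _ _).
exact: fintype.subset_trans sY (subsetDl _ _).
Qed.

Lemma set_composition1 S X : set_composition S [:: X] -> X = S.
Proof.
move=> /= /and3P[_ sXS]; rewrite setD_eq0 => sSX.
by apply/eqP; rewrite eqEsubset sXS.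
Qed.

Lemma set_composition_rcons S W X :
  set_composition S (rcons W X) = set_composition S (X :: W).
Proof.
elim: W S => [//|Y W IH] S; rewrite rcons_cons /= IH /= !subsetD !setDDl setUC.
by rewrite [X :|: Y]setUC; do 2 case: (_ == set0) => //=;
  rewrite ?andbF // disjoint_sym; do 2 case: (_ \subset S); rewrite ?andbF //=.
Qed.

Lemma set_composition_proper S W X : W != [::] -> set_composition S (X :: W) ->
  X != S.
Proof.
case: W => // Y W _ /= /and5P[_ _ nY sY _]; apply: contraNneq nY => e.
by rewrite e setDv subset0 in sY.
Qed.

Lemma set_composition_filter S W A B : A :|: B = [set: T] -> [disjoint A & B] ->
  set_composition S W -> all (fun X : {set T} => (X \subset A) || (X \subset B)) W ->
  set_composition (S :&: A) [seq X : {set T} <- W | X \subset A].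
Proof.
move=> AB dAB; elim: W S => [|X W IH] S /=.
  by move/eqP->; rewrite set0I eqxx.
move=> /and3P[nX sXS wf] /andP[sX allW]; have {}IH := IH _ wf allW.
have [sXA|nsXA] := boolP (X \subset A).
  by rewrite /= nX subsetI sXS sXA /= -setIDAC.
have sXB : X \subset B by move: sX; rewrite (negbTE nsXA).
have -> // : S :&: A = (S :\: X) :&: A.
rewrite setIDAC; apply/esym/setDidPl.
rewrite disjoint_sym; apply: disjointWl sXB _; rewrite disjoint_sym.
by apply: disjointWl dAB; apply: subsetIr.
Qed.

Section Functionals.
Context (F : fieldType) (c : {set T} -> {set T} -> F).
Implicit Types (Phi Psi : seq {set T} -> F) (neg : pred {set T}).

Definition swap_rel S Phi := forall W1 X Y W2,
  set_composition S (W1 ++ X :: Y :: W2) ->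
  Phi (W1 ++ X :: Y :: W2) =
  Phi (W1 ++ Y :: X :: W2) + c X Y * Phi (W1 ++ (X :|: Y) :: W2).

(** The one-block word is exempt here and in [vanish_last]: its value is the normalization that the
    rules leave free. *)
Definition vanish_first neg S Phi := forall X W,
  W != [::] -> set_composition S (X :: W) -> neg X -> Phi (X :: W) = 0.

Definition vanish_last neg S Phi := forall X W,
  W != [::] -> set_composition S (rcons W X) -> ~~ neg X -> Phi (rcons W X) = 0.

(* If every block is nonnegative, the last one kills the word; otherwise a
   negative block is commuted to the front, each commutator merging two blocks. *)
Lemma functional_eq0 neg S Phi : swap_rel S Phi -> vanish_first neg S Phi ->
  vanish_last neg S Phi -> Phi [:: S] = 0 ->
  forall W, W != [::] -> set_composition S W -> Phi W = 0.
Proof.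
move=> sw vf vl P1 W; move: {2}(size W) (leqnn (size W)) => n.
elim: n W => [|n IH] W; first by rewrite leqn0 size_eq0 => /eqP->.
case: W => // X0 W0; have [->|nz0] := eqVneq W0 [::].
  by move=> _ _ /set_composition1->.
move=> szW _ wf; have [/hasP[X XW negX]|/hasPn allpos] := boolP (has neg (X0 :: W0)).
  have szW1 : (1 < size (X0 :: W0))%N by case: W0 nz0 {szW wf XW}.
  case/splitPr: XW szW wf szW1 => W1 W2.
  elim/last_ind: W1 W2 => [|W1 Y IHW] W2 szW wf szW1.
    apply: vf => //; by case: W2 szW1 {szW wf}.
  rewrite cat_rcons in szW wf szW1 *.
  have [wf1 wf2 _ _ _] := set_composition_mid wf.
  rewrite sw // IHW ?add0r; last first.
  - by move: szW1; rewrite !size_cat.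
  - by [].
  - by move: szW; rewrite !size_cat.
  rewrite (IH _ _ _ wf2) ?mulr0 //; last by case: (W1).
  by move: szW; rewrite !size_cat /= !addnS ltnS.
move: nz0 allpos wf; case/lastP: W0 {szW} => // W X _ allpos.
rewrite -rcons_cons => wf; apply: vl => //.
by apply: allpos; rewrite inE mem_rcons inE eqxx orbT.
Qed.

(** The cross-multiplied difference of the two functionals obeys the same rules and is zero on
    [[:: S]]. *)
Lemma functional_proportional neg S Phi Psi :
  swap_rel S Phi -> vanish_first neg S Phi -> vanish_last neg S Phi ->
  swap_rel S Psi -> vanish_first neg S Psi -> vanish_last neg S Psi ->
  forall W, W != [::] -> set_composition S W ->
  Phi W * Psi [:: S] = Psi W * Phi [:: S].
Proof.
move=> s1 f1 l1 s2 f2 l2 W nz wf; apply/eqP; rewrite -subr_eq0; apply/eqP.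
pose D W := Phi W * Psi [:: S] - Psi W * Phi [:: S].
rewrite -/(D W); apply: (@functional_eq0 neg S D) => //.
- move=> W1 X Y W2 wf'; rewrite /D (s1 _ _ _ _ wf') (s2 _ _ _ _ wf'); ring.
- by move=> X W' nz' wf' nX; rewrite /D (f1 _ _ nz' wf' nX) (f2 _ _ nz' wf' nX) !mul0r subr0.
- by move=> X W' nz' wf' nX; rewrite /D (l1 _ _ nz' wf' nX) (l2 _ _ nz' wf' nX) !mul0r subr0.
- by rewrite /D mulrC subrr.
Qed.

(** Fixing a nonnegative head [C] gives a functional on the words in its complement. It still kills
    a negative first block [X]: commuting [X] past [C] leaves words that begin with [X] or with
    [C :|: X], both negative. *)
Lemma functional_head neg Phi Psi C :
  swap_rel [set: T] Phi -> vanish_first neg [set: T] Phi ->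
  vanish_last neg [set: T] Phi ->
  C != set0 -> ~: C != set0 -> ~~ neg C ->
  (forall X, X != set0 -> X \proper ~: C -> neg X -> neg (C :|: X)) ->
  swap_rel (~: C) Psi -> vanish_first neg (~: C) Psi ->
  vanish_last neg (~: C) Psi ->
  forall W, W != [::] -> set_composition (~: C) W ->
  Phi (C :: W) * Psi [:: ~: C] = Psi W * (c C (~: C) * Phi [:: [set: T]]).
Proof.
move=> sw vf vl nC nCc posC negU sw' vf' vl' W nz wfW.
have wfC W' : set_composition [set: T] (C :: W') = set_composition (~: C) W'.
  by rewrite /= nC subsetT setTD.
have wf2 : set_composition [set: T] [:: C; ~: C].
  by rewrite wfC /= nCc subxx setDv eqxx.
(* With the nonnegative [C] in last place the word vanishes, so only the commutator remains. *)
have PhiC : Phi [:: C; ~: C] = c C (~: C) * Phi [:: [set: T]].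
  rewrite (sw [::] C (~: C) [::] wf2) /= setUCr.
  rewrite -[X in X + _ = _]/(Phi (rcons [:: ~: C] C)) vl ?add0r //.
  by have [] := set_composition_mid (W1 := [::]) wf2.
rewrite -PhiC; apply: (@functional_proportional neg (~: C) (fun W => Phi (C :: W))) => //.
- move=> W1 X Y W2 wf.
  have w : set_composition [set: T] (C :: W1 ++ X :: Y :: W2) by rewrite wfC.
  exact: (sw (C :: W1) X Y W2 w).
- move=> X W' nz' wf negX.
  have wf' : set_composition [set: T] (C :: X :: W') by rewrite wfC.
  have /= -> := sw [::] C X W' wf'.
  have [/= w1 w2 _ _ _] := set_composition_mid (W1 := [::]) wf'.
  have nCX : neg (C :|: X).
    apply: negU => //; first by case/and3P: wf.
    rewrite properEneq (set_composition_proper nz' wf) /=.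
    by case/and3P: wf.
  by rewrite (vf _ (C :: W') isT w1 negX) (vf _ _ nz' w2 nCX) mulr0 addr0.
- move=> X W' nz' wf posX; rewrite -rcons_cons; apply: vl => //.
  by rewrite rcons_cons wfC.
Qed.

Section Crossing.
Context (A : {set T}) (neg1 neg2 : pred {set T}).
Local Notation B := (~: A).
Context (Phi1 Phi2 PhiA PhiB : seq {set T} -> F).
Hypotheses (nA : A != set0) (nB : B != set0).
Hypothesis cBA : c B A = - c A B.
Hypotheses (neg1A : neg1 A) (pos1B : ~~ neg1 B) (pos2A : ~~ neg2 A) (neg2B : neg2 B).
Hypothesis neg12 : forall X, X != set0 -> X != [set: T] -> X != A ->
  X != B -> neg1 X = neg2 X.
Hypothesis negUA : forall X, X != set0 -> X \proper B -> neg2 X -> neg2 (A :|: X).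
Hypothesis negUB : forall X, X != set0 -> X \proper A -> neg1 X -> neg1 (B :|: X).
Hypotheses (sw1 : swap_rel [set: T] Phi1) (sw2 : swap_rel [set: T] Phi2).
Hypotheses (vf1 : vanish_first neg1 [set: T] Phi1)
  (vf2 : vanish_first neg2 [set: T] Phi2).
Hypotheses (vl1 : vanish_last neg1 [set: T] Phi1)
  (vl2 : vanish_last neg2 [set: T] Phi2).
Hypothesis Phi12 : Phi1 [:: [set: T]] = Phi2 [:: [set: T]].
Hypotheses (swA : swap_rel A PhiA) (swB : swap_rel B PhiB).
Hypotheses (vfA : vanish_first neg2 A PhiA) (vfB : vanish_first neg2 B PhiB).
Hypotheses (vlA : vanish_last neg2 A PhiA) (vlB : vanish_last neg2 B PhiB).
Hypotheses (PhiA_neq0 : PhiA [:: A] != 0) (PhiB_neq0 : PhiB [:: B] != 0).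

Local Notation split_block := (fun X : {set T} => (X \subset A) || (X \subset B)).
Local Notation restr D W := [seq X : {set T} <- W | X \subset D].

Definition split_functional W : F :=
  if all split_block W then PhiA (restr A W) * PhiB (restr B W) else 0.

Let AB : A :|: B = [set: T]. Proof. exact: setUCr. Qed.
Let dAB : [disjoint A & B]. Proof. by rewrite -setI_eq0 setICr. Qed.

Let wfA W : set_composition [set: T] W -> all split_block W ->
  set_composition A (restr A W).
Proof. by move=> wf h; have := set_composition_filter AB dAB wf h; rewrite setTI. Qed.

Let wfB W : set_composition [set: T] W -> all split_block W ->
  set_composition B (restr B W).
Proof.
move=> wf h; have := @set_composition_filter _ W B A.
rewrite setUC AB disjoint_sym => /(_ _ erefl dAB wf); rewrite setTI; apply.
by apply: sub_all h => X; rewrite orbC.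
Qed.

Let subAB X : X != set0 -> X \subset A -> (X \subset B) = false.
Proof.
move=> nX sA; apply/negP => sB; case/negP: nX; rewrite -subset0 -(setICr A).
by rewrite subsetI sA.
Qed.

(** Two blocks on the same side inherit the rule from [PhiA] or [PhiB]. Blocks on opposite sides
    commute, consistently with the value zero on their union, which meets both sides. *)
Let split_functional_swap : swap_rel [set: T] split_functional.
Proof.
move=> W1 X Y W2 wf; have [wf1 wf2 dXY _ _] := set_composition_mid wf.
have nX : X != set0.
  by apply: (set_composition_nonempty wf); rewrite mem_cat !inE eqxx orbT.
have nY : Y != set0.
  by apply: (set_composition_nonempty wf); rewrite mem_cat !inE eqxx !orbT.
have allsw : all split_block (W1 ++ Y :: X :: W2) = all split_block (W1 ++ X :: Y :: W2).
  by rewrite !all_cat /=; do !bool_congr.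
rewrite /split_functional allsw; case: ifP => hall; last first.
  case: ifP => hall'; last by rewrite mulr0 addr0.
  move: hall hall'; rewrite !all_cat /= !subUset.
  case: (all _ W1) => //=; case: (all _ W2); rewrite ?andbF // !andbT.
  by do 4 case: (_ \subset _).
have hall1 := hall; have wfa := wfA wf hall; have wfb := wfB wf hall.
move: hall1; rewrite !all_cat /= => /and4P[all1 sX sY all2].
rewrite !filter_cat /= all1 all2 /= andbT !subUset in wfa wfb *.
have [XA|XA] := boolP (X \subset A); rewrite ?XA ?(negbTE XA) /= in sX wfa wfb *.
  rewrite (subAB nX XA) in wfb *.
  have [YA|YA] := boolP (Y \subset A); rewrite ?YA ?(negbTE YA) /= in sY wfa wfb *.
    by rewrite (subAB nY YA) swA // mulrDl mulrA.
  by rewrite sY mulr0 addr0.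
have [YA|YA] := boolP (Y \subset A); rewrite ?YA ?(negbTE YA) /= in sY wfa wfb *.
  by rewrite sX (subAB nY YA) /= mulr0 addr0.
by rewrite sX sY /= in wfb *; rewrite swB // mulrDr mulrCA.
Qed.

Lemma crossing_difference W : set_composition [set: T] W -> W != [::] ->
  all split_block W ->
  Phi2 W - Phi1 W = c A B * Phi2 [:: [set: T]] / (PhiA [:: A] * PhiB [:: B])
    * (PhiA (restr A W) * PhiB (restr B W)).
Proof.
set kappa := _ / _ => wf nz hall.
pose D W := Phi2 W - Phi1 W - kappa * split_functional W.
suff : D W = 0 by rewrite /D /split_functional hall => /eqP; rewrite subr_eq0 => /eqP.
have nsBA : ~~ (B \subset A) by apply/negP => /(subAB nB); rewrite subxx.
have neg12A X : X != set0 -> X \subset A -> X != A -> neg1 X = neg2 X.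
  move=> nX sX nXA; apply: neg12 => //; last by apply: contraNneq nsBA => <-.
  by apply: contraNneq nsBA => eX; rewrite eX subTset in sX; rewrite (eqP sX) subsetT.
(* Proper blocks of [A] have the same sign for both rules, so [PhiA] can also be compared with
   [Phi1]. *)
have vfA1 : vanish_first neg1 A PhiA.
  move=> Y W2 nz2 w2 negY; apply: vfA => //; case/and3P: (w2) => nY sY _.
  by rewrite -neg12A // (set_composition_proper nz2 w2).
have vlA1 : vanish_last neg1 A PhiA.
  move=> Y W2 nz2 w2 posY; apply: vlA => //.
  have w2' : set_composition A (Y :: W2) by rewrite -set_composition_rcons.
  case/and3P: (w2') => nY sY _.
  by rewrite -neg12A // (set_composition_proper nz2 w2').
(* [A] and [B] are negative for one rule each. With both counted as negative, a nonnegative last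
   block is neither of them, and words that begin with them are evaluated by [functional_head]. *)
pose neg3 : pred {set T} := fun X => neg1 X || neg2 X.
(* A block that does not exhaust its side leaves further blocks there, so the vanishing rules of
   [PhiA] or [PhiB] apply. *)
have subA X W' : all split_block (X :: W') -> set_composition [set: T] (X :: W') ->
    W' != [::] -> X != A -> X != B ->
    ((X \subset A) && (restr A W' != [::])) || ((X \subset B) && (restr B W' != [::])).
  move=> h w nW' nXA nXB; have wa := wfA w h; have wb := wfB w h.
  move: h => /= /andP[/orP[sX|sX] _]; rewrite sX /=.
    apply/orP; left; apply/eqP => e; rewrite /= sX e in wa.
    by case/eqP: nXA; apply: set_composition1 wa.
  apply/orP; right; apply/eqP => e; rewrite /= sX e in wb.
  by case/eqP: nXB; apply: set_composition1 wb.
apply: (@functional_eq0 neg3 [set: T] D) => //.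
- move=> W1 X Y W2 w; rewrite /D (sw1 w) (sw2 w) (split_functional_swap w); ring.
- move=> X W' nW' w negX.
  have nX : X != set0 by case/and3P: w.
  have wfW' : set_composition (~: X) W' by case/and3P: w; rewrite setTD.
  (* When [A] comes first, [Phi1] vanishes and [Phi2] is a multiple of [PhiB] on the rest; this case
     dictates [kappa]. *)
  have [eXA|nXA] := eqVneq X A.
    have hW' : all (fun Y : {set T} => Y \subset B) W'.
      by apply/allP => Y; rewrite -eXA; apply: set_composition_sub wfW'.
    have hA : restr A W' = [::].
      rewrite -(filter_pred0 W'); apply: eq_in_filter => Y YW' /=.
      apply/negP => sYA; have := allP hW' _ YW'; rewrite subAB //.
      exact: set_composition_nonempty wfW' YW'.
    have hB : restr B W' = W' by apply/all_filterP.
    have hsp : all split_block W' by apply: sub_all hW' => Y ->; rewrite orbT.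
    rewrite /D /split_functional eXA /= subxx /= hsp (subAB nA (subxx _)) hA hB.
    rewrite eXA in w wfW'.
    rewrite (vf1 nW' w) // subr0; apply/eqP; rewrite subr_eq0; apply/eqP.
    apply: (mulIf PhiB_neq0).
    rewrite (functional_head sw2 vf2 vl2 nA nB pos2A negUA swB vfB vlB) //.
    by rewrite /kappa; field; rewrite PhiA_neq0 PhiB_neq0.
  (* When [B] comes first, [Phi2] vanishes and [Phi1] enters with a minus sign, which the
     antisymmetry [cBA] compensates. *)
  have [eXB|nXB] := eqVneq X B.
    have hW' : all (fun Y : {set T} => Y \subset A) W'.
      by apply/allP => Y; rewrite -[A]setCK -eXB; apply: set_composition_sub wfW'.
    have hB : restr B W' = [::].
      rewrite -(filter_pred0 W'); apply: eq_in_filter => Y YW' /=.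
      rewrite subAB //; first exact: set_composition_nonempty wfW' YW'.
      exact: (allP hW').
    have hA : restr A W' = W' by apply/all_filterP.
    have hsp : all split_block W' by apply: sub_all hW' => Y ->.
    rewrite /D /split_functional eXB /= subxx (negbTE nsBA) /= hsp hA hB.
    rewrite eXB in w wfW'; rewrite setCK in wfW'.
    rewrite (vf2 nW' w) // sub0r; apply/eqP; rewrite subr_eq0; apply/eqP.
    apply: (mulIf PhiA_neq0).
    have nBc : ~: B != set0 by rewrite setCK.
    have := @functional_head neg1 Phi1 PhiA B sw1 vf1 vl1 nB nBc pos1B.
    rewrite setCK => /(_ negUB swA vfA1 vlA1 W' nW' wfW') H.
    rewrite mulNr H cBA Phi12 /kappa; field; by rewrite PhiA_neq0 PhiB_neq0.
  have nXT := set_composition_proper nW' w.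
  have e12 := neg12 nX nXT nXA nXB.
  have neg2X : neg2 X by move: negX; rewrite /neg3 e12 orbb.
  have neg1X : neg1 X by rewrite e12.
  rewrite /D (vf1 nW' w neg1X) (vf2 nW' w neg2X) subr0 sub0r.
  apply/eqP; rewrite oppr_eq0 mulf_eq0; apply/orP; right; apply/eqP.
  rewrite /split_functional; case: ifP => // hs.
  have wa := wfA w hs; have wb := wfB w hs.
  case/orP: (subA X W' hs w nW' nXA nXB) => /andP[sX nr]; rewrite /= sX in wa wb *.
    by rewrite (vfA nr wa neg2X) mul0r.
  by rewrite (vfB nr wb neg2X) mulr0.
- move=> X W' nW' w posX.
  have [pos1X pos2X] : ~~ neg1 X /\ ~~ neg2 X.
    by apply/andP; rewrite -negb_or.
  have nXA : X != A by apply: contraNneq pos1X => ->.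
  have nXB : X != B by apply: contraNneq pos2X => ->.
  rewrite /D (vl1 nW' w pos1X) (vl2 nW' w pos2X) subr0 sub0r.
  apply/eqP; rewrite oppr_eq0 mulf_eq0; apply/orP; right; apply/eqP.
  rewrite /split_functional; case: ifP => // hs.
  have wa := wfA w hs; have wb := wfB w hs.
  have w' : set_composition [set: T] (X :: W') by rewrite -set_composition_rcons.
  have hs' : all split_block (X :: W') by move: hs; rewrite all_rcons.
  rewrite !filter_rcons in wa wb *.
  case/orP: (subA X W' hs' w' nW' nXA nXB) => /andP[sX nr]; rewrite sX in wa wb *.
    by rewrite (vlA nr wa pos2X) mul0r.
  by rewrite (vlB nr wb pos2X) mulr0.
- rewrite /D Phi12 subrr sub0r /split_functional /=.
  have -> : ([set: T] \subset A) = false.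
    by apply/negP; rewrite subTset => /eqP e; move: nB; rewrite e setCT eqxx.
  have -> : ([set: T] \subset B) = false.
    by apply/negP; rewrite subTset => /eqP e; move: nA; rewrite -[A]setCK e setCT eqxx.
  by rewrite mulr0 oppr0.
Qed.

End Crossing.
End Functionals.
End Words.

End SetCompositions.

(** * Extrapolation of polynomial families *)

Section PolynomialFamilies.
Context (K : numFieldType) (n : nat).
Implicit Types (h g : nat -> mps n K) (f : nat -> K).

(** Dependence on one natural parameter suffices, because the chamber polynomials are only
    restricted to a ray. *)
Definition poly_fun f := exists r : {poly K}, forall t, f t = r.[t%:R].

Definition poly_family h := forall k : 'X_{1..n}, poly_fun (fun t => h t k).

Lemma poly_fun_ext f f' : f =1 f' -> poly_fun f -> poly_fun f'.
Proof. by move=> e [r hr]; exists r => t; rewrite -e. Qed.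

Lemma poly_fun_const c : poly_fun (fun _ => c).
Proof. by exists c%:P => t; rewrite hornerC. Qed.

Lemma poly_fun_id : poly_fun (fun t => t%:R).
Proof. by exists 'X => t; rewrite hornerX. Qed.

Lemma poly_funD f f' : poly_fun f -> poly_fun f' -> poly_fun (fun t => f t + f' t).
Proof. by move=> [r hr] [s hs]; exists (r + s) => t; rewrite hornerD hr hs. Qed.

Lemma poly_funM f f' : poly_fun f -> poly_fun f' -> poly_fun (fun t => f t * f' t).
Proof. by move=> [r hr] [s hs]; exists (r * s) => t; rewrite hornerM hr hs. Qed.

Lemma poly_fun_sum (I : Type) (s : seq I) (P : pred I) (F : I -> nat -> K) :
  (forall i, P i -> poly_fun (F i)) ->
  poly_fun (fun t => \sum_(i <- s | P i) F i t).
Proof.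
move=> hF; elim: s => [|i s IH].
  by apply: poly_fun_ext (poly_fun_const 0) => t; rewrite big_nil.
have [Pi|nPi] := boolP (P i).
  by apply: poly_fun_ext (poly_funD (hF i Pi) IH) => t; rewrite big_cons Pi.
by apply: poly_fun_ext IH => t; rewrite big_cons (negbTE nPi).
Qed.

(** A nonzero difference would have the roots [N], [N + 1], ..., which are distinct in
    characteristic zero and exceed its degree in number. *)
Lemma poly_fun_eq f f' N : poly_fun f -> poly_fun f' ->
  (forall t, (N <= t)%N -> f t = f' t) -> f =1 f'.
Proof.
move=> [r hr] [s hs] e t; suff e0 : r - s = 0.
  by rewrite hr hs -[r](subrK s) e0 add0r.
apply/eqP; apply: contraT => nz.
have := @max_poly_roots _ _ [seq (N + i)%:R | i <- iota 0 (size (r - s))] nz.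
rewrite size_map size_iota ltnn; apply.
  apply/allP => x /mapP[i _ ->]; rewrite /root hornerD hornerN -hr -hs e ?leq_addr //.
  by rewrite subrr.
rewrite map_inj_in_uniq ?iota_uniq // => i j _ _ /eqP.
by rewrite eqr_nat eqn_add2l => /eqP.
Qed.

Lemma poly_family_ext h h' : h =1 h' -> poly_family h -> poly_family h'.
Proof. by move=> e hh k; apply: poly_fun_ext (hh k) => t; rewrite e. Qed.

Lemma poly_family_eq h h' N : poly_family h -> poly_family h' ->
  (forall t, (N <= t)%N -> h t = h' t) -> h =1 h'.
Proof.
move=> ph ph' e t; apply: mpsP => k.
by apply: (poly_fun_eq (ph k) (ph' k)) => t' /e ->.
Qed.

Lemma poly_family_const (x : mps n K) : poly_family (fun _ => x).
Proof. by move=> k; apply: poly_fun_const. Qed.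

Lemma poly_familyD h g : poly_family h -> poly_family g ->
  poly_family (fun t => h t + g t).
Proof. by move=> ph pg k; apply: poly_funD (ph k) (pg k). Qed.

Lemma poly_familyZ c h : poly_family h -> poly_family (fun t => c *: h t).
Proof. by move=> ph k; apply: poly_funM (poly_fun_const c) (ph k). Qed.

Lemma poly_familyN h : poly_family h -> poly_family (fun t => - h t).
Proof.
by move=> ph; apply: poly_family_ext (poly_familyZ (-1) ph) => t; rewrite scaleN1r.
Qed.

Lemma poly_familyM h g : poly_family h -> poly_family g ->
  poly_family (fun t => h t * g t).
Proof.
by move=> ph pg k; apply: poly_fun_sum => i _; apply: poly_funM (ph _) (pg _).
Qed.

Lemma poly_familyX h k : poly_family h -> poly_family (fun t => h t ^+ k).
Proof.
move=> ph; elim: k => [|k IH].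
  by apply: poly_family_ext (poly_family_const 1) => t; rewrite expr0.
by apply: poly_family_ext (poly_familyM ph IH) => t; rewrite exprS.
Qed.

Lemma poly_family_fps_at (c : nat -> K) h : poly_family h ->
  poly_family (fun t => fps_at c (h t)).
Proof.
move=> ph k; apply: poly_fun_sum => i _.
exact: poly_funM (poly_fun_const _) (poly_familyX i ph k).
Qed.

Lemma poly_family_varsigma h : poly_family h -> poly_family (fun t => varsigma (h t)).
Proof.
move=> ph; have ph2 := poly_familyZ 2^-1 ph.
apply: poly_familyD; first exact: poly_family_fps_at.
by apply/poly_familyN/poly_family_fps_at/poly_familyN.
Qed.

Lemma poly_family_affine (x : mps n K) (a b : int) :
  poly_family (fun t : nat => x *~ (a + b *+ t)).
Proof.
apply: (@poly_family_ext (fun t => x *~ a + (t%:R * b%:~R) *: x)).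
  move=> t; rewrite mulrzDr; congr (_ + _).
  by rewrite mulr_natl -(scaler_int (b *+ t)) rmorphMn.
apply: poly_familyD; first exact: poly_family_const.
move=> k; apply: poly_funM; last exact: poly_fun_const.
apply: poly_funM; [exact: poly_fun_id | exact: poly_fun_const].
Qed.

End PolynomialFamilies.

Import SetCompositions.

Section Extrapolation.
Context (K : numFieldType) (n : nat) (T : finType).
Local Notation A := {fraction mps n K}.
Context (S : {set T}) (cor : nat -> seq {set T} -> A)
  (c : nat -> {set T} -> {set T} -> mps n K) (sigma : mps n K)
  (neg : pred {set T}) (N : nat).
Hypothesis sigma_neq0 : sigma != 0.
Hypothesis c_poly : forall X Y, poly_family (fun t => c t X Y).
Local Notation cF t := (fun X Y => (c t X Y)%:F : A).
Hypothesis cor_swap : forall t, (N <= t)%N -> swap_rel (cF t) S (cor t).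
Hypothesis cor_first : forall t, (N <= t)%N -> vanish_first neg S (cor t).
Hypothesis cor_last : forall t, (N <= t)%N -> vanish_last neg S (cor t).
Hypothesis cor1 : forall t, (N <= t)%N -> cor t [:: S] = sigma%:F^-1.

(* The factor sigma clears the denominator of the one-point function, so that
   every coefficient in z is a polynomial in the parameter t. *)
Definition interpolates (W : seq {set T}) (h : nat -> mps n K) : Prop :=
  poly_family h /\ forall t, (N <= t)%N -> cor t W * sigma%:F = (h t)%:F.

Lemma interpolates_eq W h h' : interpolates W h -> interpolates W h' -> h =1 h'.
Proof.
move=> [ph eh] [ph' eh']; apply: (poly_family_eq ph ph' (N := N)) => t le_t.
by apply/eqP; rewrite -tofrac_eq -eh // -eh'.
Qed.

Lemma interpolates0 W : (forall t, (N <= t)%N -> cor t W = 0) ->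
  interpolates W (fun _ => 0).
Proof.
move=> W0; split=> [|t le_t]; first exact: poly_family_const.
by rewrite W0 // mul0r tofrac0.
Qed.

Lemma interpolates_swap W1 X Y W2 h g :
  set_composition S (W1 ++ X :: Y :: W2) ->
  interpolates (W1 ++ Y :: X :: W2) h -> interpolates (W1 ++ (X :|: Y)%SET :: W2) g ->
  interpolates (W1 ++ X :: Y :: W2) (fun t => h t + c t X Y * g t).
Proof.
move=> wf [ph eh] [pg eg]; split=> [|t le_t].
  by apply: poly_familyD => //; apply: poly_familyM.
by rewrite (cor_swap le_t wf) mulrDl -mulrA eh // eg // -tofracM -tofracD.
Qed.

(** The reduction of [functional_eq0], run so as to build a polynomial: the one-block word gives 1,
    vanishing words give 0, and a swap combines the polynomials of two words already treated. *)
Lemma interpolates_ex W : W != [::] -> set_composition S W ->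
  exists h, interpolates W h.
Proof.
move: {2}(size W) (leqnn (size W)) => k.
elim: k W => [|k IH] W; first by rewrite leqn0 size_eq0 => /eqP->.
case: W => // X0 W0; have [->|nz0] := eqVneq W0 [::].
  move=> _ _ /set_composition1->; exists (fun _ => 1).
  split=> [|t le_t]; first exact: poly_family_const.
  by rewrite cor1 // mulVf ?tofrac1 // tofrac_eq0.
move=> szW _ wf; have [/hasP[X XW negX]|/hasPn allpos] := boolP (has neg (X0 :: W0)).
  have szW1 : (1 < size (X0 :: W0))%N by case: W0 nz0 {szW wf XW}.
  case/splitPr: XW szW wf szW1 => W1 W2.
  elim/last_ind: W1 W2 => [|W1 Y IHW] W2 szW wf szW1.
    exists (fun _ => 0); apply: interpolates0 => t le_t; apply: cor_first => //.
    by case: W2 szW1 {szW wf}.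
  rewrite cat_rcons in szW wf szW1 *.
  have [wf1 wf2 _ _ _] := set_composition_mid wf.
  have [|//||h hh] := IHW (Y :: W2); rewrite ?size_cat; try by move: szW szW1; rewrite !size_cat.
  have [||//|g hg] := IH (W1 ++ (Y :|: X)%SET :: W2); last first.
  - by exists (fun t => h t + c t Y X * g t); apply: interpolates_swap.
  - by case: (W1).
  - by move: szW; rewrite !size_cat /= !addnS ltnS.
move: nz0 allpos wf; case/lastP: W0 {szW} => // W X _ allpos.
rewrite -rcons_cons => wf; exists (fun _ => 0).
apply: interpolates0 => t le_t; apply: cor_last => //.
by apply: allpos; rewrite inE mem_rcons inE eqxx orbT.
Qed.

(** The interpolating polynomials at [t = 0] form a functional with the signs of large [t] and the
    brackets of [t = 0]; each rule holds for large [t], hence at 0 by uniqueness. The last clause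
    computes its values from any polynomial family that represents the correlators for large [t]. *)
Lemma functional_extrapolation : S != finset.set0 ->
  exists Phi : seq {set T} -> A,
  [/\ swap_rel (cF 0%N) S Phi, vanish_first neg S Phi, vanish_last neg S Phi,
      Phi [:: S] = sigma%:F^-1
    & forall W h, W != [::] -> set_composition S W -> poly_family h ->
        (forall t, (N <= t)%N -> cor t W = (h t)%:F) -> Phi W = (h 0%N)%:F].
Proof.
move=> nS.
have exH W : exists h, W != [::] -> set_composition S W -> interpolates W h.
  have [nz|_] := boolP (W != [::]); last by exists (fun _ => 0).
  have [wf|_] := boolP (set_composition S W); last by exists (fun _ => 0).
  by have [h hh] := interpolates_ex nz wf; exists h.
have [H HP] := choice exH.
have nzs : sigma%:F != 0 :> A by rewrite tofrac_eq0.
exists (fun W => (H W 0%N)%:F / sigma%:F).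
have eqH W h : W != [::] -> set_composition S W -> interpolates W h ->
    H W 0%N = h 0%N.
  by move=> nz wf hh; apply: (interpolates_eq (HP W nz wf) hh).
split.
- move=> W1 X Y W2 wf; have [wf1 wf2 _ _ _] := set_composition_mid wf.
  have nz1 : W1 ++ Y :: X :: W2 != [::] by case: (W1).
  have nz2 : W1 ++ (X :|: Y)%SET :: W2 != [::] by case: (W1).
  have nz : W1 ++ X :: Y :: W2 != [::] by case: (W1).
  rewrite (eqH _ _ nz wf (interpolates_swap wf (HP _ nz1 wf1) (HP _ nz2 wf2))).
  by rewrite tofracD tofracM mulrDl mulrA.
- move=> X W nz wf negX; rewrite (eqH _ (fun _ => 0)) ?tofrac0 ?mul0r //.
  by apply: interpolates0 => t le_t; apply: cor_first.
- move=> X W nz wf posX; rewrite (eqH _ (fun _ => 0)) ?tofrac0 ?mul0r //.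
    by case: (W).
  by apply: interpolates0 => t le_t; apply: cor_last.
- rewrite (eqH _ (fun _ => 1)) ?tofrac1 ?mul1r //=.
    by rewrite nS fintype.subxx finset.setDv eqxx.
  split=> [|t le_t]; first exact: poly_family_const.
  by rewrite cor1 // mulVf ?tofrac1.
- move=> W h nz wf ph e; apply: (mulIf nzs); rewrite mulfVK //.
  rewrite (eqH _ (fun t => h t * sigma)) ?tofracM //; split=> [|t le_t].
    exact: poly_familyM ph (poly_family_const _).
  by rewrite e // tofracM.
Qed.

End Extrapolation.

(** * Chambers and walls *)

Lemma big_disjointU (V : nmodType) (I : finType) (X Y : {set I}) (F : I -> V) :
  [disjoint X & Y] ->
  \sum_(x in (X :|: Y)%SET) F x = \sum_(x in X) F x + \sum_(x in Y) F x.
Proof.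
move=> d; rewrite -bigU //; apply: eq_bigl => x; by rewrite !inE.
Qed.

Section Energies.
Context (m n : nat).
Local Notation T := ('I_m + 'I_n)%type.
Implicit Types (p : hpoint m n) (X Y D : {set T}) (I : {set 'I_m}) (J : {set 'I_n}).

Definition weight p (x : T) : int :=
  match x with inl i => (tnth p.1 i)%:Z | inr j => - (tnth p.2 j)%:Z end.

Definition energy p X : int := \sum_(x in X) weight p x.

(** A pair [(I, J)] becomes one set of letters, so that walls and blocks of words are the same
    objects. *)
Definition sum_set I J : {set T} :=
  [set x : T | match x with inl i => i \in I | inr j => j \in J end].

Lemma big_sum_set (V : nmodType) I J (F : T -> V) :
  \sum_(x in sum_set I J) F x = \sum_(i in I) F (inl i) + \sum_(j in J) F (inr j).
Proof.
rewrite big_sumType /=; congr (_ + _); apply: eq_bigl => i; by rewrite inE.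
Qed.

Lemma sum_setE X :
  X = sum_set [set i | inl i \in X] [set j | inr j \in X].
Proof. by apply/finset.setP => -[i|j]; rewrite !inE. Qed.

Lemma sum_setC I J : ~: sum_set I J = sum_set (~: I) (~: J).
Proof. by apply/finset.setP => -[i|j]; rewrite !inE. Qed.

Lemma sum_set0 : sum_set finset.set0 finset.set0 = finset.set0.
Proof. by apply/finset.setP => -[i|j]; rewrite !inE. Qed.

Lemma sum_setT : sum_set [set: 'I_m] [set: 'I_n] = [set: T].
Proof. by apply/finset.setP => -[i|j]; rewrite !inE. Qed.

Lemma energy_sum_set p I J : energy p (sum_set I J) = delta I J p.
Proof. by rewrite /energy big_sum_set /delta sumrN. Qed.

Lemma energyU p X Y : [disjoint X & Y] -> energy p (X :|: Y) = energy p X + energy p Y.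
Proof. exact: big_disjointU. Qed.

Lemma energyC p X : energy p [set: T] = 0 -> energy p (~: X) = - energy p X.
Proof.
move=> e; apply/eqP; rewrite -addr_eq0 addrC -energyU ?finset.setUCr ?e //.
by rewrite -finset.setI_eq0 finset.setICr.
Qed.

Lemma sumn_tuple k (t : k.-tuple nat) :
  (sumn t)%:Z = \sum_(i in [set: 'I_k]) (tnth t i)%:Z.
Proof.
rewrite sumnE big_tuple (big_morph Posz PoszD erefl).
by apply: eq_bigl => i; rewrite inE.
Qed.

Lemma energyT p : in_H p -> energy p [set: T] = 0.
Proof.
case=> _ _ e; rewrite -sum_setT energy_sum_set /delta -!sumn_tuple e.
by rewrite subrr.
Qed.

Definition nontrivial X : bool := (X != finset.set0) && (X != [set: T]).

Lemma is_wall_sum_set I J : is_wall I J <-> nontrivial (sum_set I J).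
Proof.
split=> [[h0 hT]|/andP[h0 hT]].
  apply/andP; split; apply/eqP => e; [apply: h0|apply: hT]; split.
  - by apply/finset.setP => i; have /finset.setP/(_ (inl i)) := e; rewrite !inE.
  - by apply/finset.setP => i; have /finset.setP/(_ (inr i)) := e; rewrite !inE.
  - by apply/finset.setP => i; have /finset.setP/(_ (inl i)) := e; rewrite !inE.
  - by apply/finset.setP => i; have /finset.setP/(_ (inr i)) := e; rewrite !inE.
split=> -[eI eJ].
  by rewrite eI eJ sum_set0 eqxx in h0.
by rewrite eI eJ sum_setT eqxx in hT.
Qed.

Lemma sum_set_nontrivial X : nontrivial X ->
  exists I J, X = sum_set I J /\ is_wall I J.
Proof.
move=> nX; exists [set i | inl i \in X], [set j | inr j \in X].
by split; [exact: sum_setE | apply/is_wall_sum_set; rewrite -sum_setE].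
Qed.

Definition line p p0 (t : nat) : hpoint m n :=
  ([tuple (tnth p.1 i + t * tnth p0.1 i)%N | i < m],
   [tuple (tnth p.2 j + t * tnth p0.2 j)%N | j < n]).

Lemma energy_line p p0 t X : energy (line p p0 t) X = energy p X + energy p0 X *+ t.
Proof.
rewrite /energy -sumrMnl -big_split; apply: eq_bigr => -[i|j] _ /=;
  rewrite tnth_mktuple; lia.
Qed.

Lemma in_H_line p p0 t : in_H p -> in_H p0 -> in_H (line p p0 t).
Proof.
move=> hp hp0; have [a1 a2 e] := hp.
split.
- by apply/all_tnthP => i; rewrite tnth_mktuple ltn_addr //; apply: (all_tnthP a1).
- by apply/all_tnthP => i; rewrite tnth_mktuple ltn_addr //; apply: (all_tnthP a2).
have : energy (line p p0 t) [set: T] = 0.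
  by rewrite energy_line !energyT // mul0rn addr0.
rewrite -sum_setT energy_sum_set /delta -!sumn_tuple => /eqP.
by rewrite subr_eq0 => /eqP [].
Qed.

Lemma chamber_in_H (c : set (hpoint m n)) p : is_chamber c -> c p -> in_H p.
Proof. by move=> [p0 _ ->] []. Qed.

Lemma chamber_sign (c : set (hpoint m n)) p p' X : is_chamber c -> c p -> c p' ->
  nontrivial X -> 0 < energy p X * energy p' X.
Proof.
move=> [p0 _ ->] [_ h] [_ h'] /sum_set_nontrivial[I [J [-> w]]].
move: (h I J w) (h' I J w); rewrite !energy_sum_set; nia.
Qed.

Lemma chamber_neq0 (c : set (hpoint m n)) p X : is_chamber c -> c p ->
  nontrivial X -> energy p X != 0.
Proof.
by move=> hc cp nX; apply: contraTneq (chamber_sign hc cp cp nX) => ->; rewrite mul0r.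
Qed.

(** The energies at [p0] of nontrivial blocks are nonzero integers; once [t] exceeds the absolute
    values of all energies at [p], they decide every sign. *)
Lemma chamber_line (c : set (hpoint m n)) p p0 : is_chamber c -> c p0 -> in_H p ->
  exists N, forall t, (N <= t)%N -> c (line p p0 t).
Proof.
move=> hc cp0 hp; have hp0 := chamber_in_H hc cp0.
exists (\sum_(X : {set T}) `|energy p X|)%N.+1 => t lt_t.
have [q0 cq0 ec] := hc; rewrite ec; split; first exact: in_H_line.
move=> I J /is_wall_sum_set w; rewrite -!energy_sum_set.
set X := sum_set I J in w *; rewrite energy_line.
have := chamber_sign hc cp0 cq0 w.
have : (`|energy p X| <= \sum_(X : {set T}) `|energy p X|)%N.
  by rewrite (bigD1 X) //= leq_addr.
move: lt_t; set N := (\sum_(X : {set T}) _)%N.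
move: (energy p X) (energy p0 X) (energy q0 X) N => a b d N h1 h2 h3.
have [b_gt0|b_le0] := ltP 0 b.
  have d_gt0 : 0 < d by nia.
  have : 0 < a + b *+ t by nia.
  nia.
have d_lt0 : d < 0 by nia.
have b_lt0 : b < 0 by nia.
have : a + b *+ t < 0 by nia.
nia.
Qed.

End Energies.

(** * Points on the common boundary of adjacent chambers *)

Section Adjacency.
Context (m n : nat).
Local Notation T := ('I_m + 'I_n)%type.
Implicit Types (p : hpoint m n) (X Y D : {set T}).

Definition weight_sign (x : T) : rat := match x with inl _ => 1 | inr _ => -1 end.

Definition energy_form X : 'cV[rat]_(m + n) :=
  \col_i (weight_sign (fintype.split i) * (fintype.split i \in X)%:R).

Lemma coords_energy p X : coords rat p *m energy_form X = (energy p X)%:~R%:M.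
Proof.
apply/matrixP => i j; rewrite !ord1 !mxE eqxx mulr1n /energy big_sumType /=.
rewrite big_split_ord rmorphD /= !rmorph_sum /= [X in _ = X + _]big_mkcond.
rewrite [X in _ = _ + X]big_mkcond /=; congr (_ + _); apply: eq_bigr => k _.
  rewrite !mxE (unsplitK (inl _)) tnth_lshift mul1r.
  by case: ifP => _; rewrite ?mulr1 ?mulr0.
rewrite !mxE (unsplitK (inr _)) tnth_rshift mulN1r mulrN.
by case: ifP => _; rewrite ?mulr1 ?mulr0 ?oppr0 // rmorphN.
Qed.

(* A family of m + n - 2 independent points has a two-dimensional annihilator,
   which is already spanned by the total energy and by the energy of A. *)
Lemma free_wall_points A Y (s : (m + n - 2).-tuple (hpoint m n)) :
  free [seq coords rat p | p <- s] -> nontrivial A ->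
  (forall p, p \in (s : seq (hpoint m n)) ->
     [/\ energy p [set: T] = 0, energy p A = 0 & energy p Y = 0]) ->
  [|| Y == finset.set0, Y == [set: T], Y == A | Y == ~: A].
Proof.
move=> frs /andP[nA0 nAT] hs.
pose S : 'M[rat]_(m + n - 2, m + n) := \matrix_(i, j) coords rat (tnth s i) 0 j.
have rowS i : row i S = coords rat (tnth s i).
  by apply/rowP => j; rewrite !mxE.
have rkS : (\rank S = m + n - 2)%N.
  apply/eqP; rewrite -/(row_free S); apply: inj_row_free => v vS.
  have /freeP frS := (frs : free (map_tuple (coords rat) s)).
  apply/rowP => i; rewrite [RHS]mxE; apply: (frS (fun i => v 0 i)).
  rewrite -{}[RHS]vS mulmx_sum_row; apply: eq_bigr => k _.
  by rewrite rowS -tnth_nth tnth_map.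
pose form (j : 'I_3) := energy_form (nth finset.set0 [:: A; [set: T]; Y] j).
pose Phi : 'M[rat]_(m + n, 3) := \matrix_(i, j) form j i 0.
have SPhi : S *m Phi = 0.
  apply/matrixP => i j; rewrite !mxE.
  have /matrixP/(_ 0 0) := coords_energy (tnth s i) (nth finset.set0 [:: A; [set: T]; Y] j).
  rewrite !mxE => e; transitivity (\sum_k coords rat (tnth s i) 0 k * form j k 0).
    by apply: eq_bigr => k _; rewrite !mxE.
  rewrite e eqxx mulr1n; have [e1 e2 e3] := hs _ (mem_tnth i s).
  by case: j {e} => -[|[|[|//]]] /= _; rewrite ?e1 ?e2 ?e3.
have rkPhi : (\rank Phi <= 2)%N.
  by have := mulmx0_rank_max SPhi; rewrite rkS; lia.
have [v vPhi nzv] : exists2 v : 'rV[rat]_3, v *m Phi^T = 0 & v != 0.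
  have : kermx Phi^T != 0.
    by rewrite kermx_eq0 /row_free mxrank_tr; apply: contraTneq rkPhi => ->.
  by case/rowV0Pn => v /sub_kermxP e nz; exists v.
(* The signs of [energy_form] cancel, which leaves a linear relation between the indicator functions
   of [A], of all letters and of [Y]. *)
have eqn x : v 0 0 * (x \in A)%:R + v 0 1 + v 0 ord_max * (x \in Y)%:R = 0.
  have /rowP/(_ (unsplit x)) := vPhi.
  rewrite !mxE !big_ord_recl big_ord0 addr0 !mxE !unsplitK /=.
  have -> : fintype.lift ord0 (fintype.lift ord0 ord0) = ord_max :> 'I_3 by apply/val_inj.
  have -> : fintype.lift ord0 ord0 = 1 :> 'I_3 by apply/val_inj.
  rewrite inE mulr1.
  case: x => x /=; rewrite ?mul1r ?mulr1 ?mulN1r ?mulrN1 ?mulrN -?opprD addrA //.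
  by move=> /eqP; rewrite oppr_eq0 => /eqP.
have nz3 : ~ [/\ v 0 0 = 0, v 0 1 = 0 & v 0 ord_max = 0].
  move=> [v0 v1 v2]; case/eqP: nzv; apply/rowP => -[[|[|[|//]]] i]; rewrite mxE.
  - by rewrite -[RHS]v0; congr (v _ _); apply/val_inj.
  - by rewrite -[RHS]v1; congr (v _ _); apply/val_inj.
  - by rewrite -[RHS]v2; congr (v _ _); apply/val_inj.
move: (v 0 0) (v 0 1) (v 0 ord_max) eqn nz3 => a b c eqn nz3.
have [x1 x1A] : exists x, x \in A by apply/set0Pn.
have [x0 x0A] : exists x, x \notin A.
  apply/existsP; rewrite -negb_forall; apply: contra nAT => /forallP h.
  by apply/eqP/finset.setP => x; rewrite !inE h.
(* If [Y] separated two letters on the same side of [A], its coefficient would vanish, and then so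
   would the other two, because both sides of [A] are inhabited. *)
have constA (x y : T) : (x \in A) = (y \in A) -> (x \in Y) = (y \in Y).
  move=> eA; apply/eqP; apply: contraT => neY; case: nz3.
  have c0 : c = 0.
    have := eqn x; rewrite eA; have := eqn y; move: neY.
    by case: (x \in Y); case: (y \in Y) => // _; rewrite ?mulr1 ?mulr0 ?addr0;
      move=> e1 e2; lra.
  have := eqn x0; have := eqn x1; rewrite x1A (negbTE x0A) c0 !mul0r mulr1 mulr0.
  by move=> e1 e2; split; lra.
have YE x : (x \in Y) = if x \in A then x1 \in Y else x0 \in Y.
  by case: ifP => xA; apply: constA; rewrite ?x1A ?(negbTE x0A).
case e1: (x1 \in Y); case e0: (x0 \in Y); rewrite e1 e0 in YE.
- by apply/or4P; constructor 2; apply/eqP/finset.setP => x; rewrite YE !inE; case: ifP.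
- by apply/or4P; constructor 3; apply/eqP/finset.setP => x; rewrite YE; case: ifP.
- by apply/or4P; constructor 4; apply/eqP/finset.setP => x; rewrite YE !inE; case: ifP.
- by apply/or4P; constructor 1; apply/eqP/finset.setP => x; rewrite YE !inE; case: ifP.
Qed.

Section AdjacentChambers.
Context (I : {set 'I_m}) (J : {set 'I_n}) (c1 c2 : set (hpoint m n)).
Hypotheses (wall : is_wall I J) (adj : adjacent I J c1 c2).
Local Notation A := (sum_set I J).

(** By [free_wall_points], a nontrivial block other than [A] and its complement cannot vanish at all
    the given boundary points. The signs at such a point are weakly compatible with both
    chambers. *)
Lemma adjacent_wall_point Y : nontrivial Y -> Y != A -> Y != ~: A ->
  exists q, [/\ energy q [set: T] = 0, energy q A = 0, energy q Y != 0
    & forall X p, nontrivial X -> c1 p \/ c2 p -> 0 <= energy q X * energy p X].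
Proof.
move=> /andP[nY0 nYT] nYA nYB; have [hc1 hc2 _ _ [s frs hs]] := adj.
apply: contrapT => hno.
have : [|| Y == finset.set0, Y == [set: T], Y == A | Y == ~: A].
  apply: (free_wall_points frs); first exact/is_wall_sum_set.
  move=> q qs; have [[hq cq1] [_ cq2] dq] := hs q qs.
  split; [exact: energyT | by rewrite energy_sum_set |].
  apply/eqP; apply: contraT => nz; case: hno; exists q; split=> //.
  - exact: energyT.
  - by rewrite energy_sum_set.
  - move=> X p /sum_set_nontrivial[I' [J' [-> w]]]; rewrite !energy_sum_set.
    by case=> cp; [apply: cq1|apply: cq2].
by rewrite (negbTE nY0) (negbTE nYT) (negbTE nYA) (negbTE nYB).
Qed.

Lemma adjacent_same_sign Y p1 p2 : nontrivial Y -> Y != A -> Y != ~: A ->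
  c1 p1 -> c2 p2 -> (energy p1 Y < 0) = (energy p2 Y < 0).
Proof.
move=> nY nYA nYB cp1 cp2; have [q [_ _ nz h]] := adjacent_wall_point nY nYA nYB.
have [hc1 hc2 _ _ _] := adj.
have := h Y p1 nY (or_introl cp1); have := h Y p2 nY (or_intror cp2).
have := chamber_neq0 hc1 cp1 nY; have := chamber_neq0 hc2 cp2 nY.
move: (energy p1 Y) (energy p2 Y) (energy q Y) nz => a b e nz na nb h1 h2.
by apply/idP/idP; nia.
Qed.

(** At the boundary point [q] the energy of [D] is zero, so [X] and its union with [D] have the same
    nonzero energy there, which decides both signs at [p]. *)
Lemma adjacent_union_sign D X p : D = A \/ D = ~: A -> [disjoint D & X] ->
  nontrivial X -> X != A -> X != ~: A -> nontrivial (D :|: X) -> c1 p \/ c2 p ->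
  (energy p (D :|: X) < 0) = (energy p X < 0).
Proof.
move=> hD dX nX nXA nXB nDX cp.
have [q [q0 qA nz h]] := adjacent_wall_point nX nXA nXB.
have [hc1 hc2 _ _ _] := adj.
have qD : energy q D = 0 by case: hD => ->; rewrite ?energyC // qA oppr0.
have h1 := h X p nX cp; have := h _ p nDX cp; rewrite energyU // qD add0r => h2.
have n1 : energy p X != 0 by case: cp => cp; [apply: (chamber_neq0 hc1 cp)|apply: (chamber_neq0 hc2 cp)].
have n2 : energy p (D :|: X) != 0 by case: cp => cp; [apply: (chamber_neq0 hc1 cp)|apply: (chamber_neq0 hc2 cp)].
move: (energy p X) (energy p (D :|: X)) (energy q X) nz h1 h2 n1 n2 => a b e.
by move=> nz h1 h2 n1 n2; apply/idP/idP; nia.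
Qed.

(** [delta < 0] on [c1] requires a part in [J], and [delta > 0] on [c2] requires one in its
    complement. Hence the z-sums of both sides are nonzero and their [varsigma] can be divided
    by. *)
Lemma adjacent_zsum_nonempty : J != finset.set0 /\ ~: J != finset.set0.
Proof.
have [hc1 hc2 d1 d2 _] := adj; have [p1 cp1 _] := hc1; have [p2 cp2 _] := hc2.
have h1 := d1 _ cp1; have h2 := d2 _ cp2; have hp2 := chamber_in_H hc2 cp2.
split; apply/eqP => eJ.
  move: h1; rewrite /delta eJ big_set0 subr0 ltNge sumr_ge0 //.
move: h2; rewrite -energy_sum_set -[A]finset.setCK energyC ?energyT //.
rewrite sum_setC energy_sum_set /delta eJ big_set0 subr0 oppr_gt0 ltNge.
by rewrite sumr_ge0.
Qed.

End AdjacentChambers.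

End Adjacency.

(** * Correlators near the wall *)

Lemma mulrz_subN (V : zmodType) (x y : V) (d : int) :
  x *~ d - y *~ (- d) = (y + x) *~ d.
Proof. by rewrite mulrNz opprK addrC mulrzDl. Qed.

Lemma divf_neq0 (F : fieldType) (x y : F) : x != 0 -> y != 0 -> x / y != 0.
Proof. by move=> nx ny; rewrite mulf_neq0 ?invr_eq0. Qed.

Section Blocks.
Context (K : numFieldType) (m n : nat).
Local Notation T := ('I_m + 'I_n)%type.
Local Notation F := {fraction mps n K}.
Implicit Types (p : hpoint m n) (X Y D : {set T}) (W : seq {set T}).

Definition zvar (x : T) : mps n K :=
  match x with inl _ => 0 | inr j => mpsX K j end.

Definition zblock X : mps n K := \sum_(x in X) zvar x.

Definition block p X : int * mps n K := (energy p X, zblock X).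

Definition block_bracket p X Y : mps n K :=
  varsigma (zblock Y *~ energy p X - zblock X *~ energy p Y).

Lemma zblock_sum_set I J : zblock (sum_set I J) = zsum K J.
Proof. by rewrite /zblock big_sum_set big1 ?add0r. Qed.

Lemma zblockU X Y : [disjoint X & Y] -> zblock (X :|: Y)%SET = zblock X + zblock Y.
Proof. exact: big_disjointU. Qed.

Lemma zblock_const X : zblock X 0%MM = 0.
Proof.
rewrite mps_sumE big1 // => -[i|j] _ //=.
by case: eqP => // /(congr1 (fun k : 'X_{1..n} => k j)); rewrite mnm0E mnm1E eqxx.
Qed.

Lemma zblock_neq0 X j : inr j \in X -> zblock X != 0.
Proof.
move=> jX; apply/eqP => /(congr1 (fun f : mps n K => f U_(j)%MM)).
rewrite mps_sumE (bigD1 (inr j)) //= eqxx big1 ?addr0; first by move/eqP; rewrite oner_eq0.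
move=> [i|j'] /andP[_ ne] //=; case: eqP => // /(congr1 (fun k : 'X_{1..n} => k j)).
rewrite !mnm1E eqxx; case: (eqVneq j' j) => // e.
by rewrite e eqxx in ne.
Qed.

Lemma zblock_mulrz_neq0 X (d : int) : zblock X != 0 -> d != 0 -> zblock X *~ d != 0.
Proof. by move=> nz nd; rewrite -scaler_int scaler_eq0 negb_or nz intr_eq0 nd. Qed.

Lemma mulrz_const (x : mps n K) (d : int) : x 0%MM = 0 -> (x *~ d) 0%MM = 0.
Proof. by move=> x0; rewrite mps_intE x0 mul0rz. Qed.

Lemma gcorr_block_swap p L1 L2 W1 X Y W2 : [disjoint X & Y] ->
  energy p X != 0 -> energy p Y != 0 ->
  (energy p (X :|: Y)%SET != 0) || (zblock (X :|: Y)%SET != 0) ->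
  gcorr (L1 ++ map (block p) (W1 ++ X :: Y :: W2) ++ L2) =
  gcorr (L1 ++ map (block p) (W1 ++ Y :: X :: W2) ++ L2)
  + (block_bracket p X Y)%:F
    * gcorr (L1 ++ map (block p) (W1 ++ (X :|: Y)%SET :: W2) ++ L2).
Proof.
move=> dXY nX nY h; rewrite !map_cat -!catA !(catA L1) /=.
rewrite /block energyU // zblockU //.
by apply: gcorr_swap => //; rewrite ?zblock_const // -energyU // -zblockU.
Qed.

Lemma composition_nontrivial X W : W != [::] ->
  set_composition [set: T] (X :: W) -> nontrivial X.
Proof.
move=> nW w; rewrite /nontrivial (set_composition_proper nW w) andbT.
by case/and3P: w.
Qed.

Lemma composition_mid_nontrivial W1 X Y W2 :
  set_composition [set: T] (W1 ++ X :: Y :: W2) -> nontrivial X /\ nontrivial Y.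
Proof.
move=> w; have [w' _ d _ _] := set_composition_mid w.
have nX : X != finset.set0.
  by apply: (set_composition_nonempty w); rewrite mem_cat !inE eqxx orbT.
have nY : Y != finset.set0.
  by apply: (set_composition_nonempty w); rewrite mem_cat !inE eqxx !orbT.
rewrite /nontrivial nX nY; split; apply/eqP => e; rewrite e in d.
  case/negP: nY; rewrite -finset.subset0 -(finset.setCT T) -finset.disjoints_subset.
  by rewrite disjoint_sym.
by case/negP: nX; rewrite -finset.subset0 -(finset.setCT T) -finset.disjoints_subset.
Qed.

Definition corr p W : F := gcorr (map (block p) W).

Definition generic p := forall X, nontrivial X -> energy p X != 0.

Lemma corr_swap p : generic p -> zblock [set: T] != 0 ->
  swap_rel (fun X Y => (block_bracket p X Y)%:F) [set: T] (corr p).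
Proof.
move=> gp nzT W1 X Y W2 w; have [nX nY] := composition_mid_nontrivial w.
have [_ w2 d _ _] := set_composition_mid w.
have := @gcorr_block_swap p [::] [::] W1 X Y W2 d (gp X nX) (gp Y nY).
rewrite /= !cats0; apply; apply/orP.
have [->|nT] := eqVneq (X :|: Y) [set: T]; [by right | left].
apply: gp; rewrite /nontrivial nT andbT.
by apply: (set_composition_nonempty w2); rewrite mem_cat inE eqxx orbT.
Qed.

Lemma corr_vanish_first p neg :
  (forall X, nontrivial X -> (energy p X < 0) = neg X) ->
  vanish_first neg [set: T] (corr p).
Proof.
move=> hn X W nW w nX; apply: gcorr_neg.
by rewrite hn //; apply: composition_nontrivial w.
Qed.

Lemma corr_vanish_last p neg : generic p ->
  (forall X, nontrivial X -> (energy p X < 0) = neg X) ->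
  vanish_last neg [set: T] (corr p).
Proof.
move=> gp hn X W nW w nX; rewrite /corr map_rcons; apply: gcorr_pos.
rewrite set_composition_rcons in w; have ntX := composition_nontrivial nW w.
by rewrite lt_neqAle eq_sym gp // leNgt hn.
Qed.

Lemma corr_total p : energy p [set: T] = 0 ->
  corr p [:: [set: T]] = (varsigma (zblock [set: T]))%:F^-1.
Proof. by move=> e; rewrite /corr /= /block e gcorr1. Qed.

Section Crossing.
Context (I : {set 'I_m}) (J : {set 'I_n}) (c1 c2 : set (hpoint m n)).
Hypotheses (wall : is_wall I J) (adj : adjacent I J c1 c2).
Local Notation A := (sum_set I J).
Local Notation B := (~: sum_set I J)%SET.
Context (p p1 : hpoint m n) (cp : c2 p) (cp1 : c1 p1).
Local Notation d := (energy p A).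

(* The words in A completed by the missing energy -d, and those in the
   complement of A completed by d, with z-variable 0 as in the statement. *)
Definition corrA W : F := gcorr (map (block p) W ++ [:: (- d, 0)]).
Definition corrB W : F := gcorr ((d, 0) :: map (block p) W).

Let hc1 : is_chamber c1. Proof. by case: adj. Qed.
Let hc2 : is_chamber c2. Proof. by case: adj. Qed.
Let hp : in_H p. Proof. exact: chamber_in_H cp. Qed.
Let eT : energy p [set: T] = 0. Proof. exact: energyT. Qed.
Let d_gt0 : 0 < d.
Proof. by rewrite energy_sum_set; case: adj => _ _ _ h _; apply: h. Qed.
Let gp : generic p. Proof. by move=> X; apply: chamber_neq0 cp. Qed.
Let ntA : nontrivial A. Proof. exact/is_wall_sum_set. Qed.

Let nontrivialC X : nontrivial X -> nontrivial (~: X)%SET.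
Proof.
move=> /andP[n0 nT]; apply/andP; split.
  by rewrite -(inj_eq (@finset.setC_inj T)) finset.setCK finset.setC0.
by rewrite -(inj_eq (@finset.setC_inj T)) finset.setCK finset.setCT.
Qed.

Let ntB : nontrivial B. Proof. exact: nontrivialC. Qed.
Let eB : energy p B = - d. Proof. exact: energyC. Qed.

Let zA_neq0 : zblock A != 0.
Proof.
have [/set0Pn[j jJ] _] := adjacent_zsum_nonempty adj.
by apply: (@zblock_neq0 _ j); rewrite inE.
Qed.

Let zB_neq0 : zblock B != 0.
Proof.
have [_ /set0Pn[j jJ]] := adjacent_zsum_nonempty adj.
by apply: (@zblock_neq0 _ j); move: jJ; rewrite !inE.
Qed.

Let zT_neq0 : zblock [set: T] != 0.
Proof.
have [/set0Pn[j jJ] _] := adjacent_zsum_nonempty adj.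
by apply: (@zblock_neq0 _ j); rewrite inE.
Qed.

Let sub_nontrivial D X : nontrivial D -> X != finset.set0 -> X \subset D -> nontrivial X.
Proof.
move=> /andP[_ nT] nX sX; rewrite /nontrivial nX; apply: contraNneq nT => e.
by rewrite -finset.subTset -e.
Qed.

Let part_swap D L1 L2 : nontrivial D ->
  swap_rel (fun X Y => (block_bracket p X Y)%:F) D
    (fun W => gcorr (L1 ++ map (block p) W ++ L2)).
Proof.
move=> nD W1 X Y W2 w; have [_ w2 dXY sX sY] := set_composition_mid w.
have nX : X != finset.set0.
  by apply: (set_composition_nonempty w); rewrite mem_cat !inE eqxx orbT.
have nY : Y != finset.set0.
  by apply: (set_composition_nonempty w); rewrite mem_cat !inE eqxx !orbT.
apply: gcorr_block_swap => //; try by apply: gp; apply: sub_nontrivial nD _ _.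
apply/orP; left; apply: gp; apply: sub_nontrivial nD _ _; last by rewrite finset.subUset sX.
by rewrite finset.setU_eq0 negb_and nX.
Qed.

Let neg2 := [pred X : {set T} | energy p X < 0].
Let neg1 := [pred X : {set T} | energy p1 X < 0].

Let compl_union D X : nontrivial D -> X != finset.set0 -> X \proper D ->
  [/\ nontrivial X, nontrivial (~: D :|: X)%SET & [disjoint (~: D)%SET & X]].
Proof.
move=> nD nX pX; have sX := proper_sub pX; split.
- exact: sub_nontrivial nD nX sX.
- rewrite /nontrivial finset.setU_eq0 negb_and nX orbT /=.
  rewrite -(inj_eq (@finset.setC_inj T)) finset.setCT finset.setCU finset.setCK.
  by move: pX; rewrite properE => /andP[_]; rewrite -finset.setD_eq0 finset.setDE.
- by rewrite disjoint_sym finset.disjoints_subset finset.setCK.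
Qed.

Let proper_neqs D X : D = A \/ D = B -> X != finset.set0 -> X \proper D ->
  X != A /\ X != B.
Proof.
move=> hD nX pX; have sX := proper_sub pX.
have dis : ~~ (X \subset (~: D)%SET).
  apply: contra nX => sX'; rewrite -finset.subset0 -(finset.setICr D).
  by rewrite finset.subsetI sX.
have nXD : X != D by apply: contraTneq pX => ->; rewrite fintype.properxx.
have nXC : X != (~: D)%SET by apply: contraNneq dis => ->.
by case: hD nXD nXC => ->; rewrite ?finset.setCK.
Qed.

(** Moving the last block [X] past the operator of energy [- d] leaves words that end in energy
    [energy p X] or [energy p X - d]. The latter is the energy of [B :|: X], positive by
    [adjacent_union_sign]. *)
Let corrA_last : vanish_last neg2 A corrA.
Proof.
move=> X W nW; rewrite set_composition_rcons => w /= negX.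
have nX : X != finset.set0 by case/and3P: (w).
have pX : X \proper A.
  by rewrite finset.properEneq (set_composition_proper nW w); case/and3P: (w).
have [ntX ntU dis] := compl_union ntA nX pX.
have [nXA nXB] := proper_neqs (or_introl erefl) nX pX.
have eU : energy p (B :|: X)%SET = energy p X - d.
  by rewrite energyU // eB addrC.
have eX_gt0 : 0 < energy p X by rewrite lt_neqAle eq_sym gp // leNgt.
have eU_gt0 : 0 < energy p X - d.
  rewrite -eU lt_neqAle eq_sym gp // leNgt.
  by rewrite (adjacent_union_sign wall adj (or_intror erefl)) //; right.
rewrite /corrA map_rcons -cats1 -catA /=.
have h : (energy p X - d != 0) || (zblock X + 0 != 0) by rewrite gt_eqF.
rewrite (gcorr_swap _ _ (zblock_const X) _ (lt0r_neq0 eX_gt0) _ h) ?oppr_eq0 ?lt0r_neq0 //.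
rewrite -cat_rcons !cats1 gcorr_pos // gcorr_pos // mulr0 addr0 //.
Qed.

(** Dual to [corrA_last]: after the exchange the words begin with [X] or with the energy of
    [A :|: X], both negative. *)
Let corrB_first : vanish_first neg2 B corrB.
Proof.
move=> X W nW w /= negX.
have nX : X != finset.set0 by case/and3P: (w).
have pX : X \proper B.
  by rewrite finset.properEneq (set_composition_proper nW w); case/and3P: (w).
have [ntX ntU dis] := compl_union ntB nX pX.
have [nXA nXB] := proper_neqs (or_intror erefl) nX pX.
rewrite finset.setCK in ntU dis.
have eU : energy p (A :|: X)%SET = d + energy p X by rewrite energyU.
have eU_lt0 : d + energy p X < 0.
  rewrite -eU.
  by rewrite (adjacent_union_sign wall adj (or_introl erefl)) //; right.
have h : (d + energy p X != 0) || (0 + zblock X != 0) by rewrite lt_eqF.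
rewrite /corrB /=.
have := gcorr_swap [::] (map (block p) W) _ (zblock_const X) (lt0r_neq0 d_gt0) (gp ntX) h.
by move=> /= ->; rewrite // !gcorr_neg // mulr0 addr0.
Qed.

Lemma corrA_one : corrA [:: A] =
  (varsigma (zblock A *~ d))%:F / (varsigma (zblock A))%:F.
Proof.
have nz : zblock A + 0 != 0 by rewrite addr0.
have := gcorr_pair (w := 0) (zblock_const A) erefl d_gt0 nz.
by rewrite addr0.
Qed.

Lemma corrB_one : corrB [:: B] =
  (varsigma (zblock B *~ d))%:F / (varsigma (zblock B))%:F.
Proof.
have nz : 0 + zblock B != 0 by rewrite add0r.
have := gcorr_pair (z := 0) erefl (zblock_const B) d_gt0 nz.
by rewrite add0r -eB.
Qed.

Let vs_neq0 X : zblock X != 0 -> (varsigma (zblock X))%:F != 0.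
Proof. by move=> nz; rewrite tofrac_eq0 varsigma_neq0 // zblock_const. Qed.

Let vsd_neq0 X : zblock X != 0 -> (varsigma (zblock X *~ d))%:F != 0.
Proof.
move=> nz; rewrite tofrac_eq0 varsigma_neq0 ?mulrz_const ?zblock_const //.
by rewrite zblock_mulrz_neq0 // lt0r_neq0.
Qed.

Lemma block_bracketAB : block_bracket p A B = varsigma (zblock [set: T] *~ d).
Proof.
rewrite /block_bracket eB mulrz_subN -zblockU ?finset.setUCr //.
by rewrite -finset.setI_eq0 finset.setICr.
Qed.

(** [h] represents the correlators of [c1] along the ray, so [h 0] is their extrapolation to [p].
    The general crossing lemma compares the extrapolated functional with the true correlator at
    [p]. *)
Lemma correlator_crossing W (h : nat -> mps n K) :
  set_composition [set: T] W -> W != [::] ->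
  all (fun X : {set T} => (X \subset A) || (X \subset B)) W ->
  poly_family h ->
  (forall t, c1 (line p p1 t) -> corr (line p p1 t) W = (h t)%:F) ->
  corr p W - (h 0%N)%:F =
  (varsigma (zblock [set: T] *~ d))%:F / (varsigma (zblock [set: T]))%:F
  / ((varsigma (zblock A *~ d))%:F / (varsigma (zblock A))%:F
     * ((varsigma (zblock B *~ d))%:F / (varsigma (zblock B))%:F))
  * (corrA [seq X : {set T} <- W | X \subset A]
     * corrB [seq X : {set T} <- W | X \subset B]).
Proof.
move=> w nW sp ph hh; have [N hN] := chamber_line hc1 cp1 hp.
have gt t : (N <= t)%N -> generic (line p p1 t).
  by move=> le_t X; apply: (chamber_neq0 hc1 (hN t le_t)).
have st t : (N <= t)%N -> forall X, nontrivial X ->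
    (energy (line p p1 t) X < 0) = neg1 X.
  move=> le_t X nX /=; have := chamber_sign hc1 cp1 (hN t le_t) nX.
  move: (energy _ X) (energy _ X) => a b.
  case: (ltgtP a 0) => [ha|ha|->].
  - by rewrite (nmulr_lgt0 _ ha) => ->.
  - by rewrite (pmulr_lgt0 _ ha) => hb; rewrite ltNge ltW.
  - by rewrite mulr0 ltxx.
have sT0 : varsigma (zblock [set: T]) != 0.
  by rewrite varsigma_neq0 ?zblock_const.
have cpoly X Y : poly_family (fun t => block_bracket (line p p1 t) X Y).
  apply: poly_family_varsigma; apply: poly_familyD; last apply: poly_familyN.
    by apply: poly_family_ext (poly_family_affine _ _ _) => t; rewrite energy_line.
  by apply: poly_family_ext (poly_family_affine _ _ _) => t; rewrite energy_line.
have TN0 : [set: T] != finset.set0.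
  by case/andP: ntA => nA _; apply: contraNneq nA => e; rewrite -finset.subset0 -e finset.subsetT.
have [|||||Phi [sw vf vl one ext]] := @functional_extrapolation K n T [set: T]
  (fun t => corr (line p p1 t)) (fun t => block_bracket (line p p1 t))
  (varsigma (zblock [set: T])) neg1 N sT0 cpoly.
- by move=> t le_t; apply: corr_swap => //; apply: gt.
- by move=> t le_t; apply: corr_vanish_first; apply: st.
- by move=> t le_t; apply: corr_vanish_last; [apply: gt | apply: st].
- by move=> t le_t; apply: corr_total; apply/energyT/(chamber_in_H hc1)/hN.
- exact: TN0.
have line0 X : energy (line p p1 0) X = energy p X by rewrite energy_line addr0.
have br0 X Y : block_bracket (line p p1 0) X Y = block_bracket p X Y.
  by rewrite /block_bracket !line0.
have sw' : swap_rel (fun X Y => (block_bracket p X Y)%:F) [set: T] Phi.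
  by move=> W1 X Y W2 w'; rewrite (sw _ _ _ _ w') br0.
rewrite -(ext W h nW w ph) => [|t le_t]; last by apply: hh; apply: hN.
have sgn12 X : X != finset.set0 -> X != [set: T] -> X != A -> X != B -> neg1 X = neg2 X.
  move=> n0 nT nXA nXB; apply: (adjacent_same_sign wall adj) => //.
  by rewrite /nontrivial n0.
have dlt : energy p1 A < 0.
  by rewrite energy_sum_set; case: adj => _ _ hlt _ _; apply: hlt.
have eB1 : energy p1 B = - energy p1 A by apply/energyC/energyT/(chamber_in_H hc1).
have [nA nB] : A != finset.set0 /\ B != finset.set0.
  by case/andP: ntA => -> _; case/andP: ntB => -> _.
have cBA : (block_bracket p B A)%:F = - (block_bracket p A B)%:F.
  by rewrite -tofracN -varsigmaN opprB.
have pos1B : ~~ neg1 B by rewrite /= eB1 -leNgt oppr_ge0 ltW.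
have pos2A : ~~ neg2 A by rewrite /= -leNgt ltW.
have neg2B : neg2 B by rewrite /= eB oppr_lt0.
have negUA X : X != finset.set0 -> X \proper B -> neg2 X -> neg2 (A :|: X)%SET.
  move=> nX pX negX; have [ntX ntU dis] := compl_union ntB nX pX.
  rewrite finset.setCK in ntU dis.
  have [nXA nXB] := proper_neqs (or_intror erefl) nX pX.
  rewrite /neg2 inE (adjacent_union_sign wall adj (or_introl erefl) dis ntX nXA nXB ntU) //.
  by right.
have negUB X : X != finset.set0 -> X \proper A -> neg1 X -> neg1 (B :|: X)%SET.
  move=> nX pX negX; have [ntX ntU dis] := compl_union ntA nX pX.
  have [nXA nXB] := proper_neqs (or_introl erefl) nX pX.
  rewrite /neg1 inE (adjacent_union_sign wall adj (or_intror erefl) dis ntX nXA nXB ntU) //.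
  by left.
have sw2 := corr_swap gp zT_neq0.
have vf2 : vanish_first neg2 [set: T] (corr p) by apply: corr_vanish_first.
have vl2 : vanish_last neg2 [set: T] (corr p) by apply: corr_vanish_last.
have one12 : Phi [:: [set: T]] = corr p [:: [set: T]].
  exact: (etrans one (esym (corr_total eT))).
have swA : swap_rel (fun X Y => (block_bracket p X Y)%:F) A corrA.
  exact: (part_swap [::] [:: (- d, 0)] ntA).
have swB : swap_rel (fun X Y => (block_bracket p X Y)%:F) B corrB.
  move=> W1 X Y W2 w'; have := part_swap [:: (d, 0)] [::] ntB w'.
  by rewrite /corrB !cats0.
have vfA : vanish_first neg2 A corrA.
  by move=> X W' _ _ negX; apply: gcorr_neg.
have vlB : vanish_last neg2 B corrB.
  move=> X W' nW' w' negX; rewrite /corrB map_rcons -rcons_cons; apply: gcorr_pos.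
  rewrite set_composition_rcons in w'; rewrite lt_neqAle eq_sym leNgt negX andbT.
  apply: gp; case/and3P: w' => n0 sX _; exact: sub_nontrivial ntB n0 sX.
have nzA : corrA [:: A] != 0.
  rewrite corrA_one; exact: divf_neq0 (vsd_neq0 zA_neq0) (vs_neq0 zA_neq0).
have nzB : corrB [:: B] != 0.
  rewrite corrB_one; exact: divf_neq0 (vsd_neq0 zB_neq0) (vs_neq0 zB_neq0).
have := @crossing_difference T F (fun X Y => (block_bracket p X Y)%:F) A neg1 neg2
  Phi (corr p) corrA corrB nA nB cBA dlt pos1B pos2A neg2B sgn12 negUA negUB
  sw' sw2 vf vf2 vl vl2 one12 swA swB vfA corrB_first corrA_last vlB nzA nzB W w nW sp.
by rewrite (corr_total eT) block_bracketAB corrA_one corrB_one.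
Qed.

End Crossing.
End Blocks.

(** * Coefficients of the generating series *)

Section Monomials.
Context (R : comNzRingType).

Definition mps_mono (N : nat) (e : 'X_{1..N}) : mps N R := Mps (fun m => (m == e)%:R).

Lemma mps_monoM N (e f : 'X_{1..N}) :
  mps_mono e * mps_mono f = mps_mono (e + f)%MM.
Proof.
apply: mpsP => m; rewrite mpsE_mul /=; have [->|ne] := eqVneq m (e + f)%MM; last first.
  rewrite big1 // => -[k1 k2] /= /eqP em; case: eqP => [e1|_]; last by rewrite mul0r.
  case: eqP => [e2|_]; last by rewrite mulr0.
  by rewrite em e1 e2 eqxx in ne.
set d := (mdeg _).+1.
have b1 : (mdeg e < d)%N by rewrite ltnS mdegD leq_addr.
have b2 : (mdeg f < d)%N by rewrite ltnS mdegD leq_addl.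
rewrite (bigD1 (BMultinom b1, BMultinom b2)) //= !eqxx mulr1 big1 ?addr0 //.
move=> [k1 k2] /= /andP[/eqP e1 ne]; case: eqP => [h1|_]; last by rewrite mul0r.
case: eqP => [h2|_]; last by rewrite mulr0.
by case/eqP: ne; congr pair; apply/val_inj.
Qed.

Section Substitution.
Context (l N : nat) (sigma : 'I_l -> 'I_N).
Hypothesis sigma_inj : injective sigma.

(** [sigma] embeds the variables of a factor into those of the ambient series; [mpull] and [mpush]
    transport exponents along it, and a monomial is [msupported] when no other variable occurs in
    it. *)
Definition mpull (m : 'X_{1..N}) : 'X_{1..l} := [multinom m (sigma j) | j < l].

Definition mpush (v : 'X_{1..l}) : 'X_{1..N} :=
  [multinom (\sum_(j < l | sigma j == i) v j)%N | i < N].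

Definition msupported (m : 'X_{1..N}) : bool :=
  [forall i, (i \in codom sigma) || (m i == 0%N)].

Lemma mpush_sum v : mpush v = (\sum_(j < l) U_(sigma j) *+ v j)%MM.
Proof.
apply/mnmP => i; rewrite mnmE mnm_sumE big_mkcond; apply: eq_bigr => j _.
by rewrite mulmnE mnm1E; case: eqP; rewrite ?mul1n ?mul0n.
Qed.

Lemma mpush_pull m : (m == mpush (mpull m)) = msupported m.
Proof.
apply/eqP/forallP => [-> i|h].
  have [//|ni] := boolP (i \in codom sigma).
  rewrite mnmE big_pred0 // => j; apply/negbTE; apply: contra ni => /eqP <-.
  exact: codom_f.
apply/mnmP => i; rewrite mnmE; have /orP[/codomP[j ->]|/eqP mi] := h i.
  rewrite (big_pred1 j) ?mnmE // => j'; exact: inj_eq.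
rewrite mi big1 // => j /eqP e; by rewrite mnmE e.
Qed.

Lemma mpull_push v : mpull (mpush v) = v.
Proof.
apply/mnmP => j; rewrite !mnmE (big_pred1 j) // => j'; exact: inj_eq.
Qed.

Lemma mdeg_pull m : (mdeg (mpull m) <= mdeg m)%N.
Proof.
rewrite !mdegE; under eq_bigr => j _ do rewrite mnmE.
rewrite -(big_imset (fun i => m i) (h := sigma) (A := predT)) /=; last first.
  by move=> j j' _ _; apply: sigma_inj.
rewrite [X in (_ <= X)%N](bigID (mem (sigma @: predT)%SET)) /=.
exact: leq_addr.
Qed.

Lemma prod_mpsX (u : l.-tuple (mps N R)) (v : 'X_{1..l}) :
  (forall j, tnth u j = mpsX R (sigma j)) ->
  \prod_(j < l) tnth u j ^+ v j = mps_mono (mpush v).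
Proof.
move=> hu; rewrite mpush_sum.
apply: (big_ind2 (fun x e => x = mps_mono e)) => // [x1 e1 x2 e2 -> ->|j _].
  by rewrite mps_monoM.
rewrite hu; elim: (v j) => [|k IH]; first by rewrite expr0 mulm0n.
by rewrite exprS IH mulmS -mps_monoM.
Qed.

(** As [sigma] is injective, distinct [v] give distinct monomials, and a coefficient is a single
    term. *)
Lemma mono_series_coef (u : l.-tuple (mps N R)) (d : nat) (P : pred 'X_{1..l})
    (c : 'X_{1..l} -> R) (m : 'X_{1..N}) :
  (forall j, tnth u j = mpsX R (sigma j)) ->
  (P (mpull m) -> mdeg (mpull m) < d)%N ->
  (\sum_(v : 'X_{1..l < d} | P v) c v *: \prod_(j < l) tnth u j ^+ v j) m =
  if msupported m && P (mpull m) then c (mpull m) else 0.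
Proof.
move=> hu hd; rewrite mps_sumE.
under eq_bigr => v _ do rewrite mpsE_scale (prod_mpsX _ hu) /=.
case: ifP => [/andP[sm Pm]|nP].
  rewrite (bigD1 (BMultinom (hd Pm))) //= mpush_pull sm mulr1 big1 ?addr0 //.
  move=> v /andP[_ ne]; case: eqP => [e|_]; last by rewrite mulr0.
  by case/eqP: ne; apply/val_inj; rewrite /= e mpull_push.
rewrite big1 // => v Pv; case: eqP => [e|_]; last by rewrite mulr0.
move: nP; rewrite e mpull_push Pv andbT => /negP[].
by rewrite -mpush_pull mpull_push.
Qed.

End Substitution.

Definition mrestr N (D : pred 'I_N) (m : 'X_{1..N}) : 'X_{1..N} :=
  [multinom (if D i then m i else 0%N) | i < N].

(** With complementary variables in the two factors a monomial splits in one way only, so the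
    convolution has at most one nonzero term. *)
Lemma mul_disjoint_support N (D : pred 'I_N) (f g : mps N R) (m : 'X_{1..N}) :
  (forall k, f k != 0 -> forall i, ~~ D i -> k i = 0%N) ->
  (forall k, g k != 0 -> forall i, D i -> k i = 0%N) ->
  (f * g) m = f (mrestr D m) * g (mrestr (predC D) m).
Proof.
move=> hf hg; have em : m = (mrestr D m + mrestr (predC D) m)%MM.
  by apply/mnmP => i; rewrite mnmDE !mnmE /=; case: (D i); rewrite ?addn0.
have dm := congr1 (@mdeg N) em; rewrite mdegD in dm.
rewrite mpsE_mul.
have b1 : (mdeg (mrestr D m) < (mdeg m).+1)%N by rewrite ltnS dm leq_addr.
have b2 : (mdeg (mrestr (predC D) m) < (mdeg m).+1)%N by rewrite ltnS dm leq_addl.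
rewrite (bigD1 (BMultinom b1, BMultinom b2)) /=; last by apply/eqP.
rewrite big1 ?addr0 // => -[k1 k2] /= /andP[/eqP e ne].
apply/eqP; apply: contraT => nz.
have nz1 : f k1 != 0 by apply: contraNneq nz => ->; rewrite mul0r.
have nz2 : g k2 != 0 by apply: contraNneq nz => ->; rewrite mulr0.
case/eqP: ne; congr pair; apply/val_inj/mnmP => i; rewrite /= mnmE /=;
  have := congr1 (fun t : 'X_{1..N} => t i) e; rewrite mnmDE => ->.
  case: ifP => Di; first by rewrite (hg _ nz2) ?addn0.
  by rewrite (hf _ nz1) ?Di.
case: ifP => Di; first by rewrite (hf _ nz1).
by rewrite (hg _ nz2) //; apply: negbFE.
Qed.

End Monomials.

(** * The word of single letters and its restrictions to both sides of the wall *)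

Lemma composition_singletons (T : finType) (s : seq T) : uniq s ->
  set_composition [set x in s] [seq [set x]%SET | x <- s].
Proof.
elim: s => [_|x s IH] /=; first by apply/eqP/finset.setP => y; rewrite !inE.
move=> /andP[xs Us]; apply/and3P; split.
- by apply/set0Pn; exists x; rewrite inE.
- by rewrite finset.sub1set !inE eqxx.
have -> : ([set y in x :: s] :\: [set x])%SET = [set y in s]; last exact: IH.
apply/finset.setP => y; rewrite !inE; case: eqVneq => [->|] //=.
by rewrite (negbTE xs).
Qed.

Lemma enum_filter (T : finType) (D : {set T}) : [seq x <- enum T | x \in D] = enum D.
Proof. by rewrite enumT. Qed.

Lemma enum_fullset (T : finType) : enum [set: T] = enum T.
Proof. by apply: eq_enum => x; rewrite inE. Qed.

Lemma val_sub_tuple (X : Type) (k : nat) (J : {set 'I_k}) (t : k.-tuple X) :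
  sub_tuple J t = [seq tnth t j | j <- enum J] :> seq X.
Proof.
rewrite /= /image_mem.
have -> : [seq tnth t j | j <- enum J] = [seq tnth t j | j <- [seq enum_val i | i : 'I_#|J|]].
  congr (map _ _); case: (pickP (mem J)) => [j0 _|J0]; last first.
    rewrite (eq_enum J0) enum0; apply/esym/size0nil.
    by rewrite size_map size_enum_ord (eq_card0 J0).
  apply: (eq_from_nth (x0 := j0)) => [|i]; first by rewrite size_map -cardE size_enum_ord.
  rewrite -cardE => lt_i; have := enum_val_nth j0 (Ordinal lt_i) => /= <-.
  rewrite (nth_map (Ordinal lt_i)) ?size_enum_ord //; congr enum_val.
  exact/esym/(nth_ord_enum (Ordinal lt_i) (Ordinal lt_i)).
by rewrite /image_mem -[RHS]map_comp.
Qed.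

Section SingletonWords.
Context (K : numFieldType) (m n : nat).
Local Notation T := ('I_m + 'I_n)%type.
Implicit Types (p : hpoint m n) (I : {set 'I_m}) (J : {set 'I_n}).

Definition letters I J : seq T := map inl (enum I) ++ map inr (enum J).

Definition word I J : seq {set T} := [seq [set x]%SET | x <- letters I J].

Lemma letters_uniq I J : uniq (letters I J).
Proof.
rewrite cat_uniq !map_inj_uniq ?enum_uniq; [|by move=> ? ? []|by move=> ? ? []].
by rewrite andbT; apply/hasPn => x /mapP[j _ ->]; apply/mapP => -[].
Qed.

Lemma word_composition : set_composition [set: T] (word [set: 'I_m] [set: 'I_n]).
Proof.
rewrite (_ : [set: T] = [set x in letters [set: 'I_m] [set: 'I_n]]).
  exact/composition_singletons/letters_uniq.
apply/finset.setP => -[i|j]; rewrite !inE mem_cat; apply/esym/orP; [left|right];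
  by rewrite mem_map ?mem_enum ?inE // => ? ? [].
Qed.

Lemma restr_word I J :
  [seq X : {set T} <- word [set: 'I_m] [set: 'I_n] | X \subset sum_set I J] = word I J.
Proof.
rewrite /word filter_map; congr map.
rewrite (eq_filter (a2 := mem (sum_set I J))); last by move=> x /=; rewrite finset.sub1set.
rewrite /letters filter_cat !filter_map; congr (_ ++ _); congr map.
  rewrite (eq_filter (a2 := mem I)); last by move=> x /=; rewrite inE.
  by rewrite enum_fullset; apply: enum_filter.
rewrite (eq_filter (a2 := mem J)); last by move=> x /=; rewrite inE.
by rewrite enum_fullset; apply: enum_filter.
Qed.

Lemma word_split I J : all (fun X : {set T} => (X \subset sum_set I J)
  || (X \subset (~: sum_set I J)%SET)) (word [set: 'I_m] [set: 'I_n]).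
Proof.
by apply/allP => X /mapP[x _ ->]; rewrite !finset.sub1set !inE orbN.
Qed.

Lemma map_block_word p I J : map (block K p) (word I J) =
  [seq (a%:Z, 0) | a <- sub_tuple I p.1]
  ++ [seq (- az.1%:Z, az.2) | az <- zip (sub_tuple J p.2) (sub_tuple J (z_ n K))].
Proof.
rewrite !val_sub_tuple zip_map /word /letters !map_cat; congr (_ ++ _).
  rewrite -[LHS]map_comp -[LHS]map_comp -[RHS]map_comp; apply: eq_map => i /=.
  by rewrite /block /energy /zblock !big_set1.
rewrite -[LHS]map_comp -[LHS]map_comp -[RHS]map_comp; apply: eq_map => j /=.
by rewrite /block /energy /zblock !big_set1 /= tnth_mktuple.
Qed.

Lemma sub_tupleT (X : Type) (k : nat) (t : k.-tuple X) :
  sub_tuple [set: 'I_k] t = t :> seq X.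
Proof.
rewrite val_sub_tuple -[RHS]map_tnth_enum; by rewrite enum_fullset.
Qed.

Lemma corr_word p :
  corr K p (word [set: 'I_m] [set: 'I_n]) = correlator p.1 p.2 (z_ n K).
Proof. by rewrite /corr map_block_word !sub_tupleT. Qed.

Lemma corrA_word p I J (d : nat) : energy p (sum_set I J) = d%:Z ->
  corrA K I J p (word I J) =
  correlator (sub_tuple I p.1) [tuple of rcons (sub_tuple J p.2) d]
     [tuple of rcons (sub_tuple J (z_ n K)) 0].
Proof.
move=> e; rewrite /corrA map_block_word e -catA; congr (gcorr (_ ++ _)).
rewrite /= zip_rcons; last by rewrite !size_tuple.
by rewrite map_rcons cats1.
Qed.

(** Both z-variables vanish, so the bracket is [varsigma 0 = 0]. This moves the operator of energy
    [delta], which is first in [corrB], behind the parts of [mu] to which the statement appends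
    it. *)
Lemma gcorr_commute_positive (s : seq nat) (d : nat) (L1 L2 : seq (int * mps n K)) :
  all (fun a => 0 < a)%N s -> (0 < d)%N ->
  gcorr (L1 ++ (d%:Z, 0) :: [seq (a%:Z, 0) | a <- s] ++ L2) =
  gcorr (L1 ++ rcons [seq (a%:Z, 0) | a <- s] (d%:Z, 0) ++ L2).
Proof.
move=> hs d_gt0; elim: s L1 hs => [//|a s IH] L1 /= /andP[a_gt0 hs].
rewrite -[in RHS]cat_rcons -IH // cat_rcons.
have h : (d%:Z + a%:Z != 0) || ((0 : mps n K) + 0 != 0) by lia.
have nd : d%:Z != 0 by lia.
have na : a%:Z != 0 by lia.
rewrite (gcorr_swap L1 _ (z := 0) (w := 0) erefl erefl nd na h).
by rewrite !mul0rz subr0 varsigma0 tofrac0 mul0r addr0.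
Qed.

Lemma corrB_word p I J (d : nat) : energy p (sum_set I J) = d%:Z -> (0 < d)%N ->
  in_H p ->
  corrB K I J p (word (~: I)%SET (~: J)%SET) =
  correlator [tuple of rcons (sub_tuple (~: I)%SET p.1) d]
     (sub_tuple (~: J)%SET p.2) (sub_tuple (~: J)%SET (z_ n K)).
Proof.
move=> e d_gt0 [h1 _ _]; rewrite /corrB map_block_word e.
rewrite /correlator -/(gcorr _) map_rcons.
apply: (gcorr_commute_positive [::]) => //.
apply/allP => a; rewrite val_sub_tuple => /mapP[i _ ->].
exact: (allP h1 _ (mem_tnth _ _)).
Qed.

Lemma poly_family_qeval (q : poly_series m n K) p p0 :
  poly_family (fun t => qeval q (line p p0 t)).
Proof.
move=> k; apply: (@poly_fun_ext _ (fun t => \sum_(e <- msupp (q k))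
  (q k)@_e * \prod_i coords K (line p p0 t) 0 i ^+ e i)).
  by move=> t; rewrite /qeval /= mevalE.
apply: poly_fun_sum => e _; apply: poly_funM; first exact: poly_fun_const.
have hc i : poly_fun (fun t => coords K (line p p0 t) 0 i).
  apply: (@poly_fun_ext _ (fun t => coords K p 0 i + t%:R * coords K p0 0 i)).
    move=> t; rewrite !mxE; case: (split_ordP i) => j ->.
      by rewrite !tnth_lshift tnth_mktuple natrD natrM.
    by rewrite !tnth_rshift tnth_mktuple natrD natrM.
  apply: poly_funD; first exact: poly_fun_const.
  by apply: poly_funM; [exact: poly_fun_id | exact: poly_fun_const].
have hX i j : poly_fun (fun t => coords K (line p p0 t) 0 i ^+ j).
  elim: j => [|j IH]; first by apply: poly_fun_ext (poly_fun_const 1).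
  by apply: poly_fun_ext (poly_funM (hc i) IH) => t; rewrite exprS.
apply: (@poly_fun_ext _ (fun t => \prod_(i <- index_enum 'I_(m + n))
  coords K (line p p0 t) 0 i ^+ e i)) => //.
elim: (index_enum _) => [|i s IH].
  by apply: poly_fun_ext (poly_fun_const 1) => t; rewrite big_nil.
by apply: poly_fun_ext (poly_funM (hX i (e i)) IH) => t; rewrite big_cons.
Qed.

End SingletonWords.

Lemma tnth_rcons_widen (X : Type) (l : nat) (t : l.-tuple X) (x : X) (j : 'I_l) :
  tnth [tuple of rcons t x] (widen_ord (leqnSn l) j) = tnth t j.
Proof.
by rewrite (tnth_nth x) /= nth_rcons size_tuple ltn_ord -tnth_nth.
Qed.

Lemma tnth_rcons_max (X : Type) (l : nat) (t : l.-tuple X) (x : X) :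
  tnth [tuple of rcons t x] ord_max = x.
Proof. by rewrite (tnth_nth x) /= nth_rcons size_tuple ltnn eqxx. Qed.

(** The appended part [e] occurs once in each denominator, and [e ^+ 2] cancels both. The two
    factors 1 are its weights at [v = 0] and [z = 0]. *)
Lemma split_fraction (F : fieldType) (x y A A' B B' M M' N N' e : F) : e != 0 ->
  e ^+ 2 * ((A * 1) * (B * 1) * (x / (M * (N * e)))
            * (A' * B' * (y / ((M' * e) * N'))))
  = (A * A') * (B * B') * (x * y / ((M * M') * (N * N'))).
Proof.
move=> ne; rewrite !invfM; move: (M^-1) (M'^-1) (N^-1) (N'^-1) => a a' b b'.
by field.
Qed.

(** * Coefficients of the two generating series *)

Section SeriesCoefficients.
Context (K : numFieldType) (n : nat).
Local Notation F := {fraction mps n K}.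

Definition le_weight (a v : nat) : F := (v + a).-1`!%:R / a.-1`!%:R.
Definition le_S (a : nat) (z : mps n K) : F := (calS z)%:F ^+ a.-1.
(** The value zero beyond [a] replaces the bound on the summation range. *)
Definition lt_weight (a v : nat) : F :=
  if (v <= a)%N then a`!%:R / (a - v)`!%:R else 0.
Definition lt_S (a : nat) (z : mps n K) : F := (calS z)%:F ^- a.+1.

Section Coefficient.
Context (m l N : nat) (mu : m.-tuple nat) (nu : l.-tuple nat)
  (u : l.-tuple (mps N F)) (z : l.-tuple (mps n K)) (X : F)
  (sigma : 'I_l -> 'I_N).
Hypotheses (sigma_inj : injective sigma)
  (u_sigma : forall j, tnth u j = mpsX F (sigma j)).

(** The common shape of the coefficients of both series, which differ only in the weights [a] and
    [b]; the wall-crossing is thereby proved for both at once. *)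
Definition series_coef (a : nat -> nat -> F) (b : nat -> mps n K -> F)
    (M : 'X_{1..N}) : F :=
  if msupported sigma M then
    \prod_(j < l) a (tnth nu j) (M (sigma j)) * \prod_(j < l) b (tnth nu j) (tnth z j)
    * (X / (\prod_(i < m) (tnth mu i)%:R * \prod_(j < l) (tnth nu j)%:R))
  else 0.

Lemma Hle_coef M : Hle_with mu nu u z X M = series_coef le_weight le_S M.
Proof.
rewrite /Hle_with /mps_sum /=.
have := @mono_series_coef F l N sigma sigma_inj u (mdeg M).+1 predT
  (fun v => \prod_(j < l) (((v j + tnth nu j).-1)`!%:R / ((tnth nu j).-1)`!%:R)
     * \prod_(j < l) (calS (tnth z j))%:F ^+ (tnth nu j).-1
     * (X / (\prod_(i < m) (tnth mu i)%:R * \prod_(j < l) (tnth nu j)%:R)))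
  M u_sigma.
rewrite mps_sumE => -> /=; last by move=> _; rewrite ltnS; apply: mdeg_pull.
rewrite andbT /series_coef; case: ifP => // _.
by congr (_ * _ * _); apply: eq_bigr => j _; rewrite mnmE.
Qed.

Lemma Hlt_coef M : Hlt_with mu nu u z X M = series_coef lt_weight lt_S M.
Proof.
rewrite /Hlt_with.
rewrite (@mono_series_coef F l N sigma sigma_inj u _
  (fun v => [forall j, (v j <= tnth nu j)%N])
  (fun v => \prod_(j < l) ((tnth nu j)`!%:R / (tnth nu j - v j)`!%:R)
     * \prod_(j < l) (calS (tnth z j))%:F ^- (tnth nu j).+1
     * (X / (\prod_(i < m) (tnth mu i)%:R * \prod_(j < l) (tnth nu j)%:R)))
  M u_sigma) /=; last first.
  by move=> /forallP h; rewrite ltnS mdegE; apply: leq_sum => j _; apply: h.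
rewrite /series_coef; case: (msupported sigma M) => //=.
case: forallP => [h|nh].
  congr (_ * _ * _); apply: eq_bigr => j _.
  by have := h j; rewrite /lt_weight mnmE => ->.
have [j hj] : exists j, ~~ (M (sigma j) <= tnth nu j)%N.
  apply/existsP; rewrite -negb_forall; apply/negP => /forallP h; case: nh => j.
  by rewrite mnmE.
rewrite [X in _ = X * _ * _](bigD1 j) //= {1}/lt_weight (negbTE hj).
by rewrite !mul0r.
Qed.

End Coefficient.

Section SplitVariables.
Context (m : nat) (mu : m.-tuple nat) (nu : n.-tuple nat)
  (I : {set 'I_m}) (J : {set 'I_n}) (d : nat) (X1 X2 : F).

(** The variables of the first factor: those indexed by [J], then [u'] as the last one. The image is
    complementary to that of [sigma2]. *)
Definition sigma1 (j : 'I_(#|J|.+1)) : 'I_n.+1 :=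
  tnth [tuple of rcons (sub_tuple J [tuple widen_ord (leqnSn n) i | i < n]) ord_max] j.

Definition sigma2 (j : 'I_(#|(~: J)%SET|)) : 'I_n.+1 :=
  widen_ord (leqnSn n) (enum_val j).

Lemma sigma1_widen (j : 'I_#|J|) :
  sigma1 (widen_ord (leqnSn _) j) = widen_ord (leqnSn n) (enum_val j).
Proof. by rewrite /sigma1 tnth_rcons_widen !tnth_mktuple. Qed.

Lemma sigma1_max : sigma1 ord_max = ord_max.
Proof. exact: tnth_rcons_max. Qed.

Lemma ord_widen_or_max k (i : 'I_k.+1) :
  i = ord_max \/ exists j : 'I_k, i = widen_ord (leqnSn k) j.
Proof.
have [lt|ge] := ltnP i k; [right; exists (Ordinal lt) | left]; apply/val_inj => //=.
by apply/eqP; rewrite eqn_leq ge -ltnS ltn_ord.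
Qed.

Lemma sigma1_inj : injective sigma1.
Proof.
move=> i j; have [->|[i' ->]] := ord_widen_or_max i;
  have [->|[j' ->]] := ord_widen_or_max j; rewrite ?sigma1_max ?sigma1_widen //.
- by move=> /(congr1 val) /= e; have := ltn_ord (enum_val j'); rewrite -e ltnn.
- by move=> /(congr1 val) /= e; have := ltn_ord (enum_val i'); rewrite e ltnn.
- by move=> /(congr1 val) /= /val_inj/enum_val_inj ->.
Qed.

Lemma sigma2_inj : injective sigma2.
Proof. by move=> i j /(congr1 val) /= /val_inj/enum_val_inj. Qed.

Lemma codom_sigma1 (j : 'I_n) : (widen_ord (leqnSn n) j \in codom sigma1) = (j \in J).
Proof.
apply/codomP/idP => [[ i]|jJ].
  have [->|[i' ->]] := ord_widen_or_max i; rewrite ?sigma1_max ?sigma1_widen.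
    by move=> /(congr1 val) /= e; have := ltn_ord j; rewrite e ltnn.
  by move=> /(congr1 val) /= /val_inj ->; apply: enum_valP.
exists (widen_ord (leqnSn _) (enum_rank_in jJ j)).
by rewrite sigma1_widen enum_rankK_in.
Qed.

Lemma codom_sigma2 (j : 'I_n) : (widen_ord (leqnSn n) j \in codom sigma2) = (j \notin J).
Proof.
rewrite -finset.in_setC; apply/codomP/idP => [[ i]|jJ].
  by move=> /(congr1 val) /= /val_inj ->; apply: enum_valP.
exists (enum_rank_in jJ j); by rewrite /sigma2 enum_rankK_in.
Qed.

Lemma codom_sigma1_max : ord_max \in codom sigma1.
Proof. by rewrite -sigma1_max codom_f. Qed.

Lemma codom_sigma2_max : ord_max \notin codom sigma2.
Proof.
apply/codomP => -[i /(congr1 val) /= e].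
by have := ltn_ord (enum_val i); rewrite -e ltnn.
Qed.

Lemma codom_sigmaC i : (i \in codom sigma2) = (i \notin codom sigma1).
Proof.
have [->|[j ->]] := ord_widen_or_max i.
  by rewrite codom_sigma1_max (negbTE codom_sigma2_max).
by rewrite codom_sigma1 codom_sigma2.
Qed.

Lemma tnth_u1 j :
  tnth [tuple of rcons (sub_tuple J (u_ext n K)) (u' n K)] j = mpsX F (sigma1 j).
Proof.
have [->|[j' ->]] := ord_widen_or_max j; first by rewrite tnth_rcons_max sigma1_max.
by rewrite tnth_rcons_widen sigma1_widen !tnth_mktuple.
Qed.

Lemma tnth_u2 j : tnth (sub_tuple (~: J)%SET (u_ext n K)) j = mpsX F (sigma2 j).
Proof. by rewrite !tnth_mktuple. Qed.

Local Notation mu1 := (sub_tuple I mu).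
Local Notation nu1 := [tuple of rcons (sub_tuple J nu) d].
Local Notation z1 := [tuple of rcons (sub_tuple J (z_ n K)) 0].
Local Notation mu2 := [tuple of rcons (sub_tuple (~: I)%SET mu) d].
Local Notation nu2 := (sub_tuple (~: J)%SET nu).
Local Notation z2 := (sub_tuple (~: J)%SET (z_ n K)).

Lemma prod_sub_tuple (R : comNzRingType) (k : nat) (D : {set 'I_k}) (G : 'I_k -> R) :
  \prod_(j < #|D|) G (enum_val j) = \prod_(j in D) G j.
Proof. by rewrite -big_enum_val. Qed.

Lemma prod_setID (R : comNzRingType) (k : nat) (D : {set 'I_k}) (G : 'I_k -> R) :
  (\prod_(j in D) G j) * (\prod_(j in (~: D)%SET) G j) = \prod_(j < k) G j.
Proof.
rewrite [RHS](bigID (mem D)) /=; congr (_ * _).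
by apply: eq_bigl => j; rewrite inE.
Qed.

(** Extracting the power 0 of [u'] pads the exponent of [M] with a 0, at which the appended part has
    weight 1. The factors have complementary variables, and their products over [J] and its
    complement recombine. *)
Lemma split_series_coef (a : nat -> nat -> F) (b : nat -> mps n K -> F)
    (f g : mps n.+1 F) (M : 'X_{1..n}) : a d 0%N = 1 -> b d 0 = 1 -> d%:R != 0 :> F ->
  (forall M, f M = series_coef mu1 nu1 z1 X1 sigma1 a b M) ->
  (forall M, g M = series_coef mu2 nu2 z2 X2 sigma2 a b M) ->
  d%:R ^+ 2 * last_coef 0 (f * g) M = series_coef mu nu (z_ n K) (X1 * X2) id a b M.
Proof.
move=> a0 b0 nd fE gE; set M' : 'X_{1..n.+1} := Multinom [tuple of rcons (multinom_val M) 0%N].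
have M'w (j : 'I_n) : M' (widen_ord (leqnSn n) j) = M j by apply: tnth_rcons_widen.
have M'm : M' ord_max = 0%N by apply: tnth_rcons_max.
have -> : last_coef 0 (f * g) M = (f * g) M' by [].
rewrite (@mul_disjoint_support _ _ (mem (codom sigma1))); last first.
- move=> k; rewrite gE /series_coef; case: ifP => [/forallP h _ i /= hi|]; last by rewrite eqxx.
  by have := h i; rewrite codom_sigmaC hi => /eqP.
- move=> k; rewrite fE /series_coef; case: ifP => [/forallP h _ i /= hi|]; last by rewrite eqxx.
  by have := h i; rewrite (negbTE hi) => /eqP.
rewrite fE gE /series_coef.
have -> : msupported sigma1 (mrestr (mem (codom sigma1)) M').
  by apply/forallP => i; rewrite mnmE /=; case: (i \in codom sigma1).
have -> : msupported sigma2 (mrestr (predC (mem (codom sigma1))) M').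
  by apply/forallP => i; rewrite mnmE /= codom_sigmaC; case: (i \in codom sigma1).
have -> : msupported id M.
  by apply/forallP => i; apply/orP; left; apply/codomP; exists i.
rewrite !big_ord_recr /= !tnth_rcons_max.
have eA1 : \prod_(j < #|J|) a (tnth nu1 (widen_ord (leqnSn _) j))
    (mrestr (mem (codom sigma1)) M' (sigma1 (widen_ord (leqnSn _) j)))
    = \prod_(j in J) a (tnth nu j) (M j).
  rewrite -prod_sub_tuple; apply: eq_bigr => j _.
  by rewrite tnth_rcons_widen sigma1_widen mnmE /= codom_sigma1 enum_valP M'w tnth_mktuple.
have eA1' : mrestr (mem (codom sigma1)) M' (sigma1 ord_max) = 0%N.
  by rewrite sigma1_max mnmE M'm; case: ifP.
have eB1 : \prod_(j < #|J|) b (tnth nu1 (widen_ord (leqnSn _) j)) (tnth z1 (widen_ord (leqnSn _) j))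
    = \prod_(j in J) b (tnth nu j) (tnth (z_ n K) j).
  by rewrite -prod_sub_tuple; apply: eq_bigr => j _; rewrite !tnth_rcons_widen !tnth_mktuple.
have eM1 : \prod_(i < #|I|) (tnth mu1 i)%:R = \prod_(i in I) (tnth mu i)%:R :> F.
  by rewrite -prod_sub_tuple; apply: eq_bigr => j _; rewrite tnth_mktuple.
have eN1 : \prod_(j < #|J|) (tnth nu1 (widen_ord (leqnSn _) j))%:R = \prod_(j in J) (tnth nu j)%:R :> F.
  by rewrite -prod_sub_tuple; apply: eq_bigr => j _; rewrite tnth_rcons_widen tnth_mktuple.
have eA2 : \prod_(j < #|(~: J)%SET|) a (tnth nu2 j)
    (mrestr (predC (mem (codom sigma1))) M' (sigma2 j))
    = \prod_(j in (~: J)%SET) a (tnth nu j) (M j).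
  rewrite -prod_sub_tuple; apply: eq_bigr => j _.
  rewrite mnmE /= /sigma2 codom_sigma1 M'w tnth_mktuple.
  by have := enum_valP j; rewrite finset.in_setC => ->.
have eB2 : \prod_(j < #|(~: J)%SET|) b (tnth nu2 j) (tnth z2 j)
    = \prod_(j in (~: J)%SET) b (tnth nu j) (tnth (z_ n K) j).
  by rewrite -prod_sub_tuple; apply: eq_bigr => j _; rewrite !tnth_mktuple.
have eM2 : \prod_(i < #|(~: I)%SET|) (tnth mu2 (widen_ord (leqnSn _) i))%:R
    = \prod_(i in (~: I)%SET) (tnth mu i)%:R :> F.
  by rewrite -prod_sub_tuple; apply: eq_bigr => j _; rewrite tnth_rcons_widen tnth_mktuple.
have eN2 : \prod_(j < #|(~: J)%SET|) (tnth nu2 j)%:R = \prod_(j in (~: J)%SET) (tnth nu j)%:R :> F.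
  by rewrite -prod_sub_tuple; apply: eq_bigr => j _; rewrite tnth_mktuple.
rewrite eA1 eA1' eB1 eM1 eN1 eA2 eB2 eM2 eN2 a0 b0 (split_fraction _ _ _ _ _ _ _ _ _ _ nd).
by rewrite !prod_setID.
Qed.

End SplitVariables.
End SeriesCoefficients.

(** * The wall-crossing formulas *)

Lemma crossing_ratioE (F : fieldType) (sA sB sT sAd sBd sTd : F) :
  (sA * sB * sTd) / (sAd * sBd * sT) = sTd / sT / ((sAd / sA) * (sBd / sB)).
Proof. by rewrite !invfM !invrK; ring. Qed.

Lemma crossing_scale (F : fieldType) (e k x c q y1 y2 w : F) :
  y2 - y1 = k * x -> e ^+ 2 * w = c * (x / q) ->
  c * (y2 / q) - c * (y1 / q) = e ^+ 2 * k * w.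
Proof.
move=> h hw; have -> : e ^+ 2 * k * w = k * (e ^+ 2 * w) by ring.
by rewrite hw -mulrBr -mulrBl h; ring.
Qed.

Section WallCrossing.
Context (K : numFieldType) (m n : nat) (I : {set 'I_m}) (J : {set 'I_n})
  (c1 c2 : set (hpoint m n)) (q1 q2 : poly_series m n K)
  (mu : m.-tuple nat) (nu : n.-tuple nat).
Local Notation F := {fraction mps n K}.
Local Notation p := ((mu, nu) : hpoint m n).
Hypotheses (wall : is_wall I J) (adj : adjacent I J c1 c2)
  (hq1 : is_chamber_series c1 q1) (hq2 : is_chamber_series c2 q2) (cp : c2 p).

Let d : nat := `|delta I J p|%N.
Let s (x : mps n K) : F := (varsigma x)%:F.
Local Notation zJ := (zsum K J).
Local Notation zJc := (zsum K (~: J)%SET).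
Local Notation zn := (zsum K [set: 'I_n]).
Local Notation mu1 := (sub_tuple I mu).
Local Notation nu1 := [tuple of rcons (sub_tuple J nu) d].
Local Notation z1 := [tuple of rcons (sub_tuple J (z_ n K)) 0].
Local Notation mu2 := [tuple of rcons (sub_tuple (~: I)%SET mu) d].
Local Notation nu2 := (sub_tuple (~: J)%SET nu).
Local Notation z2 := (sub_tuple (~: J)%SET (z_ n K)).

Let delta_gt0 : 0 < delta I J p. Proof. by case: adj => _ _ _ h _; apply: h. Qed.
Let dE : energy p (sum_set I J) = d%:Z.
Proof. by rewrite energy_sum_set /d gez0_abs // ltW. Qed.
Let d_gt0 : (0 < d)%N. Proof. by rewrite /d absz_gt0 lt0r_neq0 ?delta_gt0. Qed.

Definition crossing_ratio : F :=
  s (zn *+ d) / s zn / ((s (zJ *+ d) / s zJ) * (s (zJc *+ d) / s zJc)).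

(** The crossing for the word of single letters, whose restrictions to the two sides, completed by
    the energies [- d] and [d], are the correlators of the two factors. *)
Lemma correlator_difference :
  (qeval q2 p)%:F - (qeval q1 p)%:F =
  crossing_ratio * (correlator mu1 nu1 z1 * correlator mu2 nu2 z2).
Proof.
have [hc1 hc2 _ _ _] := adj; have hp : in_H p := chamber_in_H hc2 cp.
have [p1 cp1 _] := hc1.
have w := word_composition m n.
have nw : word [set: 'I_m] [set: 'I_n] != [::].
  have /andP[nA _] : nontrivial (sum_set I J) by apply/is_wall_sum_set.
  apply: contraNneq nA => e; rewrite e /= in w.
  by rewrite -finset.subset0 -(eqP w) finset.subsetT.
have hh t : c1 (line p p1 t) -> corr K (line p p1 t) (word [set: 'I_m] [set: 'I_n])
    = (qeval q1 (line p p1 t))%:F.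
  by move=> ct; rewrite corr_word; apply: hq1.
have := correlator_crossing wall adj cp cp1 w nw (word_split I J)
  (poly_family_qeval q1 p p1) hh.
have -> : line p p1 0 = p.
  by congr pair; apply: eq_from_tnth => i; rewrite tnth_mktuple mul0n addn0.
rewrite corr_word (hq2 cp) sum_setC !restr_word dE.
rewrite (corrA_word K dE) (corrB_word K dE d_gt0 hp) -sum_setT.
by rewrite !zblock_sum_set -!pmulrn.
Qed.

Lemma series_coef_crossing (a : nat -> nat -> F) (b : nat -> mps n K -> F)
    (h : F -> mps n F) (f g : mps n.+1 F) :
  a d 0%N = 1 -> b d 0 = 1 ->
  (forall X M, h X M = series_coef mu nu (z_ n K) X id a b M) ->
  (forall M, f M = series_coef mu1 nu1 z1 (correlator mu1 nu1 z1) (@sigma1 n J) a b M) ->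
  (forall M, g M = series_coef mu2 nu2 z2 (correlator mu2 nu2 z2) (@sigma2 n J) a b M) ->
  h (qeval q2 p)%:F - h (qeval q1 p)%:F =
  (d%:R ^+ 2 * ((s zJ * s zJc * s (zn *+ d)) / (s (zJ *+ d) * s (zJc *+ d) * s zn)))
    *: last_coef 0 (f * g).
Proof.
move=> a0 b0 hE fE gE; apply: mpsP => M.
rewrite mpsE_add mpsE_opp mpsE_scale !hE.
have nd : d%:R != 0 :> F.
  rewrite -(rmorph_nat (@tofrac (mps n K))) tofrac_eq0; apply/eqP.
  move=> /(congr1 (fun f : mps n K => f 0%MM)); rewrite mps_natE mps1E eqxx => /eqP.
  by rewrite pnatr_eq0 eqn0Ngt d_gt0.
have := split_series_coef M a0 b0 nd fE gE.
have id_supp : msupported id M.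
  by apply/forallP => i; apply/orP; left; apply/codomP; exists i.
rewrite /series_coef id_supp crossing_ratioE => hw.
exact: crossing_scale correlator_difference hw.
Qed.

Let calS0_frac k : (calS (0 : mps n K))%:F ^+ k = 1.
Proof. by rewrite calS0 tofrac1 expr1n. Qed.

Let fact_neq0 k : k`!%:R != 0 :> F.
Proof.
rewrite -(rmorph_nat (@tofrac (mps n K))) tofrac_eq0; apply/eqP.
move=> /(congr1 (fun f : mps n K => f 0%MM)); rewrite mps_natE mps1E eqxx => /eqP.
by rewrite pnatr_eq0 eqn0Ngt fact_gt0.
Qed.

Let tnth_u j : tnth (u_ n K) j = mpsX F (id j). Proof. exact: tnth_mktuple. Qed.

Local Notation u1 := [tuple of rcons (sub_tuple J (u_ext n K)) (u' n K)].
Local Notation u2 := (sub_tuple (~: J)%SET (u_ext n K)).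
Local Notation factor :=
  (d%:R ^+ 2 * ((s zJ * s zJc * s (zn *+ d)) / (s (zJ *+ d) * s (zJc *+ d) * s zn))).

Lemma wall_crossing_le :
  WCle q1 q2 p = factor *: last_coef 0 (Hle mu1 nu1 u1 z1 * Hle mu2 nu2 u2 z2).
Proof.
apply: (@series_coef_crossing (@le_weight K n) (@le_S K n)
  (fun X => Hle_with mu nu (u_ n K) (z_ n K) X)).
- by rewrite /le_weight add0n divff ?fact_neq0.
- exact: calS0_frac.
- by move=> X M; apply: Hle_coef tnth_u M; apply: inj_id.
- by move=> M; apply: Hle_coef (@tnth_u1 K n J) M; apply: sigma1_inj.
- by move=> M; apply: Hle_coef (@tnth_u2 K n J) M; apply: sigma2_inj.
Qed.

Lemma wall_crossing_lt :
  WClt q1 q2 p = factor *: last_coef 0 (Hlt mu1 nu1 u1 z1 * Hlt mu2 nu2 u2 z2).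
Proof.
apply: (@series_coef_crossing (@lt_weight K n) (@lt_S K n)
  (fun X => Hlt_with mu nu (u_ n K) (z_ n K) X)).
- by rewrite /lt_weight leq0n subn0 divff ?fact_neq0.
- by rewrite /lt_S calS0_frac invr1.
- by move=> X M; apply: Hlt_coef tnth_u M; apply: inj_id.
- by move=> M; apply: Hlt_coef (@tnth_u1 K n J) M; apply: sigma1_inj.
- by move=> M; apply: Hlt_coef (@tnth_u2 K n J) M; apply: sigma2_inj.
Qed.

End WallCrossing.

Theorem theorem5p6 (R : realType) (m n : nat)
    (I : {set 'I_m}) (J : {set 'I_n}) (c1 c2 : set (hpoint m n))
    (q1 q2 : poly_series m n R[i]) (mu : m.-tuple nat) (nu : n.-tuple nat) :
  is_wall I J ->
  adjacent I J c1 c2 ->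
  is_chamber_series c1 q1 ->
  is_chamber_series c2 q2 ->
  c2 (mu, nu) ->
  let d : nat := `|delta I J (mu, nu)|%N in
  let s : mps n R[i] -> {fraction mps n R[i]} := fun x => (varsigma x)%:F in
  let zJ : mps n R[i] := zsum R[i] J in
  let zJc : mps n R[i] := zsum R[i] (~: J) in
  let zn : mps n R[i] := zsum R[i] [set: 'I_n] in
  let factor : {fraction mps n R[i]} :=
    d%:R ^+ 2 * ((s zJ * s zJc * s (zn *+ d))
                 / (s (zJ *+ d) * s (zJc *+ d) * s zn)) in
  let mu1 := sub_tuple I mu in
  let nu1 := [tuple of rcons (sub_tuple J nu) d] in
  let u1 := [tuple of rcons (sub_tuple J (u_ext n R[i])) (u' n R[i])] in
  let z1 := [tuple of rcons (sub_tuple J (z_ n R[i])) 0] in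
  let mu2 := [tuple of rcons (sub_tuple (~: I) mu) d] in
  let nu2 := sub_tuple (~: J) nu in
  let u2 := sub_tuple (~: J) (u_ext n R[i]) in
  let z2 := sub_tuple (~: J) (z_ n R[i]) in
  WCle q1 q2 (mu, nu)
    = factor *: last_coef 0 (Hle mu1 nu1 u1 z1 * Hle mu2 nu2 u2 z2)
  /\
  WClt q1 q2 (mu, nu)
    = factor *: last_coef 0 (Hlt mu1 nu1 u1 z1 * Hlt mu2 nu2 u2 z2).
Proof.
move=> wall adj hq1 hq2 cp d s zJ zJc zn factor mu1 nu1 u1 z1 mu2 nu2 u2 z2.
split.
  exact: (wall_crossing_le wall adj hq1 hq2 cp).
exact: (wall_crossing_lt wall adj hq1 hq2 cp).
Qed.
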